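(* Let $L(s)$ be a function, holomorphic in the strip $D=\{s\in\mathbb{C}: 1/2<\Re(s)<1\}$, which is hybridly universal. Let $l\ge 1$ be an integer and let $P_s\in\mathcal{D}_s[X_0,X_1,\ldots,X_l]$ be a polynomial such that the degree of $P_s$ in at least one of the variables $X_1,\ldots,X_l$ is greater than zero. Then for any $1/2<\sigma_1<\sigma_2<1$ there exists a constant $C_1>0$ such that for all sufficiently large $T$, the function $P_s\bigl(L(s),L^{(1)}(s),\ldots,L^{(l)}(s)\bigr)$ has more than $C_1T$ zeros in the rectangle $\sigma_1<\Re(s)<\sigma_2$, $0<\Im(s)<T$.
   Context: A general Dirichlet series is a series $\sum_{n=1}^\infty a_n e^{-\lambda_n s}$ with $a_n\in\mathbb{C}$, $\lambda_n\in\mathbb{R}$. $\mathcal{D}_s$ denotes the ring of all general Dirichlet series which converge absolutely in the half-plane $\Re(s)>1/2$, and $\mathcal{D}_s[X_0,\ldots,X_l]$ is the ring of polynomials in $X_0,\ldots,X_l$ with coefficients in $\mathcal{D}_s$; $P_s(L(s),L^{(1)}(s),\ldots,L^{(l)}(s))$ denotes the function obtained by substituting $X_j=L^{(j)}(s)$ (the $j$-th derivative of $L$, with $L^{(0)}=L$) and evaluating the coefficients at $s$. For $T>0$, $\nu_T\{\cdots\}:=T^{-1}\mu\{\tau\in[0,T]:\cdots\}$ where $\mu$ is Lebesgue measure; $\Vert x\Vert$ denotes the distance from $x$ to the nearest integer. $L$ is called hybridly universal if: for every compact set $K\subset D$ with connected complement, every function $f$ that is non-vanishing and continuous on $K$ and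 analytic in the interior of $K$, every finite collection of real numbers $\alpha_1,\ldots,\alpha_k$ linearly independent over $\mathbb{Q}$, every real numbers $\theta_1,\ldots,\theta_k$ and every $\varepsilon>0$, $$\liminf_{T\to\infty}\nu_T\Bigl\{\max_{s\in K}|L(s+i\tau)-f(s)|<\varepsilon,\ \Vert\tau\alpha_j-\theta_j\Vert<\varepsilon \ (1\le j\le k)\Bigr\}>0.$$ *)

(* Defs.v *)
From HB Require Import structures.
From mathcomp Require Import all_boot all_order all_algebra.
From mathcomp Require Import all_classical all_reals all_analysis.
From mathcomp Require Import complex.
(* The notations of mpoly clash with those of mathcomp-analysis. *)
From mathcomp Require Import(canonicals,coercions) mpoly.

Set Implicit Arguments.
Unset Strict Implicit.
Unset Printing Implicit Defensive.

Import Order.TTheory GRing.Theory Num.Theory numFieldNormedType.Exports.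

Local Open Scope classical_set_scope.
Local Open Scope complex_scope.
Local Open Scope ring_scope.

(* R[i] is packed as a numClosedFieldType so that it inherits the topology and
   normed structure over itself; hence derivatives below are complex ones. *)
Definition Cplx (R : realType) : numClosedFieldType := R[i].

Definition cexp (R : realType) (z : Cplx R) : Cplx R :=
  (expR (complex.Re z) * cos (complex.Im z)) +i*
  (expR (complex.Re z) * sin (complex.Im z)).

Definition strip (R : realType) : set (Cplx R) :=
  [set s : Cplx R | 2^-1 < complex.Re s < 1].

Definition holomorphic_on (R : realType) (U : set (Cplx R))
    (f : Cplx R -> Cplx R) : Prop :=
  forall s, U s -> derivable f s 1.

Definition nu (R : realType) (T : R) (A : set R) : \bar R :=
  ((T^-1)%:E * lebesgue_measure (`[0%R, T]%classic `&` A))%E.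

Definition dist_int (R : realType) (x : R) : R :=
  inf [set `|x - n%:~R| | n in [set: int]].

Definition lin_indep_rat (R : realType) (k : nat) (alpha : 'I_k -> R) : Prop :=
  forall q : 'I_k -> rat,
    \sum_(j < k) ratr (q j) * alpha j = 0 -> forall j, q j = 0.

Definition hybrid_approx (R : realType) (L f : Cplx R -> Cplx R)
    (K : set (Cplx R)) (k : nat) (alpha theta : 'I_k -> R) (eps : R) : set R :=
  [set tau : R |
     (forall s : Cplx R, K s -> `|L (s + (0 +i* tau)) - f s| < eps%:C) /\
     (forall j : 'I_k, dist_int (tau * alpha j - theta j) < eps)].

Definition hybridly_universal (R : realType) (L : Cplx R -> Cplx R) : Prop :=
  forall (K : set (Cplx R)) (f : Cplx R -> Cplx R),
    compact K -> K `<=` @strip R -> connected (~` K) ->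
    {within K, continuous f} -> (forall s, K s -> f s != 0) ->
    holomorphic_on K^° f ->
  forall (k : nat) (alpha theta : 'I_k -> R) (eps : R),
    lin_indep_rat alpha -> 0 < eps ->
  (0 < limf_einf (fun T : R => nu T (hybrid_approx L f K alpha theta eps))
         (pinfty_nbhs R))%E.

Definition halfplane (R : realType) : Type :=
  {s : Cplx R | 2^-1 < complex.Re s}.

Lemma half_lt_Re1 (R : realType) : 2^-1 < complex.Re (1 : Cplx R).
Proof. by rewrite /= invf_lt1 ?ltr1n. Qed.

HB.instance Definition _ (R : realType) := Choice.on (halfplane R).
(* The base point makes [halfplane R -> Cplx R] a nontrivial ring. *)
HB.instance Definition _ (R : realType) :=
  isPointed.Build (halfplane R) (Sub (1 : Cplx R) (half_lt_Re1 R)).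

(* Dirichlet series are identified with their sum functions on the half-plane,
   under pointwise addition and multiplication. *)
Definition hpfun (R : realType) : comNzRingType := halfplane R -> Cplx R.

Definition gdirichlet_term (R : realType) (a : nat -> Cplx R) (lam : nat -> R)
    (s : Cplx R) (n : nat) : Cplx R :=
  a n * cexp (- ((lam n)%:C * s)).

Definition gdirichlet (R : realType) : {pred hpfun R} :=
  fun g : halfplane R -> Cplx R =>
    `[< exists (a : nat -> Cplx R) (lam : nat -> R), forall s : halfplane R,
          cvgn [normed series (gdirichlet_term a lam (val s))] /\
          series (gdirichlet_term a lam (val s)) @ \oo --> g s >].

Definition degree_in (A : nzRingType) (n : nat) (j : 'I_n) (P : mpoly.mpoly n A)
    : nat :=
  \max_(m <- mpoly.msupp P) m j.

Definition diff_poly (R : realType) (l : nat) (P : mpoly.mpoly l.+1 (hpfun R))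
    (L : Cplx R -> Cplx R) (s : halfplane R) : Cplx R :=
  mpoly.meval (fun j : 'I_l.+1 => derive1n j L (val s))
    (mpoly.map_mpoly (fun c : halfplane R -> Cplx R => c s) P).

Definition more_than (R : realType) (T : eqType) (x : R) (A : set T) : Prop :=
  exists zs : seq T,
    [/\ uniq zs, x < (size zs)%:R & forall z, z \in zs -> A z].

Definition zeros_in_rect (R : realType) (l : nat)
    (P : mpoly.mpoly l.+1 (hpfun R)) (L : Cplx R -> Cplx R)
    (sigma1 sigma2 T : R) : set (halfplane R) :=
  [set s : halfplane R | [/\ sigma1 < complex.Re (val s) < sigma2,
                             0 < complex.Im (val s) < T
                           & diff_poly P L s = 0]].

(* Main.v *)
(** Pick a point s0 of the strip and a polynomial f, zero-free on a small square
    around s0, whose jet at s0 annihilates P_{s0} while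
    F(s) = P_s(f(s), f'(s), ...) is not identically zero; such an f exists
    because P_{s0} depends on a derivative variable and there is freedom in the
    higher Taylor coefficients.  The exponents of the finitely many relevant
    Dirichlet terms are integer combinations of rationally independent numbers
    alpha_j, so when tau alpha_j is close to integers the coefficients are almost
    unchanged by the shift s -> s + i tau.  Hybrid universality and Cauchy's
    estimates then give a set of shifts tau of positive lower density for which
    P_{s+i tau}(L(s+i tau), ...) is uniformly close to F(s) on a disc around s0,
    hence has a zero there; shifts in separated unit cells give distinct zeros.

    The complex analysis needed rests on Goursat's theorem for rectangles: in
    the coordinate w = log(z - c) it yields the mean value inequality, and from
    it Cauchy's estimates, smoothness, factorisation of zeros and the existence
    of zeros of small perturbations. *)

Require Import Defs.
From HB Require Import structures.
From mathcomp Require Import all_boot all_order all_algebra.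
From mathcomp Require Import all_classical all_reals all_analysis.
From mathcomp Require Import complex ring lra zify.
From mathcomp Require Import(canonicals,coercions) mpoly.
Import Order.TTheory GRing.Theory Num.Theory numFieldNormedType.Exports.
Local Open Scope classical_set_scope.
Local Open Scope complex_scope.
Local Open Scope ring_scope.

Set Implicit Arguments.
Unset Strict Implicit.
Unset Printing Implicit Defensive.

(** * The modulus and complex derivatives *)

(** The analytic tool is one inequality: if q is holomorphic in a punctured disc and tends to A at
    the centre, then |A| is at most the maximum of |q| on the circle. The puncture admits difference
    quotients, which gives Cauchy's estimate; applied to 1/F the inequality produces zeros with no
    winding number or Rouche argument; applied to the quotients F/(z-c)^n it replaces power series.

    Two obstacles shape the arithmetic side. The exponents are arbitrary reals, possibly rationally
    dependent, while universality accepts only independent alpha_j; hence a rational basis with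
    denominators cleared. And a coefficient known to be nonzero somewhere in Re s > 1/2 has to be
    nonzero somewhere between sigma1 and sigma2; hence an identity theorem.

    The derivative variable matters because universality approximates zero-free functions only: the
    equation at s0 is solved for some X_i with i >= 1, which leaves X_0 = f(s0) nonzero. Finally,
    density becomes a count by covering the shifts with unit cells, so that monotonicity and
    subadditivity of the measure suffice. *)

(** The norm of [Cplx R] takes its values in [Cplx R]; a modulus in [R] gives access to the total
    order and to real arithmetic. *)
Definition cabs (R : realType) (z : Cplx R) : R := complex.Re `|z|.

Section Modulus.
Variable R : realType.
Local Notation C := (Cplx R).
Implicit Types (x y z w : C) (f g : C -> C).

Lemma cplx_normE z : `|z| = (cabs z)%:C.
Proof. by rewrite /cabs; apply/esym/(@RRe_real R)/normr_real. Qed.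

Lemma cabs_ge0 z : 0 <= cabs z.
Proof. by have := normr_ge0 z; rewrite cplx_normE ler0c. Qed.

Lemma cabsM z w : cabs (z * w) = cabs z * cabs w.
Proof. by apply: (@complexI R); rewrite -cplx_normE normrM !cplx_normE rmorphM. Qed.

Lemma cabsD z w : cabs (z + w) <= cabs z + cabs w.
Proof. by rewrite -lecR rmorphD /= -!cplx_normE ler_normD. Qed.

Lemma cabsN z : cabs (- z) = cabs z.
Proof. by rewrite /cabs normrN. Qed.

Lemma cabsB z w : cabs (z - w) <= cabs z + cabs w.
Proof. by rewrite -[cabs w]cabsN cabsD. Qed.

Lemma cabs_distC z w : cabs (z - w) = cabs (w - z).
Proof. by rewrite /cabs distrC. Qed.

Lemma cabs0 : cabs (0 : C) = 0.
Proof. by rewrite /cabs normr0. Qed.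

Lemma cabs1 : cabs (1 : C) = 1.
Proof. by rewrite /cabs normr1. Qed.

Lemma cabs_eq0 z : (cabs z == 0) = (z == 0).
Proof.
rewrite -[z == 0]normr_eq0 cplx_normE; apply/eqP/eqP => [->//|].
exact: (@complexI R).
Qed.

Lemma cabs_gt0 z : (0 < cabs z) = (z != 0).
Proof. by rewrite lt_neqAle cabs_ge0 andbT eq_sym cabs_eq0. Qed.

Lemma cabsX z n : cabs (z ^+ n) = cabs z ^+ n.
Proof. by elim: n => [|n IH]; rewrite ?expr0 ?cabs1// !exprS cabsM IH. Qed.

Lemma cabsV z : cabs z^-1 = (cabs z)^-1.
Proof. by apply: (@complexI R); rewrite -cplx_normE normfV cplx_normE fmorphV. Qed.

Lemma cabs_real (a : R) : cabs (a%:C : C) = `|a|.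
Proof. by rewrite /cabs normc_def/= expr0n addr0 sqrtr_sqr. Qed.

Lemma cabs_nat n : cabs (n%:R : C) = n%:R.
Proof. by rewrite -[n%:R : C](rmorph_nat (real_complex R)) cabs_real normr_nat. Qed.

Lemma cabs_i : cabs ('i%C : C) = 1.
Proof. by rewrite /cabs normc_def/= expr0n/= add0r expr1n sqrtr1. Qed.

Lemma ler_Re_cabs z : `|complex.Re z| <= cabs z.
Proof. by rewrite -lecR -cplx_normE; exact: normc_ge_Re. Qed.

Lemma ler_Im_cabs z : `|complex.Im z| <= cabs z.
Proof.
have -> : complex.Im z = complex.Re (- 'i%C * z).
  by case: z => a b /=; rewrite oppr0 mul0r mulN1r opprK add0r.
by rewrite (le_trans (ler_Re_cabs _))// cabsM cabsN cabs_i mul1r.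
Qed.

Lemma cabs_le_ReIm z : cabs z <= `|complex.Re z| + `|complex.Im z|.
Proof.
rewrite [z in cabs z]complexE (le_trans (cabsD _ _))//.
by rewrite cabsM cabs_i mul1r !cabs_real.
Qed.

Lemma cabs_dist_le z w : cabs z - cabs w <= cabs (z - w).
Proof. by rewrite lerBlDr (le_trans _ (cabsD _ _))// subrK. Qed.

Lemma cabs_sum (I : Type) (r : seq I) (P : pred I) (F : I -> C) :
  cabs (\sum_(i <- r | P i) F i) <= \sum_(i <- r | P i) cabs (F i).
Proof.
elim/big_ind2: _ => [|x a y b xa yb|//]; first by rewrite cabs0.
by rewrite (le_trans (cabsD _ _))// lerD.
Qed.

Lemma nbhs_cabsP z (P : set C) :
  nbhs z P <-> exists2 e : R, 0 < e & forall w, cabs (w - z) < e -> P w.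
Proof.
split=> [/nbhs_ballP[e /= e0 eP]|[e e0 eP]].
  (* A radius that is positive for the partial order of [Cplx R] is real. *)
  have [k ek] : exists k : R, e = k%:C.
    by apply/complex_realP; exact: gtr0_real.
  exists k; first by move: e0; rewrite ek ltcR.
  by move=> w wz; apply: eP; rewrite /ball/= cplx_normE ek ltcR cabs_distC.
apply/nbhs_ballP; exists e%:C; first by rewrite /= ltcR.
by move=> w; rewrite /ball/= cplx_normE ltcR cabs_distC => /eP.
Qed.

Lemma cplx_continuousP f z : {for z, continuous f} <->
  (forall e : R, 0 < e -> exists2 d : R, 0 < d &
     forall w, cabs (w - z) < d -> cabs (f w - f z) < e).
Proof.
split=> [fz e e0|fz P /nbhs_cabsP [e e0 eP]].
  have /fz/nbhs_cabsP[d d0 dP] : nbhs (f z) [set w : C | cabs (w - f z) < e].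
    by apply/nbhs_cabsP; exists e.
  by exists d.
have [d d0 dP] := fz _ e0.
by apply/nbhs_cabsP; exists d => // w /dP /eP.
Qed.

Lemma real_cplx_continuousP (g : R -> C) (t : R) : {for t, continuous g} <->
  (forall e : R, 0 < e -> exists2 d : R, 0 < d &
     forall s, `|s - t| < d -> cabs (g s - g t) < e).
Proof.
split=> [fz e e0|fz P /nbhs_cabsP [e e0 eP]].
  have /fz/nbhs_ballP[d d0 dP] : nbhs (g t) [set w : C | cabs (w - g t) < e].
    by apply/nbhs_cabsP; exists e.
  by exists d => // s st; apply: dP; rewrite /ball/= distrC.
have [d d0 dP] := fz _ e0.
apply/nbhs_ballP; exists d => // s; rewrite /ball/= distrC => /dP /eP //.
Qed.

(** The division-free form also covers [h = 0], so that first-order errors can be added and compared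
    without side conditions. *)
Lemma cplx_deriveP f z d : is_derive z 1 f d <->
  (forall e : R, 0 < e -> exists2 r : R, 0 < r &
     forall h, cabs h < r -> cabs (f (z + h) - f z - d * h) <= e * cabs h).
Proof.
have E (k h : C) : h != 0 -> cabs (h^-1 *: (f (h *: 1 + z) - f z) - k) =
    cabs (f (z + h) - f z - k * h) / cabs h.
  move=> h0; rewrite -cabsV -cabsM [h *: 1]mulr1 [h + z]addrC; congr cabs.
  by rewrite [_ *: _]mulrC [in RHS]mulrBl mulfK.
split=> [[fd <-] e e0|H].
  have /fd/nbhs_cabsP[r /= r0 rP] :
     nbhs ('D_1 f z) [set w : C | cabs (w - 'D_1 f z) < e].
    by apply/nbhs_cabsP; exists e.
  exists r => // h hr; have [->|h0] := eqVneq h 0.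
    by rewrite addr0 subrr mulr0 subr0 cabs0 mulr0 lexx.
  have := rP h; rewrite subr0 => /(_ hr h0) /=; rewrite E//.
  by rewrite ltr_pdivrMr ?cabs_gt0// => /ltW.
suff fd : h^-1 *: ((f \o shift z) (h *: 1) - f z) @[h --> 0^'] --> d.
  by apply: (@DeriveDef _ _ _ _ _ _ _); [exact: (cvgP d)|exact: cvg_lim].
move=> P /nbhs_cabsP[e e0 eP].
have [r r0 rP] := H (e / 2) ltac:(lra).
apply/nbhs_cabsP; exists r => //= h hr h0; apply: eP.
rewrite /= E// (@le_lt_trans _ _ (e / 2))//; last by lra.
by rewrite ler_pdivrMr ?cabs_gt0// rP//; rewrite subr0 in hr.
Qed.

Lemma cplx_derive_continuous f z d : is_derive z 1 f d -> {for z, continuous f}.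
Proof. by move=> [fz _]; exact/differentiable_continuous/derivable1_diffP. Qed.

Lemma cplx_is_derive_near f g z d (r : R) : 0 < r ->
  (forall w, cabs (w - z) < r -> f w = g w) ->
  is_derive z 1 f d -> is_derive z 1 g d.
Proof.
by move=> r0 fg; apply: near_eq_is_derive; apply/nbhs_cabsP; exists r.
Qed.

Lemma cplx_is_derive_comp f g z d e :
  is_derive (g z) 1 f d -> is_derive z 1 g e -> is_derive z 1 (f \o g) (d * e).
Proof.
move=> /cplx_deriveP fd /cplx_deriveP ge; apply/cplx_deriveP => eps eps0.
have m0 : 0 < cabs e + 1 by rewrite ltr_wpDl ?cabs_ge0.
have n0 : 0 < cabs d + 1 by rewrite ltr_wpDl ?cabs_ge0.
(* Half of [eps] pays for the error of [f] at the increment of [g], half for the error of [g]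
   magnified by [cabs d]. The tolerance 1 bounds that increment by [(cabs e + 1) * cabs h]. *)
have [r1 r10 H1] := fd (eps / 2 / (cabs e + 1)) ltac:(by rewrite !divr_gt0).
have [r2 r20 H2] := ge _ ltr01.
have [r3 r30 H3] := ge (eps / 2 / (cabs d + 1)) ltac:(by rewrite !divr_gt0).
exists (Num.min r2 (Num.min r3 (r1 / (cabs e + 1)))).
  by rewrite !lt_min r20 r30 divr_gt0.
move=> h; rewrite !lt_min => /and3P[/H2 {}H2 /H3 {}H3].
rewrite ltr_pdivlMr// => hr1.
set k := g (z + h) - g z.
have kE : g (z + h) = g z + k by rewrite [RHS]addrC subrK.
have kh : cabs k <= (cabs e + 1) * cabs h.
  have -> : k = (k - e * h) + e * h by rewrite subrK.
  by rewrite (le_trans (cabsD _ _))// cabsM mulrDl addrC lerD2l.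
rewrite /= kE.
have -> : f (g z + k) - f (g z) - d * e * h =
   (f (g z + k) - f (g z) - d * k) + d * (k - e * h) by ring.
rewrite (le_trans (cabsD _ _))// [eps in _ <= eps * _](splitr eps) mulrDl lerD//.
  rewrite (le_trans (H1 _ _))//; first by rewrite (le_lt_trans kh)// mulrC.
  by rewrite mulrAC ler_pdivrMr// -[leRHS]mulrA ler_pM2l ?divr_gt0// mulrC.
rewrite cabsM (le_trans (ler_wpM2l (cabs_ge0 _) H3))//.
rewrite mulrA ler_wpM2r ?cabs_ge0// mulrCA ger_pMr ?divr_gt0//.
by rewrite ler_pdivrMr// mul1r lerDl.
Qed.

Lemma cplx_is_deriveV f z d : f z != 0 -> is_derive z 1 f d ->
  is_derive z 1 (fun w => (f w)^-1) (- d / f z ^+ 2).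
Proof.
move=> fz [fd <-]; apply: (@DeriveDef _ _ _ _ _ _ _); first exact: derivableV.
by rewrite deriveV// [_ *: _]mulrC mulrN mulNr.
Qed.

Lemma cplx_is_deriveM f g z d e :
  is_derive z 1 f d -> is_derive z 1 g e ->
  is_derive z 1 (fun w => f w * g w) (d * g z + f z * e).
Proof.
move=> fd ge; have := @is_deriveM _ _ f g _ _ _ _ fd ge.
by rewrite addrC [g z *: d]mulrC.
Qed.

Lemma cplx_is_deriveD f g z d e :
  is_derive z 1 f d -> is_derive z 1 g e ->
  is_derive z 1 (fun w => f w + g w) (d + e).
Proof. exact: is_deriveD. Qed.

Lemma cplx_is_deriveB f g z d e :
  is_derive z 1 f d -> is_derive z 1 g e ->
  is_derive z 1 (fun w => f w - g w) (d - e).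
Proof. exact: is_deriveB. Qed.

Lemma cplx_is_derive_shift f z a d :
  is_derive (z + a) 1 f d -> is_derive z 1 (fun w => f (w + a)) d.
Proof.
move=> /cplx_deriveP H; apply/cplx_deriveP => e e0; have [r r0 rP] := H _ e0.
by exists r => // h /rP; rewrite [z + a + h]addrAC.
Qed.

Lemma cplx_is_derive_horner (p : {poly C}) z :
  is_derive z 1 (horner p) p^`().[z].
Proof.
elim/poly_ind: p => [|p c IH].
  rewrite deriv0 horner0 (_ : horner 0 = cst 0); first exact: is_derive_cst.
  by apply/funext => w; rewrite horner0.
rewrite (_ : horner _ = fun w => p.[w] * w + c); last first.
  by apply/funext => w; rewrite hornerMXaddC.
rewrite derivD derivM derivX derivC mulr1 addr0 hornerD hornerMX.
rewrite -[X in is_derive _ _ _ X]addr0.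
apply: cplx_is_deriveD; rewrite -[X in _ + X]mulr1.
exact: cplx_is_deriveM.
Qed.

End Modulus.

(** * Integrals of complex-valued functions *)

Definition cint (R : realType) (g : R -> Cplx R) (a b : R) : Cplx R :=
  (\int[lebesgue_measure]_(t in `[a, b]) complex.Re (g t)) +i*
  (\int[lebesgue_measure]_(t in `[a, b]) complex.Im (g t)).

Section ComplexIntegral.
Variable R : realType.
Local Notation C := (Cplx R).
Implicit Types (g : R -> C) (a b t : R).

Definition continuous_on_seg g a b :=
  forall t, a <= t <= b -> {for t, continuous g}.

Lemma continuous_on_segD g h a b : continuous_on_seg g a b ->
  continuous_on_seg h a b -> continuous_on_seg (fun t => g t + h t) a b.
Proof. by move=> gc hc t tab; apply: cvgD; [exact: gc|exact: hc]. Qed.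

Lemma continuous_on_segB g h a b : continuous_on_seg g a b ->
  continuous_on_seg h a b -> continuous_on_seg (fun t => g t - h t) a b.
Proof. by move=> gc hc t tab; apply: cvgB; [exact: gc|exact: hc]. Qed.

Lemma continuous_on_seg_cst (k : C) a b : continuous_on_seg (fun=> k) a b.
Proof. by move=> t tab; exact: cvg_cst. Qed.

Lemma integrable_part (p : C -> R) g a b :
  (forall z, `|p z| <= cabs z) -> {morph p : z w / z - w} ->
  continuous_on_seg g a b ->
  lebesgue_measure.-integrable `[a, b] (EFin \o (p \o g)).
Proof.
move=> p_le pB gc.
apply: continuous_compact_integrable; first exact: segment_compact.
apply: continuous_in_subspaceT => t; rewrite inE/= in_itv/= => tab.
apply/cvgrPdist_lt => e e0.
have /real_cplx_continuousP/(_ _ e0)[d d0 dP] := gc t tab.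
apply/nbhs_ballP; exists d => //= s; rewrite /ball/= => st.
by rewrite distrC -pB (le_lt_trans (p_le _))// dP// distrC.
Qed.

Let ReB : {morph (@complex.Re R) : z w / z - w}.
Proof. by move=> [? ?] [? ?]. Qed.
Let ImB : {morph (@complex.Im R) : z w / z - w}.
Proof. by move=> [? ?] [? ?]. Qed.

Let integrable_Re g a b : continuous_on_seg g a b ->
  lebesgue_measure.-integrable `[a, b] (EFin \o (fun t => complex.Re (g t))).
Proof. exact: (integrable_part (@ler_Re_cabs R) ReB). Qed.
Let integrable_Im g a b : continuous_on_seg g a b ->
  lebesgue_measure.-integrable `[a, b] (EFin \o (fun t => complex.Im (g t))).
Proof. exact: (integrable_part (@ler_Im_cabs R) ImB). Qed.

Lemma eq_cint g h a b : (forall t, a <= t <= b -> g t = h t) ->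
  cint g a b = cint h a b.
Proof.
move=> gh; rewrite /cint; congr (_ +i* _);
  by apply: eq_Rintegral => t; rewrite inE/= in_itv/= => /gh ->.
Qed.

Lemma cintD g h a b : continuous_on_seg g a b -> continuous_on_seg h a b ->
  cint (fun t => g t + h t) a b = cint g a b + cint h a b.
Proof.
move=> gc hc; rewrite /cint; apply/eqP; rewrite eq_complex/=; apply/andP; split.
- rewrite -RintegralD//; [|exact: integrable_Re|exact: integrable_Re].
  by apply/eqP/eq_Rintegral => t _; case: (g t) (h t) => [? ?] [? ?].
- rewrite -RintegralD//; [|exact: integrable_Im|exact: integrable_Im].
  by apply/eqP/eq_Rintegral => t _; case: (g t) (h t) => [? ?] [? ?].
Qed.

Lemma cint_cst (k : C) a b : a <= b -> cint (fun=> k) a b = (b - a)%:C * k.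
Proof.
move=> ab; rewrite /cint !Rintegral_cst//= lebesgue_measure_itv/= lte_fin.
have -> : fine (if a < b then (b%:E - a%:E)%E else 0%E) = b - a.
  by case: ltgtP ab => // <-; rewrite subrr.
by case: k => p q; rewrite /= [LHS]/= mulrC [q * _]mulrC; simpc.
Qed.

Lemma cint_split g a b c : a <= b -> b <= c -> continuous_on_seg g a c ->
  cint g a c = cint g a b + cint g b c.
Proof.
move=> ab bc gc.
have S p : lebesgue_measure.-integrable `[a, c] (EFin \o p) ->
    \int[lebesgue_measure]_(t in `[a, c]) p t =
    \int[lebesgue_measure]_(t in `[a, b]) p t +
    \int[lebesgue_measure]_(t in `[b, c]) p t :> R.
  move=> ip; apply/eqP; rewrite addrC -subr_eq; apply/eqP.
  rewrite Rintegral_itvB ?bnd_simp// Rintegral_itv_obnd_cbnd//.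
  by apply: integrableS ip => //; apply: subset_itvr; rewrite bnd_simp.
rewrite /cint; apply/eqP; rewrite eq_complex/=; apply/andP; split; apply/eqP/S.
- exact: integrable_Re.
- exact: integrable_Im.
Qed.

(** Real and imaginary parts are bounded separately, which costs the factor 2;
    [removable_mean_value] later removes it by taking powers. *)
Lemma cabs_cint_le g a b M : a <= b -> continuous_on_seg g a b ->
  (forall t, a <= t <= b -> cabs (g t) <= M) ->
  cabs (cint g a b) <= 2 * (M * (b - a)).
Proof.
move=> ab gc gM.
have B p : lebesgue_measure.-integrable `[a, b] (EFin \o p) ->
    (forall t, a <= t <= b -> `|p t| <= M) ->
    `|\int[lebesgue_measure]_(t in `[a, b]) p t| <= M * (b - a) :> R.
  move=> ip pM; rewrite (le_trans (le_normr_Rintegral _ ip))//.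
  have -> : M * (b - a) = \int[lebesgue_measure]_(t in `[a, b]) M.
    rewrite Rintegral_cst//= lebesgue_measure_itv/= lte_fin.
    by case: ltgtP ab => // <-; rewrite subrr.
  apply: le_Rintegral; first exact: measurable_itv.
  - rewrite (_ : _ \o _ = abse \o (EFin \o p))//; exact: integrable_abse.
  - apply: continuous_compact_integrable; first exact: segment_compact.
    by apply: continuous_subspaceT => t; exact: cvg_cst.
  - by move=> t /=; rewrite in_itv/=; exact: pM.
rewrite (le_trans (cabs_le_ReIm _))//= mulrDl mul1r; apply: lerD; apply: B.
- exact: integrable_Re.
- by move=> t /gM; exact/le_trans/ler_Re_cabs.
- exact: integrable_Im.
- by move=> t /gM; exact/le_trans/ler_Im_cabs.
Qed.

End ComplexIntegral.

(** * Goursat's theorem *)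

Ltac cplx_ring := apply/eqP; rewrite eq_complex /=; apply/andP;
  split; apply/eqP; ring.

Section Goursat.
Variable R : realType.
Local Notation C := (Cplx R).
Implicit Types (h k : C -> C) (x y : R).

Lemma cplx_is_derive_affine (u v z : C) : is_derive z 1 (fun w => u + v * w) v.
Proof.
have M := cplx_is_deriveM (is_derive_cst v z 1) (is_derive_id (z : C) 1).
have := cplx_is_deriveD (is_derive_cst u z 1) M.
by rewrite mul0r !add0r mulr1.
Qed.

Lemma nested_segments (a b : nat -> R) : (forall n, a n <= a n.+1) ->
  (forall n, b n.+1 <= b n) -> (forall n, a n <= b n) ->
  exists c, forall n, a n <= c <= b n.
Proof.
move=> /nondecreasing_seqP amono /nonincreasing_seqP bmono ab.
have abnm n m : a n <= b m.
  apply: (le_trans (amono _ _ (leq_maxl n m))).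
  exact/(le_trans (ab _))/bmono/leq_maxr.
have hs : has_sup (range a).
  by split; [exists (a 0%N), 0%N|exists (b 0%N) => _ [n _ <-]].
exists (sup (range a)) => n; apply/andP; split.
  by apply: sup_upper_bound => //; exists n.
by apply: sup_le_ub => [|_ [m _ <-]]; [exists (a 0%N), 0%N|].
Qed.

Lemma exists_div_exp2_lt x (r : R) : 0 <= x -> 0 < r ->
  exists n, x / 2 ^+ n < r.
Proof.
move=> x0 r0; have xr0 : 0 <= x / r by rewrite divr_ge0// ltW.
exists (Num.bound (x / r)); rewrite ltr_pdivrMr ?exprn_gt0//.
rewrite mulrC -ltr_pdivrMr// (lt_trans (archi_boundP xr0))//.
by rewrite -natrX ltr_nat ltn_expl.
Qed.

(** The counterclockwise boundary integral, with opposite sides paired under one integral: dz is dt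
    on horizontal sides and i dt on vertical ones. *)
Definition rint h x1 x2 y1 y2 : C :=
  cint (fun t => h (t +i* y1) - h (t +i* y2)) x1 x2 +
  'i%C * cint (fun t => h (x2 +i* t) - h (x1 +i* t)) y1 y2.

Definition continuous_on_rect h x1 x2 y1 y2 := forall x y,
  x1 <= x <= x2 -> y1 <= y <= y2 -> {for (x +i* y : C), continuous h}.

Lemma continuous_on_hseg h x1 x2 y1 y2 y : y1 <= y <= y2 ->
  continuous_on_rect h x1 x2 y1 y2 ->
  continuous_on_seg (fun t => h (t +i* y)) x1 x2.
Proof.
move=> yy hc t tx; have /cplx_continuousP H := hc _ _ tx yy.
apply/real_cplx_continuousP => e /H[d d0 dP]; exists d => // s st; apply: dP.
by rewrite (_ : _ - _ = (s - t)%:C) ?cabs_real//; cplx_ring.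
Qed.

Lemma continuous_on_vseg h x1 x2 y1 y2 x : x1 <= x <= x2 ->
  continuous_on_rect h x1 x2 y1 y2 ->
  continuous_on_seg (fun t => h (x +i* t)) y1 y2.
Proof.
move=> xx hc t ty; have /cplx_continuousP H := hc _ _ xx ty.
apply/real_cplx_continuousP => e /H[d d0 dP]; exists d => // s st; apply: dP.
rewrite (_ : _ - _ = 'i%C * (s - t)%:C); last by cplx_ring.
by rewrite cabsM cabs_i mul1r cabs_real.
Qed.

Lemma continuous_on_rectS h x1 x2 y1 y2 a1 a2 b1 b2 :
  x1 <= a1 -> a2 <= x2 -> y1 <= b1 -> b2 <= y2 ->
  continuous_on_rect h x1 x2 y1 y2 -> continuous_on_rect h a1 a2 b1 b2.
Proof. by move=> ? ? ? ? hc x y xa yb; apply: hc; lra. Qed.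

Let hdiff h x1 x2 y1 y2 y y' : y1 <= y <= y2 -> y1 <= y' <= y2 ->
  continuous_on_rect h x1 x2 y1 y2 ->
  continuous_on_seg (fun t => h (t +i* y) - h (t +i* y')) x1 x2.
Proof.
by move=> yy yy' hc; apply: continuous_on_segB; exact: continuous_on_hseg hc.
Qed.

Let vdiff h x1 x2 y1 y2 x x' : x1 <= x <= x2 -> x1 <= x' <= x2 ->
  continuous_on_rect h x1 x2 y1 y2 ->
  continuous_on_seg (fun t => h (x +i* t) - h (x' +i* t)) y1 y2.
Proof.
by move=> xx xx' hc; apply: continuous_on_segB; exact: continuous_on_vseg hc.
Qed.

Lemma rint_splitx h x1 x2 y1 y2 m : x1 <= m <= x2 -> y1 <= y2 ->
  continuous_on_rect h x1 x2 y1 y2 ->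
  rint h x1 x2 y1 y2 = rint h x1 m y1 y2 + rint h m x2 y1 y2.
Proof.
move=> xm yy hc; have /andP[x1m mx2] := xm.
rewrite /rint (@cint_split _ _ x1 m x2)//; last by apply: hdiff hc; lra.
rewrite [X in _ + _ * X](_ : _ =
    cint (fun t => h (m +i* t) - h (x1 +i* t)) y1 y2 +
    cint (fun t => h (x2 +i* t) - h (m +i* t)) y1 y2); first by ring.
rewrite -cintD; [|by apply: vdiff hc; lra|by apply: vdiff hc; lra].
by apply: eq_cint => t _; rewrite [RHS]addrC addrA subrK.
Qed.

Lemma rint_splity h x1 x2 y1 y2 m : x1 <= x2 -> y1 <= m <= y2 ->
  continuous_on_rect h x1 x2 y1 y2 ->
  rint h x1 x2 y1 y2 = rint h x1 x2 y1 m + rint h x1 x2 m y2.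
Proof.
move=> xx ym hc; have /andP[y1m my2] := ym.
rewrite /rint (@cint_split _ _ y1 m y2)//; last by apply: vdiff hc; lra.
rewrite [X in X + _](_ : _ =
    cint (fun t => h (t +i* y1) - h (t +i* m)) x1 x2 +
    cint (fun t => h (t +i* m) - h (t +i* y2)) x1 x2); first by ring.
rewrite -cintD; [|by apply: hdiff hc; lra|by apply: hdiff hc; lra].
by apply: eq_cint => t _; rewrite addrA subrK.
Qed.

Lemma rintD h k x1 x2 y1 y2 : x1 <= x2 -> y1 <= y2 ->
  continuous_on_rect h x1 x2 y1 y2 -> continuous_on_rect k x1 x2 y1 y2 ->
  rint (fun z => h z + k z) x1 x2 y1 y2 =
  rint h x1 x2 y1 y2 + rint k x1 x2 y1 y2.
Proof.
move=> xx yy hc kc; rewrite /rint addrACA -mulrDr -!cintD;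
  [|by apply: vdiff hc; lra|by apply: vdiff kc; lra
   |by apply: hdiff hc; lra|by apply: hdiff kc; lra].
by congr (_ + _ * _); apply: eq_cint => t _; rewrite opprD addrACA.
Qed.

(** The constant 4 is 2 for the difference of two opposite sides times 2 from [cabs_cint_le]. *)
Lemma cabs_rint_le h x1 x2 y1 y2 M : x1 <= x2 -> y1 <= y2 ->
  continuous_on_rect h x1 x2 y1 y2 ->
  (forall x y, x1 <= x <= x2 -> y1 <= y <= y2 -> cabs (h (x +i* y)) <= M) ->
  cabs (rint h x1 x2 y1 y2) <= 4 * (M * ((x2 - x1) + (y2 - y1))).
Proof.
move=> xx yy hc hM.
have bnd z w : cabs z <= M -> cabs w <= M -> cabs (z - w : C) <= 2 * M.
  by move=> zM wM; rewrite (le_trans (cabsB _ _))//; lra.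
have b1 : cabs (cint (fun t => h (t +i* y1) - h (t +i* y2)) x1 x2) <=
    2 * (2 * M * (x2 - x1)).
  apply: cabs_cint_le => //; first by apply: hdiff hc; lra.
  by move=> t tx; apply: bnd; apply: hM => //; lra.
have b2 : cabs (cint (fun t => h (x2 +i* t) - h (x1 +i* t)) y1 y2) <=
    2 * (2 * M * (y2 - y1)).
  apply: cabs_cint_le => //; first by apply: vdiff hc; lra.
  by move=> t tx; apply: bnd; apply: hM => //; lra.
rewrite (le_trans (cabsD _ _))// cabsM cabs_i mul1r (le_trans (lerD b1 b2))//.
by rewrite le_eqVlt; apply/orP; left; apply/eqP; ring.
Qed.

(** On opposite sides an affine function differs by a constant, so both integrals are explicit and
    cancel. This disposes of the first-order part in Goursat's argument. *)
Lemma rint_affine (u v : C) x1 x2 y1 y2 : x1 <= x2 -> y1 <= y2 ->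
  rint (fun z => u + v * z) x1 x2 y1 y2 = 0.
Proof.
move=> xx yy; transitivity (cint (fun=> v * ('i%C * (y1 - y2)%:C)) x1 x2 +
    'i%C * cint (fun=> v * (x2 - x1)%:C) y1 y2).
  congr (_ + _ * _); apply: eq_cint => t _;
    rewrite opprD addrACA subrr add0r -mulrBr; congr (_ * _); cplx_ring.
rewrite !cint_cst// -(opprB y2 y1) rmorphN /=; ring.
Qed.

Lemma derivable_rect_continuous h x1 x2 y1 y2 :
  (forall x y, x1 <= x <= x2 -> y1 <= y <= y2 -> derivable h (x +i* y : C) 1) ->
  continuous_on_rect h x1 x2 y1 y2.
Proof.
by move=> hd x y xx yy; exact/(cplx_derive_continuous (derivableP _))/hd.
Qed.

Let quarter_large (z1 z2 z3 z4 : C) (m : R) :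
  m * 2 ^+ 2 < cabs (z1 + z2 + (z3 + z4)) ->
  [|| m < cabs z1, m < cabs z2, m < cabs z3 | m < cabs z4].
Proof.
apply: contraTT; rewrite !negb_or -!leNgt => /and4P[i1 i2 i3 i4].
rewrite (le_trans (cabsD _ _))//.
by rewrite (le_trans (lerD (cabsD _ _) (cabsD _ _)))//; lra.
Qed.

(** Bisection: a rectangle violating the bound [e * (w + v) ^+ 2] has a quarter violating the same
    bound at half the scale. The nested rectangles shrink to a point, where differentiability makes
    [h] affine up to an error too small for the violation. *)
Lemma goursat h x1 x2 y1 y2 : x1 <= x2 -> y1 <= y2 ->
  (forall x y, x1 <= x <= x2 -> y1 <= y <= y2 -> derivable h (x +i* y : C) 1) ->
  rint h x1 x2 y1 y2 = 0.
Proof.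
move=> xx yy hd; have hc := derivable_rect_continuous hd.
set w := x2 - x1; set v := y2 - y1.
have w0 : 0 <= w by rewrite subr_ge0.
have v0 : 0 <= v by rewrite subr_ge0.
suff S e : 0 < e -> cabs (rint h x1 x2 y1 y2) <= e * (w + v) ^+ 2.
  apply/eqP; rewrite -cabs_eq0 eq_le cabs_ge0 andbT; apply/ler_addgt0Pr => e e0.
  have k0 : 0 < (w + v) ^+ 2 + 1 by rewrite ltr_wpDl// sqr_ge0.
  rewrite add0r (le_trans (S (e / ((w + v) ^+ 2 + 1)) _)) ?divr_gt0//.
  by rewrite mulrAC ler_pdivrMr// ler_pM2l// lerDl.
move=> e0; rewrite leNgt; apply/negP => bad0.
(* [p] is the lower left corner of the [n]-th rectangle. The violated inequality is quadratic in the
   side lengths, hence inherited by one of four quarters. *)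
pose st n (p : R * R) := [/\ x1 <= p.1, p.1 + w / 2 ^+ n <= x2,
  y1 <= p.2, p.2 + v / 2 ^+ n <= y2 &
  e * ((w + v) / 2 ^+ n) ^+ 2 <
    cabs (rint h p.1 (p.1 + w / 2 ^+ n) p.2 (p.2 + v / 2 ^+ n))].
have half (u : R) n : u / 2 ^+ n = u / 2 ^+ n.+1 + u / 2 ^+ n.+1.
  by rewrite exprS invfM mulrA -mulrDl -splitr.
(* The existential precedes the implication so that [choice] yields a total function; corners that
   are not in state [st] are returned unchanged. *)
have step (np : nat * (R * R)) : exists q, st np.1 np.2 ->
   [/\ st np.1.+1 q, np.2.1 <= q.1,
     q.1 + w / 2 ^+ np.1.+1 <= np.2.1 + w / 2 ^+ np.1,
     np.2.2 <= q.2 & q.2 + v / 2 ^+ np.1.+1 <= np.2.2 + v / 2 ^+ np.1].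
  case: np => n [a b] /=.
  have [stn|] := pselect (st n (a, b)); last by exists (a, b).
  case: (stn) => /= xa ax yb by_ bad; move: ax by_ bad.
  rewrite (half w n) (half v n); set w' := w / _; set v' := v / _ => ax by_ bad.
  have w'0 : 0 <= w' by rewrite divr_ge0// exprn_ge0.
  have v'0 : 0 <= v' by rewrite divr_ge0// exprn_ge0.
  have hc' : continuous_on_rect h a (a + (w' + w')) b (b + (v' + v')).
    exact: continuous_on_rectS hc.
  move: bad; rewrite (@rint_splitx h _ _ _ _ (a + w')) ?(addrA a); last first.
  - by rewrite -addrA.
  - lra.
  - lra.
  rewrite (@rint_splity h _ _ _ _ (b + v')) ?(addrA b); last first.
  - by apply: continuous_on_rectS hc'; lra.
  - lra.
  - lra.
  rewrite (@rint_splity h (a + w') _ _ _ (b + v')); last first.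
  - by apply: continuous_on_rectS hc'; lra.
  - lra.
  - lra.
  set I1 := rint _ _ _ _ _; set I2 := rint _ _ _ _ _.
  set I3 := rint _ _ _ _ _; set I4 := rint _ _ _ _ _ => bad.
  have wv : (w + v) / 2 ^+ n = ((w + v) / 2 ^+ n.+1) * 2.
    by rewrite (half _ n) mulrDr mulr1.
  rewrite wv exprMn mulrA in bad; set m := e * _ in bad.
  have : [|| m < cabs I1, m < cabs I2, m < cabs I3 | m < cabs I4].
    exact: quarter_large bad.
  have fin q : [/\ x1 <= q.1, q.1 + w' <= x2, y1 <= q.2, q.2 + v' <= y2 &
      m < cabs (rint h q.1 (q.1 + w') q.2 (q.2 + v'))] ->
      [/\ a <= q.1, q.1 + w' <= a + w' + w',
          b <= q.2 & q.2 + v' <= b + v' + v'] ->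
      exists q, st n (a, b) -> [/\ st n.+1 q, a <= q.1,
        q.1 + w' <= a + w' + w', b <= q.2 & q.2 + v' <= b + v' + v'].
    by move=> ? [? ? ? ?]; exists q.
  clearbody w' v'.
  case/or4P => hI.
  - by apply: (fin (a, b)); split; rewrite //=; clear -xa ax yb by_ w'0 v'0; lra.
  - by apply: (fin (a, b + v')); split; rewrite //=;
      clear -xa ax yb by_ w'0 v'0; lra.
  - by apply: (fin (a + w', b)); split; rewrite //=;
      clear -xa ax yb by_ w'0 v'0; lra.
  - by apply: (fin (a + w', b + v')); split; rewrite //=;
      clear -xa ax yb by_ w'0 v'0; lra.
have {step}[F FP] := choice step.
pose p := fix p n := if n is m.+1 then F (m, p m) else (x1, y1).
have stp n : st n (p n).
  elim: n => [|n IH]; last by have /= := FP (n, p n); case=> //.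
  rewrite /st /= expr0 !divr1 /w /v !(addrC x1) !(addrC y1) !subrK.
  by split.
have nst n := FP (n, p n) (stp n).
have [X XP] := @nested_segments (fun n => (p n).1)
  (fun n => (p n).1 + w / 2 ^+ n) (fun n => let: And5 _ a _ _ _ := nst n in a)
  (fun n => let: And5 _ _ a _ _ := nst n in a)
  (fun n => ltac:(by rewrite lerDl divr_ge0// exprn_ge0)).
have [Y YP] := @nested_segments (fun n => (p n).2)
  (fun n => (p n).2 + v / 2 ^+ n) (fun n => let: And5 _ _ _ a _ := nst n in a)
  (fun n => let: And5 _ _ _ _ a := nst n in a)
  (fun n => ltac:(by rewrite lerDl divr_ge0// exprn_ge0)).
have XYd : derivable h (X +i* Y : C) 1.
  have [? ? ? ? _] := stp 0%N; have := XP 0%N; have := YP 0%N.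
  by move=> ? ?; apply: hd; lra.
(* The quarter of [e] cancels the constant 4 of [cabs_rint_le]. *)
have /cplx_deriveP/(_ (e / 4) ltac:(lra))[r r0 rP] := derivableP XYd.
set P0 : C := X +i* Y in rP; set d := 'D_1 h P0 in rP.
have [n nr] := exists_div_exp2_lt (addr_ge0 w0 v0) r0.
have [xa ax yb by_ bad] := stp n.
have := XP n; have := YP n; move: xa ax yb by_ bad.
set a := (p n).1; set b := (p n).2.
set w' := w / _; set v' := v / _ => xa ax yb by_ bad Yb Xa.
have wv : (w + v) / 2 ^+ n = w' + v' by rewrite mulrDl.
rewrite wv in nr bad.
have w'0 : 0 <= w' by rewrite divr_ge0// exprn_ge0.
have v'0 : 0 <= v' by rewrite divr_ge0// exprn_ge0.
have hc' : continuous_on_rect h a (a + w') b (b + v').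
  exact: continuous_on_rectS hc.
(* The first-order Taylor polynomial of [h] at the limit point; its integral is zero, so only the
   remainder contributes. *)
pose A z := (h P0 - d * P0) + d * z.
have Ac : continuous_on_rect A a (a + w') b (b + v').
  move=> x y _ _.
  exact: (cplx_derive_continuous (cplx_is_derive_affine _ _ _)).
have Ec : continuous_on_rect (fun z => h z - A z) a (a + w') b (b + v').
  by move=> x y x_ y_; exact: (cvgB (hc' x y x_ y_) (Ac x y x_ y_)).
have aw : a <= a + w' by rewrite lerDl.
have bv : b <= b + v' by rewrite lerDl.
have EI : rint h a (a + w') b (b + v') =
    rint (fun z => h z - A z) a (a + w') b (b + v').
  have hE : h = (fun z => A z + (h z - A z)).
    by apply/funext => z; rewrite addrC subrK.
  have A0 : rint A a (a + w') b (b + v') = 0 by exact: rint_affine.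
  by rewrite [in LHS]hE (rintD aw bv Ac Ec) A0 add0r.
move: bad; rewrite EI; apply/negP; rewrite -leNgt.
have := @cabs_rint_le _ _ _ _ _ (e / 4 * (w' + v')) aw bv Ec.
move=> H; apply: (le_trans (H _)).
  move=> x y x_ y_; set z : C := x +i* y.
  have zP : cabs (z - P0) <= w' + v'.
    rewrite (le_trans (cabs_le_ReIm _))// lerD//=.
      by rewrite ler_norml; lra.
    by rewrite ler_norml; lra.
  have := rP (z - P0) (le_lt_trans zP nr).
  rewrite [P0 + _]addrC subrK (_ : h z - h P0 - d * (z - P0) = h z - A z).
    by move=> /le_trans K; apply: K; rewrite ler_wpM2l// divr_ge0// ltW.
  by rewrite /A; ring.
by rewrite !(addrC a) !(addrC b) !addrK expr2; lra.
Qed.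

End Goursat.

(** * The exponential and the mean value inequality *)

Section ComplexExponential.
Variable R : realType.
Local Notation C := (Cplx R).
Implicit Types (z w : C) (x y : R).

Lemma cexpD z w : cexp (z + w) = cexp z * cexp w.
Proof.
case: z w => [a b] [c d]; rewrite /cexp /= expRD cosD sinD.
cplx_ring.
Qed.

Lemma cexp0 : cexp (0 : C) = 1.
Proof. by rewrite /cexp /= expR0 cos0 sin0 mulr1 mulr0. Qed.

Lemma cabs_cexp z : cabs (cexp z) = expR (complex.Re z).
Proof.
rewrite /cabs normc_def /= !exprMn -mulrDr cos2Dsin2 mulr1.
by rewrite sqrtr_sqr ger0_norm// expR_ge0.
Qed.

Lemma cexp_neq0 z : cexp z != 0.
Proof. by rewrite -cabs_gt0 cabs_cexp expR_gt0. Qed.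

Lemma cexpN z : cexp (- z) = (cexp z)^-1.
Proof.
apply: (mulfI (cexp_neq0 z)).
by rewrite -cexpD subrr cexp0 divff// cexp_neq0.
Qed.

Lemma cexp_2pi x : cexp (x +i* (pi *+ 2) : C) = cexp (x +i* 0 : C).
Proof. by rewrite /cexp /= cos2pi sin2pi cos0 sin0. Qed.

Lemma real_derive_expansion (f : R -> R) d : is_derive (0 : R) 1 f d ->
  forall e, 0 < e -> exists2 r : R, 0 < r &
    forall x, `|x| < r -> `|f x - f 0 - d * x| <= e * `|x|.
Proof.
move=> [fd <-] e e0.
have /cvgrPdist_lt/(_ _ e0)/nbhs_ballP[r /= r0 rP] := fd.
exists r => // x xr; have [->|x0] := eqVneq x 0.
  by rewrite subrr mulr0 subrr normr0 mulr0.
have := rP x; rewrite /ball/= sub0r normrN => /(_ xr x0) /=.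
rewrite -/('D_1 f 0) [x *: 1]mulr1 addr0 => /ltW H.
have -> : f x - f 0 - 'D_1 f 0 * x = (x^-1 * (f x - f 0) - 'D_1 f 0) * x.
  by rewrite mulrBl mulrAC mulVf// mul1r.
by rewrite normrM ler_wpM2r// distrC.
Qed.

Lemma is_derive_cexp z : is_derive z 1 (@cexp R) (cexp z).
Proof.
apply/cplx_deriveP => e e0.
pose m := expR (complex.Re z) : R.
have m0 : 0 < m by exact: expR_gt0.
(* The 6 is 1 + 2 + 2 + 1, the weights of the four error terms bounded at the end. The radius
   [k / 2] below forces [|expR x - 1| <= k], hence [expR x <= 2] as [k <= 1]. *)
pose k := Num.min 1 (e / (m * 6)).
have k0 : 0 < k by rewrite lt_min ltr01 divr_gt0// mulr_gt0.
have k1 : k <= 1 by rewrite ge_min lexx.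
have [r1 r10 H1] := real_derive_expansion (is_derive_expR (0 : R)) k0.
have [r2 r20 H2] := real_derive_expansion (is_derive_cos (0 : R)) k0.
have [r3 r30 H3] := real_derive_expansion (is_derive_sin (0 : R)) k0.
exists (Num.min (k / 2) (Num.min r1 (Num.min r2 r3))).
  by rewrite !lt_min r10 r20 r30 divr_gt0.
move=> h; rewrite !lt_min => /and4P[hk h1 h2 h3].
rewrite cexpD (_ : _ - _ - _ = cexp z * (cexp h - 1 - h)); last by ring.
rewrite cabsM cabs_cexp -/m.
suff S : cabs (cexp h - 1 - h) <= 6 * (k * cabs h).
  rewrite (le_trans (ler_wpM2l (ltW m0) S))// mulrA mulrA ler_wpM2r ?cabs_ge0//.
  rewrite -ler_pdivlMl// [leRHS]mulrC -ler_pdivlMl// [leRHS]mulrC -mulrA -invfM.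
  by rewrite ge_min lexx orbT.
case: h hk h1 h2 h3 => x y hk h1 h2 h3; set h : C := _ +i* _ in hk h1 h2 h3 *.
have xh : `|x| <= cabs h := ler_Re_cabs h.
have yh : `|y| <= cabs h := ler_Im_cabs h.
have {H1}  := H1 _ (le_lt_trans xh h1).
have {H2}  := H2 _ (le_lt_trans yh h2).
have {H3}  := H3 _ (le_lt_trans yh h3).
rewrite expR0 cos0 sin0 !mul1r oppr0 mul0r !subr0 !addr0 => H3 H2 H1.
have kx : k * `|x| <= k * cabs h by rewrite ler_pM2l.
have ky : k * `|y| <= k * cabs h by rewrite ler_pM2l.
have ex1 : `|expR x - 1| <= k.
  have -> : expR x - 1 = (expR x - 1 - x) + x by rewrite subrK.
  rewrite (le_trans (ler_normD _ _))//.
  have : k * `|x| <= `|x| by rewrite ler_piMl.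
  lra.
have ex2 : `|expR x| <= 2.
  rewrite ger0_norm ?expR_ge0//; move: ex1; rewrite ler_norml; lra.
rewrite (le_trans (cabs_le_ReIm _))//= oppr0 addr0.
have -> : expR x * cos y - 1 - x = (expR x - 1 - x) + expR x * (cos y - 1) by ring.
have -> : expR x * sin y - y = expR x * (sin y - y) + (expR x - 1) * y by ring.
have a1 : `|expR x * (cos y - 1)| <= 2 * (k * cabs h).
  by rewrite normrM ler_pM// (le_trans H2).
have a2 : `|expR x * (sin y - y)| <= 2 * (k * cabs h).
  by rewrite normrM ler_pM// (le_trans H3).
have a3 : `|(expR x - 1) * y| <= k * cabs h by rewrite normrM ler_pM.
have := ler_normD (expR x - 1 - x) (expR x * (cos y - 1)).
have := ler_normD (expR x * (sin y - y)) ((expR x - 1) * y).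
clear -H1 a1 a2 a3 kx; lra.
Qed.

End ComplexExponential.

Section MeanValue.
Variable R : realType.
Local Notation C := (Cplx R).
Implicit Types (q f : C -> C) (z c A : C).

(** The exponential map turns an annulus around [c] into a rectangle of height 2 pi, where Goursat's
    theorem says that the means of [q] over the outer and inner circles agree. The inner mean is
    within [2 * e] of [A]. *)
Let mean_value_aux q c (rho : R) A (M : R) : 0 < rho ->
  (forall z, 0 < cabs (z - c) <= rho -> derivable q z 1) ->
  (forall e : R, 0 < e -> exists2 d : R, 0 < d &
    forall z, 0 < cabs (z - c) < d -> cabs (q z - A) <= e) ->
  (forall z, cabs (z - c) = rho -> cabs (q z) <= M) ->
  cabs A <= 2 * M.
Proof.
move=> rho0 qd qA qM.
suff S e : 0 < e -> cabs A <= 2 * M + 2 * e.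
  apply/ler_addgt0Pr => e e0; have := S (e / 2) ltac:(lra); lra.
move=> e0; have [d d0 dP] := qA _ e0.
(* The outer circle has radius [rho]; the inner one has radius at most [d / 2], inside the region
   where [q] is close to [A]. The minimum with [X] keeps the two in order. *)
pose X := ln rho; pose x1 := Num.min X (ln (d / 2)).
have eX : expR X = rho by rewrite lnK.
have x1X : x1 <= X by rewrite ge_min lexx.
have ex1 : expR x1 < d.
  rewrite (@le_lt_trans _ _ (d / 2))//; last by lra.
  rewrite -[leRHS](@lnK _ (d / 2)) ?posrE ?divr_gt0// ler_expR ge_min lexx.
  by rewrite orbT.
pose h w := q (c + cexp w).
have ce w : cabs (c + cexp w - c) = expR (complex.Re w).
  by rewrite addrAC subrr add0r cabs_cexp.
have hd x y : x1 <= x <= X -> 0 <= y <= pi *+ 2 -> derivable h (x +i* y : C) 1.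
  move=> /andP[x1x xX] _.
  have qd' : derivable q (c + cexp (x +i* y)) 1.
    by apply: qd; rewrite ce /= expR_gt0 -eX ler_expR.
  have ced : is_derive (x +i* y : C) 1 (fun w => c + cexp w) (cexp (x +i* y : C)).
    have := cplx_is_deriveD (is_derive_cst c (x +i* y : C) 1)
      (is_derive_cexp (x +i* y)).
    by rewrite add0r.
  by have [] := @cplx_is_derive_comp _ q (fun w => c + cexp w) _ _ _
    (derivableP qd') ced.
have pi20 : 0 <= pi *+ 2 :> R by rewrite mulrn_wge0// pi_ge0.
have pi20' : 0 < pi *+ 2 :> R by rewrite mulrn_wgt0// pi_gt0.
have hc := derivable_rect_continuous hd.
have cX : continuous_on_seg (fun t => h (X +i* t)) 0 (pi *+ 2).
  by apply: continuous_on_vseg hc; rewrite x1X lexx.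
have c1 : continuous_on_seg (fun t => h (x1 +i* t)) 0 (pi *+ 2).
  by apply: continuous_on_vseg hc; rewrite x1X lexx.
have := goursat x1X pi20 hd; rewrite /rint.
(* The horizontal sides lie at heights 0 and 2 pi and cancel by periodicity of [cexp]. *)
rewrite (@eq_cint _ _ (fun=> 0)); last first.
  by move=> t _; rewrite /h cexp_2pi subrr.
rewrite cint_cst// mulr0 add0r => /eqP; rewrite mulf_eq0 -cabs_eq0 cabs_i.
rewrite oner_eq0 /= => /eqP I0.
have cB : continuous_on_seg (fun t => h (X +i* t) - h (x1 +i* t)) 0 (pi *+ 2).
  exact: continuous_on_segB.
have cA := @continuous_on_seg_cst R A 0 (pi *+ 2).
have c1A := continuous_on_segB c1 cA.
have IE : cint (fun t => h (X +i* t)) 0 (pi *+ 2) =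
    cint (fun t => h (x1 +i* t) - A) 0 (pi *+ 2) + (pi *+ 2)%:C * A.
  have := cintD cB (continuous_on_segD c1A cA).
  rewrite I0 add0r (cintD c1A cA) (cint_cst A pi20) subr0 => <-.
  by apply: eq_cint => t _; rewrite subrK subrK.
have b1 := @cabs_cint_le _ _ _ _ M pi20 cX.
have b2 := @cabs_cint_le _ _ _ _ e pi20 c1A.
have {}b1 : cabs (cint (fun t => h (X +i* t)) 0 (pi *+ 2)) <=
    2 * (M * (pi *+ 2 - 0)).
  by apply: b1 => t _; apply: qM; rewrite ce /= eX.
have {}b2 : cabs (cint (fun t => h (x1 +i* t) - A) 0 (pi *+ 2)) <=
    2 * (e * (pi *+ 2 - 0)).
  by apply: b2 => t _; apply: dP; rewrite ce /= expR_gt0.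
have b3 : pi *+ 2 * cabs A <= 2 * (M * (pi *+ 2 - 0)) + 2 * (e * (pi *+ 2 - 0)).
  rewrite -[X in X * _](ger0_norm pi20) -cabs_real -cabsM.
  have -> : (pi *+ 2)%:C * A = cint (fun t => h (X +i* t)) 0 (pi *+ 2) -
       cint (fun t => h (x1 +i* t) - A) 0 (pi *+ 2).
    by rewrite IE addrAC subrr add0r.
  by rewrite (le_trans (cabsB _ _))// lerD.
rewrite -(ler_pM2l pi20') (le_trans b3)// subr0.
by rewrite le_eqVlt; apply/orP; left; apply/eqP; ring.
Qed.

Lemma bernoulli_le (t : R) n : 0 <= t -> 1 + t *+ n <= (1 + t) ^+ n.
Proof.
move=> t0; elim: n => [|n IH]; first by rewrite mulr0n addr0 expr0.
rewrite exprS (le_trans _ (ler_wpM2l _ IH)) ?addr_ge0//.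
rewrite mulrDr mulr1 mulrSr mulrDl mul1r.
have : 0 <= t * (t *+ n) by rewrite mulr_ge0// mulrn_wge0.
lra.
Qed.

(** If [a / M] exceeded 1, its powers would be unbounded by Bernoulli's inequality. *)
Lemma le_of_powers_le2 (a M : R) : 0 <= a -> 0 <= M ->
  (forall n, a ^+ n <= 2 * M ^+ n) -> a <= M.
Proof.
move=> a0 M0 H; rewrite leNgt; apply/negP => Ma.
have [M1|Mn0] := eqVneq M 0.
  by have := H 1%N; rewrite !expr1 M1 mulr0 leNgt -{1}M1 Ma.
have {}M0 : 0 < M by rewrite lt_neqAle eq_sym Mn0.
pose t := a / M - 1.
have t0 : 0 < t by rewrite subr_gt0 ltr_pdivlMr// mul1r.
have t10 : 0 <= t^-1 by rewrite invr_ge0 ltW.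
have := archi_boundP t10; set n := Num.bound _ => nt.
have := H n; rewrite -ler_pdivrMr ?exprn_gt0// -expr_div_n leNgt => /negP; apply.
have -> : a / M = 1 + t by rewrite /t addrC subrK.
rewrite (lt_le_trans _ (bernoulli_le _ (ltW t0)))// -mulr_natl.
have : 1 < n%:R * t by rewrite -ltr_pdivrMr// mul1r.
lra.
Qed.

Lemma cplx_continuous_exp (z : C) n : {for z, continuous (fun w : C => w ^+ n)}.
Proof.
have := cplx_derive_continuous (cplx_is_derive_horner 'X^n z).
by rewrite (_ : horner _ = fun w => w ^+ n)//; apply/funext => w; rewrite hornerXn.
Qed.

(* Replacing q by q ^+ n removes the constant 2 of the integral estimate. *)
Lemma removable_mean_value q c (rho : R) A (M : R) : 0 < rho ->
  (forall z, 0 < cabs (z - c) <= rho -> derivable q z 1) ->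
  (forall e : R, 0 < e -> exists2 d : R, 0 < d &
    forall z, 0 < cabs (z - c) < d -> cabs (q z - A) <= e) ->
  (forall z, cabs (z - c) = rho -> cabs (q z) <= M) ->
  cabs A <= M.
Proof.
move=> rho0 qd qA qM.
have M0 : 0 <= M.
  rewrite (le_trans (cabs_ge0 _) (qM (c + rho%:C) _))//.
  by rewrite addrAC subrr add0r cabs_real gtr0_norm.
apply: le_of_powers_le2 => //; first exact: cabs_ge0.
move=> n; rewrite -cabsX.
apply: (@mean_value_aux (fun z => q z ^+ n) c rho (A ^+ n) (M ^+ n) rho0).
- move=> z /qd /derivableP qz.
  have := cplx_is_derive_comp (f := horner 'X^n) (cplx_is_derive_horner _ _) qz.
  rewrite (_ : _ \o _ = fun z => q z ^+ n); first by case.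
  by apply/funext => w /=; rewrite hornerXn.
- move=> e e0; have /cplx_continuousP/(_ _ e0)[d d0 dP] := @cplx_continuous_exp A n.
  have [d' d'0 d'P] := qA (d / 2) ltac:(lra).
  exists d' => // z /d'P zA; apply/ltW/dP; rewrite (le_lt_trans zA)//; lra.
- by move=> z /qM qz; rewrite cabsX lerXn2r// nnegrE cabs_ge0.
Qed.

Lemma mean_value_le f c (rho M : R) : 0 < rho ->
  (forall z, cabs (z - c) <= rho -> derivable f z 1) ->
  (forall z, cabs (z - c) = rho -> cabs (f z) <= M) -> cabs (f c) <= M.
Proof.
move=> rho0 fd fM; apply: (@removable_mean_value f c rho (f c) M rho0) => //.
  by move=> z /andP[_]; exact: fd.
have cc : derivable f c 1 by apply: fd; rewrite subrr cabs0 ltW.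
move=> e e0; have /cplx_continuousP/(_ _ e0)[d d0 dP] :=
  cplx_derive_continuous (derivableP cc).
by exists d => // z /andP[_ /dP /ltW].
Qed.

End MeanValue.

(** * Cauchy's estimates *)

Section Cauchy.
Variable R : realType.
Local Notation C := (Cplx R).
Implicit Types (f g F G : C -> C) (z w c d h : C) (r M : R).

Lemma cplx_is_derive_subr c z : is_derive z 1 (fun w => w - c) 1.
Proof.
have := cplx_is_deriveB (is_derive_id (z : C) 1) (is_derive_cst c z 1).
by rewrite subr0.
Qed.

Lemma cplx_derivable_divr f c z d : z - c != 0 -> is_derive z 1 f d ->
  derivable (fun w => f w / (w - c)) z 1.
Proof.
move=> zc fz; have V := @cplx_is_deriveV _ (fun w => w - c) z _ zc
  (cplx_is_derive_subr c z).
by have [] := @cplx_is_deriveM _ f (fun w => (w - c)^-1) z _ _ fz V.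
Qed.

Lemma cauchy_estimate f c d (rho M : R) : 0 < rho ->
  (forall z, cabs (z - c) <= rho -> derivable f z 1) ->
  (forall z, cabs (z - c) <= rho -> cabs (f z) <= M) ->
  is_derive c 1 f d -> cabs d <= 2 * M / rho.
Proof.
move=> rho0 fd fM fcd.
apply: (@removable_mean_value _ (fun z => (f z - f c) / (z - c)) c rho d _ rho0).
- move=> z /andP[zc0 zrho].
  have zc : z - c != 0 by rewrite -cabs_gt0.
  have D1 := cplx_is_deriveB (derivableP (fd z zrho)) (is_derive_cst (f c) z 1).
  exact: (@cplx_derivable_divr (fun w => f w - f c) c z _ zc D1).
- move=> e e0; have /cplx_deriveP/(_ _ e0)[r r0 rP] := fcd.
  exists r => // z /andP[zc0 zr].
  have zc : z - c != 0 by rewrite -cabs_gt0.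
  have := rP _ zr; rewrite [c + _]addrC subrK.
  rewrite (_ : f z - f c - d * (z - c) = ((f z - f c) / (z - c) - d) * (z - c)).
    by rewrite cabsM ler_pM2r.
  by rewrite mulrBl divfK.
- move=> z zrho; rewrite cabsM cabsV zrho ler_wpM2r ?invr_ge0 ?(ltW rho0)//.
  rewrite (le_trans (cabsB _ _))//.
  have := fM z; rewrite zrho lexx => /(_ isT).
  have := fM c; rewrite subrr cabs0 (ltW rho0) => /(_ isT).
  lra.
Qed.

Lemma real_derive_of_expansion (f : R -> R) (x d : R) :
  (forall e : R, 0 < e -> exists2 r : R, 0 < r &
    forall h : R, `|h| < r -> `|f (x + h) - f x - d * h| <= e * `|h|) ->
  is_derive x 1 f d.
Proof.
move=> H.
suff fd : h^-1 *: ((f \o shift x) (h *: 1) - f x) @[h --> 0^'] --> d.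
  by apply: (@DeriveDef _ _ _ _ _ _ _); [exact: (cvgP d)|exact: cvg_lim].
apply/cvgrPdist_le => e e0; have [r r0 rP] := H _ e0.
apply/nbhs_ballP; exists r => //= h; rewrite /ball/= sub0r normrN => hr h0.
rewrite distrC [h *: 1]mulr1 [h + x]addrC.
have := rP _ hr; rewrite (_ : f (x + h) - f x - d * h =
  (h^-1 * (f (x + h) - f x) - d) * h); last first.
  by rewrite mulrBl mulrAC mulVf// mul1r.
by rewrite normrM ler_pM2r ?normr_gt0.
Qed.

(** The real mean value theorem is applied along the segment to the real and the imaginary part,
    each with its own intermediate point; hence the factor 2. *)
Lemma cplx_mean_value f (df : C -> C) z h (M : R) :
  (forall t : R, 0 <= t <= 1 ->
     is_derive (z + t%:C * h) 1 f (df (z + t%:C * h))) ->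
  (forall t : R, 0 <= t <= 1 -> cabs (df (z + t%:C * h)) <= M) ->
  cabs (f (z + h) - f z) <= 2 * (M * cabs h).
Proof.
move=> fd dfM.
have P (p : C -> R) : (forall w, `|p w| <= cabs w) ->
    {morph p : w1 w2 / w1 - w2} -> (forall (x : R) w, p (w * x%:C) = p w * x) ->
    `|p (f (z + h) - f z)| <= M * cabs h.
  move=> p_le pB pZ.
  have D (t : R) : t \in `[0, 1] -> is_derive t 1 (fun s : R => p (f (z + s%:C * h)))
      (p (df (z + t%:C * h) * h)).
    rewrite in_itv/= => t01; apply: real_derive_of_expansion => e e0.
    have k0 : 0 < cabs h + 1 by rewrite ltr_wpDl// cabs_ge0.
    have /cplx_deriveP/(_ (e / (cabs h + 1)))[] := fd t t01.
      by rewrite divr_gt0.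
    move=> r r0 rP; exists (r / (cabs h + 1)); first by rewrite divr_gt0.
    move=> s; rewrite ltr_pdivlMr// => sr.
    rewrite -pZ -!pB (le_trans (p_le _))//.
    have := rP (s%:C * h); rewrite cabsM cabs_real => H.
    rewrite rmorphD mulrDl addrA -mulrA [h * _]mulrC.
    have hh : `|s| * cabs h <= `|s| * (cabs h + 1) by rewrite ler_wpM2l// lerDl.
    rewrite (le_trans (H _))//; first by rewrite (le_lt_trans hh).
    by rewrite mulrAC ler_pdivrMr// -mulrA ler_pM2l//.
  have [t t01] := @MVT_segment R (fun s : R => p (f (z + s%:C * h)))
    (fun t => p (df (z + t%:C * h) * h)) 0 1 ler01
    (fun t ti => D t (subset_itv_oo_cc ti))
    (derivable_within_continuous (fun t ti => @ex_derive _ _ _ _ _ _ _ (D t ti))).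
  rewrite subr0 mulr1 rmorph1 rmorph0 mul1r mul0r addr0 -pB => ->.
  rewrite (le_trans (p_le _))// cabsM ler_wpM2r ?cabs_ge0//.
  by apply: dfM; move: t01; rewrite in_itv.
rewrite (le_trans (cabs_le_ReIm _))// mulrDl mul1r lerD//; apply: P.
- exact: ler_Re_cabs.
- by move=> [? ?] [? ?].
- by move=> x [u v] /=; rewrite mulr0 subr0.
- exact: ler_Im_cabs.
- by move=> [? ?] [? ?].
- by move=> x [u v] /=; rewrite mulr0 add0r.
Qed.

(** Completeness without filters: the intervals of centre [u t] and radius [b t] meet pairwise, so
    the supremum of their left ends lies in all of them. The index is a natural number in
    [weierstrass] and an increment in [derivable_derivative_ball]. *)
Lemma real_cauchy_complete (T : Type) (P : set T) (u b : T -> R) :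
  P !=set0 -> (forall s t, P s -> P t -> u s - b s <= u t + b t) ->
  exists a, forall t, P t -> `|u t - a| <= b t.
Proof.
move=> [t0 Pt0] H.
pose S := [set u t - b t | t in P].
have hs : has_sup S.
  split; first by exists (u t0 - b t0), t0.
  by exists (u t0 + b t0) => _ [s Ps <-]; exact: H.
exists (sup S) => t Pt; rewrite ler_norml; apply/andP; split.
  rewrite lerBrDl -lerBrDr opprK; apply: sup_le_ub; first exact: hs.1.
  by move=> _ [s Ps <-]; exact: H.
by rewrite lerBlDl -lerBlDr; apply: sup_upper_bound => //; exists t.
Qed.

Lemma cplx_cauchy_complete (T : Type) (P : set T) (u : T -> C) (b : T -> R) :
  P !=set0 -> (forall s t, P s -> P t -> cabs (u s - u t) <= b s + b t) ->
  exists a, forall t, P t -> cabs (u t - a) <= 2 * b t.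
Proof.
move=> P0 H.
have [x xP] := @real_cauchy_complete T P (fun t => complex.Re (u t)) b P0
  ltac:(by move=> s t Ps Pt; have := le_trans (ler_Re_cabs _) (H _ _ Ps Pt);
    rewrite ler_norml raddfB /=; lra).
have [y yP] := @real_cauchy_complete T P (fun t => complex.Im (u t)) b P0
  ltac:(by move=> s t Ps Pt; have := le_trans (ler_Im_cabs _) (H _ _ Ps Pt);
    rewrite ler_norml raddfB /=; lra).
exists (x +i* y) => t Pt; rewrite (le_trans (cabs_le_ReIm _))//.
have := xP _ Pt; have := yP _ Pt; rewrite !raddfB /=; lra.
Qed.

(** * The derivative of a holomorphic function is holomorphic *)

Section Regularity.
Variables (f f' : C -> C) (c : C) (r M : R).
Hypotheses (r0 : 0 < r)
  (fd : forall z, cabs (z - c) < 4 * r -> is_derive z 1 f (f' z))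
  (fM : forall z, cabs (z - c) < 4 * r -> cabs (f z) <= M).

Let M0 : 0 <= M.
Proof.
by rewrite (le_trans (cabs_ge0 (f c)))// fM// subrr cabs0 mulr_gt0.
Qed.

Let tri z w u : cabs (z - u) <= cabs (z - w) + cabs (w - u).
Proof. by rewrite (le_trans _ (cabsD _ _))// addrA subrK. Qed.

(** Each stage of the section gives up one [r] of radius: [f] is bounded on [4 * r], [f'] on
    [3 * r], [f'] is Lipschitz on [2 * r], and the Taylor bound holds on [r]. *)
Lemma cauchy_estimate_ball z : cabs (z - c) < 3 * r ->
  cabs (f' z) <= 2 * M / r.
Proof.
move=> zc; have L u : cabs (u - z) <= r -> cabs (u - c) < 4 * r.
  by move=> uz; have := tri u z c; lra.
apply: (@cauchy_estimate f z (f' z) r M r0).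
- by move=> u /L /fd[].
- by move=> u /L /fM.
- by apply: fd; have := r0; lra.
Qed.

Let segment_ball (s : R) z w : cabs (z - c) < s -> cabs (w - c) < s ->
  forall t : R, 0 <= t <= 1 -> cabs (z + t%:C * (w - z) - c) < s.
Proof.
move=> zs ws t /andP[t0 t1].
have -> : z + t%:C * (w - z) - c = (1 - t)%:C * (z - c) + t%:C * (w - c).
  by rewrite rmorphB rmorph1; ring.
rewrite (le_lt_trans (cabsD _ _))// !cabsM !cabs_real !ger0_norm ?subr_ge0//.
have [->|t1'] := eqVneq t 1; first by rewrite subrr mul0r add0r mul1r.
have {}t1 : t < 1 by rewrite lt_neqAle t1' t1.
have : (1 - t) * cabs (z - c) < (1 - t) * s by rewrite ltr_pM2l// subr_gt0.
have : t * cabs (w - c) <= t * s by rewrite ler_wpM2l// ltW.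
lra.
Qed.

Let lipschitz z w : cabs (z - c) < 3 * r -> cabs (w - c) < 3 * r ->
  cabs (f w - f z) <= 2 * (2 * M / r * cabs (w - z)).
Proof.
move=> zc wc; have -> : f w = f (z + (w - z)) by rewrite addrC subrK.
have L t : 0 <= t <= 1 -> cabs (z + t%:C * (w - z) - c) < 3 * r.
  exact: segment_ball.
apply: (@cplx_mean_value f f' z (w - z)) => t /L tc.
  by apply: fd; (move: r0; lra).
exact: cauchy_estimate_ball.
Qed.

(** Cauchy's estimate for the increment [f (u + (w - z)) - f u], which is of size [cabs (w - z)] and
    has derivative [f' w - f' z] at [u = z]. *)
Let lipschitz' z w : cabs (z - c) < 2 * r -> cabs (w - c) < 2 * r ->
  cabs (f' w - f' z) <= 8 * M / r ^+ 2 * cabs (w - z).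
Proof.
move=> zc wc.
have L u : cabs (u - z) <= r -> cabs (u - c) < 3 * r.
  by move=> uz; have := tri u z c; (move: r0; lra).
have L' u : cabs (u - z) <= r -> cabs (u + (w - z) - c) < 3 * r.
  move=> uz; have := tri (u + (w - z)) w c.
  have -> : u + (w - z) - w = u - z by ring.
  (move: r0; lra).
have D u : cabs (u - z) <= r ->
    is_derive u 1 (fun u => f (u + (w - z)) - f u) (f' (u + (w - z)) - f' u).
  move=> uz; apply: cplx_is_deriveB; last by apply: fd; have := L _ uz; (move: r0; lra).
  by apply: cplx_is_derive_shift; apply: fd; have := L' _ uz; (move: r0; lra).
have := @cauchy_estimate (fun u => f (u + (w - z)) - f u) z (f' w - f' z) r
  (2 * (2 * M / r * cabs (w - z))) r0.
rewrite (_ : 8 * M / r ^+ 2 * cabs (w - z) =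
  2 * (2 * (2 * M / r * cabs (w - z))) / r); last by field; rewrite gt_eqF.
apply.
- by move=> u /D[].
- move=> u uz; rewrite (le_trans (lipschitz (L _ uz) (L' _ uz)))//.
  by rewrite [u + _]addrC addrK.
- by have := D z; rewrite subrr cabs0 (ltW r0) [z + _]addrC subrK; exact.
Qed.

(** The mean value inequality for [f u - f' z * u], whose derivative is small near [z] by the
    Lipschitz bound on [f']. *)
Lemma taylor2_ball z h : cabs (z - c) < r -> cabs h < r ->
  cabs (f (z + h) - f z - f' z * h) <= 16 * M / r ^+ 2 * cabs h ^+ 2.
Proof.
move=> zc hr.
have zc2 : cabs (z - c) < 2 * r by (move: r0; lra).
have zhc : cabs (z + h - c) < 2 * r.
  by have := cabsD (z - c) h; rewrite addrAC; (move: r0; lra).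
have L t : 0 <= t <= 1 -> cabs (z + t%:C * h - c) < 2 * r.
  move=> t01; have := segment_ball zc2 zhc t01.
  by rewrite [z + h - z]addrAC subrr add0r.
have -> : f (z + h) - f z - f' z * h =
    (f (z + h) - f' z * (z + h)) - (f z - f' z * z) by ring.
have := @cplx_mean_value (fun u => f u - f' z * u) (fun u => f' u - f' z) z h
  (8 * M / r ^+ 2 * cabs h).
rewrite (_ : 2 * _ = 16 * M / r ^+ 2 * cabs h ^+ 2); last first.
  by field; rewrite gt_eqF.
apply.
- move=> t /L tc; apply: cplx_is_deriveB; first by apply: fd; (move: r0; lra).
  by have := cplx_is_derive_affine 0 (f' z) (z + t%:C * h);
    rewrite (_ : (fun _ => _) = fun u => f' z * u)//; apply/funext => u; rewrite add0r.
- move=> t t01; rewrite (le_trans (lipschitz' zc2 (L t t01)))//.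
  rewrite ler_wpM2l ?divr_ge0 ?exprn_ge0 ?mulr_ge0 ?(ltW r0)//.
  rewrite [z + _]addrC addrK cabsM cabs_real; move/andP: t01 => [t0 t1].
  by rewrite ger0_norm// ler_piMl ?cabs_ge0.
Qed.

(** Difference quotients of [f'] are derivatives of difference quotients of [f]. Two of the latter,
    with increments [h] and [k], differ by O(|h| + |k|) near [c] because both approximate [f'];
    Cauchy's estimate carries this to the former, which therefore converge. *)
Lemma derivable_derivative_ball : derivable f' c 1.
Proof.
(* Cauchy's estimate on radius [r / 2] multiplies the Taylor constant [16 * M / r ^+ 2] by
   [4 / r]. *)
pose K := 64 * M / r ^+ 3.
have K0 : 0 <= K by rewrite divr_ge0 ?exprn_ge0 ?mulr_ge0 ?(ltW r0).
have Dq h : h != 0 -> cabs h < r -> forall u, cabs (u - c) <= r / 2 ->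
    is_derive u 1 (fun u => (f (u + h) - f u) / h) ((f' (u + h) - f' u) / h).
  move=> h0 hr u uc.
  have u1 : is_derive u 1 f (f' u) by apply: fd; (move: r0; lra).
  have u2 : is_derive u 1 (fun u => f (u + h)) (f' (u + h)).
    apply: cplx_is_derive_shift; apply: fd.
    by have := cabsD (u - c) h; rewrite addrAC; (move: r0; lra).
  have := cplx_is_deriveM (cplx_is_deriveB u2 u1) (is_derive_cst h^-1 u 1).
  by rewrite mulr0 addr0.
have cc : cabs (c - c) <= r / 2 by rewrite subrr cabs0; (move: r0; lra).
have H h k : 0 < cabs h < r -> 0 < cabs k < r ->
    cabs ((f' (c + h) - f' c) / h - (f' (c + k) - f' c) / k) <=
    K * cabs h + K * cabs k.
  move=> /andP[h0 hr] /andP[k0 kr]; rewrite !cabs_gt0 in h0 k0.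
  have E (z l : C) : l != 0 -> cabs l < r -> cabs (z - c) <= r / 2 ->
      cabs ((f (z + l) - f z) / l - f' z) <= 16 * M / r ^+ 2 * cabs l.
    move=> l0 lr zc; have := @taylor2_ball z l ltac:(move: r0; lra) lr.
    have -> : f (z + l) - f z - f' z * l = ((f (z + l) - f z) / l - f' z) * l.
      by rewrite mulrBl divfK.
    by rewrite cabsM expr2 mulrA ler_pM2r ?cabs_gt0.
  have r20 : 0 < r / 2 by (move: r0; lra).
  pose g u := (f (u + h) - f u) / h - (f (u + k) - f u) / k.
  have gd u : cabs (u - c) <= r / 2 -> is_derive u 1 g
      ((f' (u + h) - f' u) / h - (f' (u + k) - f' u) / k).
    by move=> uc; exact: cplx_is_deriveB (Dq h h0 hr u uc) (Dq k k0 kr u uc).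
  have gd1 u : cabs (u - c) <= r / 2 -> derivable g u 1 by move=> /gd[].
  have gM u : cabs (u - c) <= r / 2 -> cabs (g u) <=
      16 * M / r ^+ 2 * cabs h + 16 * M / r ^+ 2 * cabs k.
    move=> uc.
    have -> : g u = ((f (u + h) - f u) / h - f' u) -
        ((f (u + k) - f u) / k - f' u) by rewrite /g; ring.
    by rewrite (le_trans (cabsB _ _))// lerD// E.
  rewrite (le_trans (cauchy_estimate r20 gd1 gM (gd c cc)))//.
  by rewrite le_eqVlt; apply/orP; left; apply/eqP; rewrite /K; field; rewrite gt_eqF.
have [d dP] := @cplx_cauchy_complete _ [set h : C | 0 < cabs h < r]
  (fun h => (f' (c + h) - f' c) / h) (fun h => K * cabs h)
  ltac:(by exists (r / 2)%:C; rewrite /= cabs_real ger0_norm; move: r0; lra) H.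
suff : is_derive c 1 f' d by case.
apply/cplx_deriveP => e e0.
have k0 : 0 < 2 * K + 1 by (move: r0; lra).
exists (Num.min r (e / (2 * K + 1))); first by rewrite lt_min r0 divr_gt0.
move=> h; rewrite lt_min ltr_pdivlMr// => /andP[hr he].
have [->|h0] := eqVneq h 0.
  by rewrite addr0 subrr mulr0 subr0 cabs0 mulr0.
have := dP h; rewrite /= cabs_gt0 h0 hr => /(_ isT) H1.
have -> : f' (c + h) - f' c - d * h = ((f' (c + h) - f' c) / h - d) * h.
  by rewrite mulrBl divfK.
rewrite cabsM ler_wpM2r ?cabs_ge0// (le_trans H1)//.
have := cabs_ge0 h; (move: r0; lra).
Qed.

End Regularity.

Lemma derivable_derivative f z (rho : R) : 0 < rho ->
  (forall w, cabs (w - z) < rho -> derivable f w 1) ->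
  derivable (f^`()%classic) z 1.
Proof.
move=> rho0 fd.
have fz : derivable f z 1 by apply: fd; rewrite subrr cabs0.
have /cplx_continuousP/(_ _ ltr01)[d d0 dP] :=
  cplx_derive_continuous (derivableP fz).
(* Continuity at [z] supplies the local bound [cabs (f z) + 1]. *)
pose r := Num.min rho d / 4.
have r0 : 0 < r by rewrite divr_gt0// lt_min rho0.
have r4 w : cabs (w - z) < 4 * r -> cabs (w - z) < rho /\ cabs (w - z) < d.
  by rewrite /r mulrC divfK ?pnatr_eq0// lt_min => /andP.
apply: (@derivable_derivative_ball f _ z r (cabs (f z) + 1) r0).
- by move=> w /r4[/fd/derivableP wd _]; rewrite derive1E.
- move=> w /r4[_ /dP wd]; have := cabs_dist_le (f w) (f z); lra.
Qed.

Lemma derivable_derive1n (U : set C) f n :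
  (forall z, U z -> exists2 r : R, 0 < r & forall w, cabs (w - z) < r -> U w) ->
  (forall z, U z -> derivable f z 1) ->
  forall z, U z -> derivable (derive1n n f) z 1.
Proof.
move=> Uo fd; elim: n => [|n IH] z Uz; first exact: fd.
have [r r0 rU] := Uo z Uz; rewrite derive1nS.
by apply: (derivable_derivative r0) => w /rU; exact: IH.
Qed.

End Cauchy.

(** * Zeros of holomorphic functions *)

Section Zeros.
Variable R : realType.
Local Notation C := (Cplx R).
Implicit Types (f g F G : C -> C) (z w c d : C) (r M : R).

(** The quotient extends by F'(c), and its derivative at [c] is F''(c)/2: the second-order Taylor
    remainder of [F] is o(|h|^2), since its own derivative is o(|h|) by differentiability of F'. *)
Lemma divide_zero F c (rho : R) : 0 < rho ->
  (forall z, cabs (z - c) < rho -> derivable F z 1) -> F c = 0 ->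
  exists G : C -> C, (forall z, cabs (z - c) < rho -> derivable G z 1) /\
    (forall z, F z = (z - c) * G z).
Proof.
move=> rho0 Fd Fc0.
have cc : cabs (c - c) < rho by rewrite subrr cabs0.
have Fc := derivableP (Fd c cc); set F1 := 'D_1 F c in Fc.
have /derivableP F2d := derivable_derivative rho0 Fd.
set F2 := 'D_1 _ c in F2d.
pose G z := if z == c then F1 else F z / (z - c).
exists G; split; last first.
  move=> z; rewrite /G; case: eqVneq => [->|zc]; first by rewrite subrr mul0r.
  by rewrite mulrC divfK// subr_eq0.
move=> z zrho; have [->|zc] := eqVneq z c; last first.
  have zc0 : z - c != 0 by rewrite subr_eq0.
  have /derivableP D1 := @cplx_derivable_divr _ F c z _ zc0 (derivableP (Fd z zrho)).
  have zc' : 0 < cabs (z - c) by rewrite cabs_gt0.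
  suff [] : is_derive z 1 G ('D_1 (fun w => F w / (w - c)) z) by [].
  apply: (@cplx_is_derive_near _ (fun w => F w / (w - c)) _ _ _ _ zc' _ D1).
  move=> w wz; rewrite /G; case: eqVneq => // wc.
  by move: wz; rewrite wc cabs_distC ltxx.
suff [] : is_derive c 1 G (F2 / 2) by [].
apply/cplx_deriveP => e e0.
have /cplx_deriveP/(_ (e / 2) ltac:(lra))[r r0 rP] := F2d.
exists (Num.min r rho); first by rewrite lt_min r0.
move=> h; rewrite lt_min => /andP[hr hrho].
have [->|h0] := eqVneq h 0; first by rewrite addr0 subrr mulr0 subr0 cabs0 mulr0.
pose E u := F u - (F1 * (u - c) + F2 / 2 * (u - c) ^+ 2).
pose E' u := F^`()%classic u - (F1 + F2 * (u - c)).
have Ed u : cabs (u - c) < rho -> is_derive u 1 E (E' u).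
  move=> uc; have D0 : is_derive u 1 F (F^`()%classic u).
    by rewrite derive1E; exact/derivableP/Fd.
  have D1 := cplx_is_derive_subr c u.
  have D2 := cplx_is_deriveD (cplx_is_deriveM (is_derive_cst F1 u 1) D1)
    (cplx_is_deriveM (is_derive_cst (F2 / 2) u 1) (cplx_is_deriveM D1 D1)).
  apply: (is_derive_eq (cplx_is_deriveB D0 D2)); rewrite /E' /cst.
  by congr (_ - _); field.
have cK (k : C) : c + k - c = k by rewrite [c + k]addrC addrK.
have c1 : F^`()%classic c = F1 by rewrite derive1E.
have hb (t : R) : 0 <= t <= 1 -> cabs (t%:C * h) <= cabs h.
  move=> /andP[t0 t1].
  by rewrite cabsM cabs_real ger0_norm// ler_piMl ?cabs_ge0.
have E'b (t : R) : 0 <= t <= 1 -> cabs (E' (c + t%:C * h)) <= e / 2 * cabs h.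
  move=> t01; have := rP (t%:C * h) (le_lt_trans (hb t t01) hr).
  rewrite c1 -addrA -opprD => rPt.
  by rewrite /E' cK (le_trans rPt)// ler_wpM2l ?hb// divr_ge0// ltW.
have Edt (t : R) : 0 <= t <= 1 -> is_derive (c + t%:C * h) 1 E (E' (c + t%:C * h)).
  by move=> t01; apply: Ed; rewrite cK (le_lt_trans (hb t t01)).
have Eb := cplx_mean_value Edt E'b.
have -> : G (c + h) - G c - F2 / 2 * h = (E (c + h) - E c) / h.
  rewrite /G eqxx -subr_eq0 cK (negbTE h0) /E cK !subrr Fc0.
  by field.
rewrite cabsM cabsV ler_pdivrMr ?cabs_gt0// (le_trans Eb)//.
by rewrite le_eqVlt; apply/orP; left; apply/eqP; field.
Qed.

(* If every quotient vanished at c, the mean value inequality for F/(z-c)^n on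
   the circle of radius 3|s-c| around s would give |F s| <= M / 2^n. *)
Lemma isolated_zero F c s (rho M : R) : cabs (s - c) < rho / 4 ->
  (forall z, cabs (z - c) < rho -> derivable F z 1) ->
  (forall z, cabs (z - c) < rho -> cabs (F z) <= M) -> F s != 0 ->
  exists n, exists G : C -> C,
    [/\ forall z, cabs (z - c) < rho -> derivable G z 1, G c != 0 &
        forall z, F z = (z - c) ^+ n * G z].
Proof.
move=> sc Fd FM Fs; have rho0 : 0 < rho by have := cabs_ge0 (s - c); lra.
apply: contrapT => H.
have Gn n : exists G : C -> C, (forall z, cabs (z - c) < rho -> derivable G z 1) /\
    (forall z, F z = (z - c) ^+ n * G z).
  elim: n => [|n [G [Gd GF]]].
    by exists F; split => // z; rewrite expr0 mul1r.
  have Gc : G c = 0.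
    by apply/eqP; apply: contrapT => /negP Gc; apply: H; exists n, G.
  have [G' [G'd G'G]] := divide_zero rho0 Gd Gc.
  by exists G'; split => // z; rewrite GF G'G mulrA exprSr.
have [sc0|sc0] := eqVneq s c.
  apply: H; exists 0%N, F; split => //; first by rewrite -sc0.
  by move=> z; rewrite expr0 mul1r.
have x0 : 0 < cabs (s - c) by rewrite cabs_gt0 subr_eq0.
set x := cabs (s - c) in sc x0.
have M0 : 0 <= M by rewrite (le_trans (cabs_ge0 (F s)))// FM// -/x; lra.
suff S n : cabs (F s) <= M / 2 ^+ n.
  have Fs0 : 0 < cabs (F s) by rewrite cabs_gt0.
  have [n] := exists_div_exp2_lt M0 Fs0.
  by rewrite ltNge S.
have [G [Gd GF]] := Gn n.
(* Points of the circle of radius [3 * x] around [s] lie at distance between [2 * x] and [4 * x]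
   from [c]. The upper bound stays below [rho], which explains [rho / 4]; the lower one gives the
   decay. *)
have x30 : 0 < 3 * x by lra.
have tri u : cabs (u - c) <= cabs (u - s) + x.
  by rewrite (le_trans _ (cabsD _ _))// addrA subrK.
have Gs : cabs (G s) <= M / (2 * x) ^+ n.
  apply: (mean_value_le x30) => u us.
    by apply: Gd; have := tri u; lra.
  have uc : cabs (u - c) < rho by have := tri u; lra.
  have uc2 : 2 * x <= cabs (u - c).
    have := cabs_dist_le (u - s) (c - s).
    by rewrite opprB addrA subrK us [cabs (c - s)]cabs_distC -/x; lra.
  have x2n : 0 < (2 * x) ^+ n by rewrite exprn_gt0// mulr_gt0.
  rewrite ler_pdivlMr// (le_trans _ (FM u uc))// GF cabsM cabsX mulrC.
  by rewrite ler_wpM2r ?cabs_ge0// lerXn2r// nnegrE ?cabs_ge0// mulr_ge0// ltW.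
rewrite GF cabsM cabsX -/x (le_trans (ler_wpM2l _ Gs)) ?exprn_ge0 ?(ltW x0)//.
rewrite le_eqVlt; apply/orP; left; apply/eqP; rewrite exprMn.
by field; rewrite !expf_neq0// gt_eqF.
Qed.

(** Without a zero, 1/F would be holomorphic and larger at the centre than on the circle, against
    the mean value inequality. *)
Lemma zero_in_disc F c (rho delta : R) : 0 < rho ->
  (forall z, cabs (z - c) <= rho -> derivable F z 1) ->
  (forall z, cabs (z - c) = rho -> delta <= cabs (F z)) ->
  cabs (F c) < delta -> exists2 z, cabs (z - c) <= rho & F z = 0.
Proof.
move=> rho0 Fd Fdelta Fc; apply: contrapT => H.
have Fn0 z : cabs (z - c) <= rho -> F z != 0.
  by move=> zc; apply/eqP => Fz; apply: H; exists z.
have cc : cabs (c - c) <= rho by rewrite subrr cabs0 ltW.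
have delta0 : 0 < delta by rewrite (le_lt_trans (cabs_ge0 (F c))).
have : cabs (F c)^-1 <= delta^-1.
  apply: (@mean_value_le _ (fun z => (F z)^-1) c rho _ rho0) => z zc.
    by have [] := cplx_is_deriveV (Fn0 z zc) (derivableP (Fd z zc)).
  by rewrite cabsV lef_pV2// ?posrE ?Fdelta// cabs_gt0 Fn0// zc.
by rewrite cabsV lef_pV2// ?posrE ?cabs_gt0 ?Fn0// leNgt Fc.
Qed.

(** Each differentiation gives up [d] of radius and multiplies the bound by [2 / d]. *)
Lemma iterated_cauchy (E : nat -> C -> C) c (a d e : R) (n : nat) : 0 < d ->
  (forall j z, cabs (z - c) < a -> is_derive z 1 (E j) (E j.+1 z)) ->
  (forall z, cabs (z - c) < a -> cabs (E 0%N z) <= e) ->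
  forall z, cabs (z - c) < a - n%:R * d -> cabs (E n z) <= (2 / d) ^+ n * e.
Proof.
move=> d0 Ed E0; elim: n => [|n IH] z zc.
  by rewrite expr0 mul1r E0//; move: zc; rewrite mul0r subr0.
have tri u : cabs (u - c) <= cabs (u - z) + cabs (z - c).
  by rewrite (le_trans _ (cabsD _ _))// addrA subrK.
have nd : n.+1%:R * d = n%:R * d + d by rewrite -natr1 mulrDl mul1r.
have nd0 : 0 <= n%:R * d by rewrite mulr_ge0// ltW.
have L u : cabs (u - z) <= d -> cabs (u - c) < a - n%:R * d.
  by move=> uz; have := tri u; rewrite nd in zc; lra.
have := @cauchy_estimate _ (E n) z (E n.+1 z) d ((2 / d) ^+ n * e) d0.
rewrite exprS (_ : 2 * _ / _ = 2 / d * (2 / d) ^+ n * e); last first.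
  by field; rewrite gt_eqF.
move=> H; apply: H.
- by move=> u /L uc; have [] : is_derive u 1 (E n) (E n.+1 u) by apply: Ed; lra.
- by move=> u /L; exact: IH.
- by apply: Ed; have := L z; rewrite subrr cabs0 => /(_ (ltW d0)); lra.
Qed.

End Zeros.

(** * General Dirichlet series *)

(** Derivatives are taken over functions on all of [Cplx R]; the value 0 outside the half-plane is a
    placeholder. *)
Definition hpext (R : realType) (g : halfplane R -> Cplx R) (s : Cplx R) :
    Cplx R :=
  if insub s is Some x then g (x : halfplane R) else 0.

Section DirichletSeries.
Variable R : realType.
Local Notation C := (Cplx R).
Implicit Types (f g F G : C -> C) (z w c d : C) (r M : R).

Lemma hpext_val (g : halfplane R -> C) (s : halfplane R) : hpext g (val s) = g s.
Proof. by rewrite /hpext valK. Qed.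

Lemma cplx_cvgnP (u : nat -> C) (l : C) : u @ \oo --> l ->
  forall e : R, 0 < e -> exists N, forall n, (N <= n)%N -> cabs (u n - l) < e.
Proof.
move=> ul e e0.
have /ul[N _ NP] : nbhs l [set w : C | cabs (w - l) < e].
  by apply/nbhs_cabsP; exists e.
by exists N.
Qed.

(** The derivatives at [c] form a Cauchy family by Cauchy's estimate, and the second-order Taylor
    bound, uniform in [n], passes to the limit and identifies the derivative of [F]. *)
Lemma weierstrass (Fn Fn' : nat -> C -> C) F c (r : R) (b : nat -> R) (M : R) :
  0 < r ->
  (forall n z, cabs (z - c) < 4 * r -> is_derive z 1 (Fn n) (Fn' n z)) ->
  (forall z, cabs (z - c) < 4 * r -> cabs (F z) <= M) ->
  (forall n z, cabs (z - c) < 4 * r -> cabs (Fn n z - F z) <= b n) ->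
  (forall e : R, 0 < e -> exists n, b n <= e) ->
  derivable F c 1.
Proof.
move=> r0 Fnd FM Fb b0.
have cc : cabs (c - c) < 4 * r by rewrite subrr cabs0; lra.
have FnM n z : cabs (z - c) < 4 * r -> cabs (Fn n z) <= M + b n.
  move=> zc; have := FM z zc; have := Fb n z zc; have := cabs_dist_le (Fn n z) (F z).
  lra.
have D n m : cabs (Fn' n c - Fn' m c) <= 2 / r * b n + 2 / r * b m.
  have := @cauchy_estimate_ball _ (fun z => Fn n z - Fn m z)
    (fun z => Fn' n z - Fn' m z) c r (b n + b m) r0 _ _ c.
  rewrite (_ : 2 * _ / _ = 2 / r * b n + 2 / r * b m); last first.
    by field; rewrite gt_eqF.
  apply.
  - by move=> z zc; apply: cplx_is_deriveB; exact: Fnd.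
  - move=> z zc; rewrite (_ : _ - _ = (Fn n z - F z) - (Fn m z - F z)); last by ring.
    by rewrite (le_trans (cabsB _ _))// lerD// Fb.
  - by rewrite subrr cabs0; lra.
have [d dP] := @cplx_cauchy_complete _ _ setT (fun n => Fn' n c)
  (fun n => 2 / r * b n) ltac:(by exists 0%N) (fun n m _ _ => D n m).
have M0 : 0 <= M by rewrite (le_trans (cabs_ge0 (F c)))// FM.
have T h : cabs h < r -> cabs (F (c + h) - F c - d * h) <= 16 * M / r ^+ 2 * cabs h ^+ 2.
  move=> hr; apply/ler_addgt0Pr => e e0.
  (* [K] collects the coefficients of [b n]: two values of the limit, the derivative at [c], and the
     excess of [M + b n] over [M] in the Taylor bound. *)
  pose K := 2 + 4 / r * cabs h + 16 / r ^+ 2 * cabs h ^+ 2.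
  have K0 : 0 < K.
    have p1 : 0 <= 4 / r * cabs h by rewrite mulr_ge0 ?divr_ge0 ?cabs_ge0 ?(ltW r0).
    have p2 : 0 <= 16 / r ^+ 2 * cabs h ^+ 2.
      by rewrite mulr_ge0 ?divr_ge0 ?exprn_ge0 ?cabs_ge0 ?(ltW r0).
    by rewrite /K; lra.
  have [n bn] := b0 (e / K) ltac:(by rewrite divr_gt0).
  have hc : cabs (c + h - c) < 4 * r by rewrite [c + h]addrC addrK; lra.
  have t1 := Fb n (c + h) hc; have t2 := Fb n c cc.
  have t3 : cabs ((Fn' n c - d) * h) <= 4 / r * b n * cabs h.
    rewrite cabsM ler_wpM2r ?cabs_ge0// (le_trans (dP n I))//.
    by rewrite le_eqVlt; apply/orP; left; apply/eqP; ring.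
  have t4 := @taylor2_ball _ (Fn n) (Fn' n) c r (M + b n) r0
    (fun z zc => Fnd n z zc) (fun z zc => FnM n z zc) c h
    ltac:(by rewrite subrr cabs0) hr.
  have -> : F (c + h) - F c - d * h = - (Fn n (c + h) - F (c + h)) +
     (Fn n c - F c) + (Fn' n c - d) * h +
     (Fn n (c + h) - Fn n c - Fn' n c * h) by ring.
  have Ke : b n * K <= e by rewrite -ler_pdivlMr.
  rewrite (le_trans (cabsD _ _))// (le_trans (lerD (cabsD _ _) t4))//.
  rewrite (le_trans (lerD (lerD (cabsD _ _) t3) (lexx _)))// cabsN.
  rewrite (_ : 16 * (M + b n) / r ^+ 2 * cabs h ^+ 2 =
    16 * M / r ^+ 2 * cabs h ^+ 2 + 16 / r ^+ 2 * cabs h ^+ 2 * b n); last first.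
    by field; rewrite gt_eqF.
  have : b n * K = b n * 2 + 4 / r * b n * cabs h + 16 / r ^+ 2 * cabs h ^+ 2 * b n.
    by rewrite /K; ring.
  lra.
suff [] : is_derive c 1 F d by [].
apply/cplx_deriveP => e e0.
pose K := 16 * M / r ^+ 2 + 1.
have K0 : 0 < K by rewrite ltr_wpDl// divr_ge0 ?exprn_ge0 ?(ltW r0)// mulr_ge0.
exists (Num.min r (e / K)); first by rewrite lt_min r0 divr_gt0.
move=> h; rewrite lt_min ltr_pdivlMr// => /andP[/T hT he].
rewrite (le_trans hT)// expr2 mulrA ler_wpM2r ?cabs_ge0//.
rewrite (le_trans _ (ltW he))// mulrC ler_wpM2l ?cabs_ge0// /K lerDl//.
Qed.

Section OneSeries.
Variables (a : nat -> C) (lam : nat -> R) (g : halfplane R -> C).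
Hypothesis ag : forall s : halfplane R,
  cvgn [normed series (gdirichlet_term a lam (val s))] /\
  series (gdirichlet_term a lam (val s)) @ \oo --> g s.

Let tm (x : R) n := cabs (a n) * expR (- (lam n * x)).

Lemma cabs_gdirichlet_term s n :
  cabs (gdirichlet_term a lam s n) = tm (complex.Re s) n.
Proof.
rewrite cabsM cabs_cexp; congr (_ * expR _).
by case: s => x y /=; rewrite mul0r subr0.
Qed.

Let tm_ge0 x n : 0 <= tm x n.
Proof. by rewrite mulr_ge0 ?cabs_ge0 ?expR_ge0. Qed.

(** The exponents may have either sign, so neither edge of a strip dominates every term; the sum
    over both edges does. *)
Let tm_convex (x y z : R) n : x <= y <= z -> tm y n <= tm x n + tm z n.
Proof.
move=> /andP[xy yz]; rewrite -mulrDr ler_wpM2l ?cabs_ge0//.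
have [l0|l0] := leP 0 (lam n).
  rewrite (@le_trans _ _ (expR (- (lam n * x))))//; last by rewrite lerDl expR_ge0.
  by rewrite ler_expR lerN2 ler_wpM2l.
rewrite (@le_trans _ _ (expR (- (lam n * z))))//; last by rewrite lerDr expR_ge0.
by rewrite ler_expR lerN2 ler_wnM2l// ltW.
Qed.

Let tm_bounded x : 2^-1 < x -> exists B, forall n, \sum_(k < n) tm x k <= B.
Proof.
move=> x2; pose s : halfplane R := Sub (x%:C : C) x2.
have [/cvg_ex[l /cplx_cvgnP/(_ _ ltr01)[N NP]] _] := ag s.
exists (cabs l + 1) => n.
have mono : \sum_(k < n) tm x k <= \sum_(k < maxn n N) tm x k.
  rewrite -(subnKC (leq_maxl n N)) [leRHS]big_split_ord/=.
  by rewrite lerDl sumr_ge0.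
rewrite (le_trans mono)//.
have E : [normed series (gdirichlet_term a lam (val s))] (maxn n N) =
    (\sum_(k < maxn n N) tm x k)%:C.
  rewrite /normed_series_of /series /= big_mkord rmorph_sum/=.
  apply: eq_bigr => k _.
  by rewrite cplx_normE cabs_gdirichlet_term.
have := NP (maxn n N) (leq_maxr _ _); rewrite E => H.
have := cabs_dist_le (\sum_(k < maxn n N) tm x k)%:C l.
rewrite cabs_real ger0_norm ?sumr_ge0//; lra.
Qed.

(** The Weierstrass M-test with the terms at both edges as majorant; [b n] is the tail of the
    majorant and [B] bounds its partial sums. *)
Lemma dirichlet_strip (x1 x2 : R) : 2^-1 < x1 -> x1 <= x2 ->
  exists (b : nat -> R) (B : R), [/\ forall e : R, 0 < e -> exists n, b n <= e,
    forall n s, x1 <= complex.Re s <= x2 ->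
      cabs (series (gdirichlet_term a lam s) n - hpext g s) <= b n &
    forall n s, x1 <= complex.Re s <= x2 ->
      \sum_(k < n) cabs (gdirichlet_term a lam s k) <= B].
Proof.
move=> x12 x1x2.
have [B1 B1P] := tm_bounded x12.
have [B2 B2P] := tm_bounded (lt_le_trans x12 x1x2).
pose W k := tm x1 k + tm x2 k.
have W0 k : 0 <= W k by rewrite addr_ge0.
have WB n : \sum_(k < n) W k <= B1 + B2 by rewrite big_split lerD.
pose S := range (fun n => \sum_(k < n) W k).
have hs : has_sup S.
  split; first by exists (\sum_(k < 0) W k), 0%N.
  by exists (B1 + B2) => _ [n _ <-].
have SleW n : \sum_(k < n) W k <= sup S by apply: sup_upper_bound => //; exists n.
have tW s k : x1 <= complex.Re s <= x2 -> cabs (gdirichlet_term a lam s k) <= W k.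
  by move=> sx; rewrite cabs_gdirichlet_term tm_convex.
exists (fun n => sup S - \sum_(k < n) W k), (B1 + B2); split.
- move=> e e0; have [_ [n _ <-] H] := sup_adherent e0 hs.
  by exists n; lra.
- move=> n s sx.
  have s2 : 2^-1 < complex.Re s by case/andP: sx => + _; exact: lt_le_trans.
  have [_ /cplx_cvgnP H] := ag (Sub s s2 : halfplane R).
  apply/ler_addgt0Pr => e e0.
  have [N NP] := H _ e0; have := NP _ (leq_maxr n N).
  rewrite -(hpext_val g) /= => H1.
  set m := maxn n N in H1.
  have nm : (n <= m)%N by exact: leq_maxl.
  have H2 : cabs (series (gdirichlet_term a lam s) n -
      series (gdirichlet_term a lam s) m) <= sup S - \sum_(k < n) W k.
    rewrite cabs_distC /series /= (@big_cat_nat _ _ _ n _ m)//= addrAC subrr add0r.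
    rewrite (le_trans (cabs_sum _ _ _))// lerBrDl (le_trans _ (SleW m))//.
    rewrite -!(big_mkord xpredT W) [leRHS](@big_cat_nat _ _ _ n _ m)//= lerD2l.
    by apply: ler_sum => k _; exact: tW.
  rewrite (_ : _ - hpext g s = (series (gdirichlet_term a lam s) n -
      series (gdirichlet_term a lam s) m) +
    (series (gdirichlet_term a lam s) m - hpext g s)); last by ring.
  by rewrite (le_trans (cabsD _ _))// lerD// ltW.
- move=> n s sx; rewrite (le_trans _ (WB n))// ler_sum// => k _; exact: tW.
Qed.

Lemma is_derive_gdirichlet_term n z :
  is_derive z 1 (fun s => gdirichlet_term a lam s n)
    (a n * (cexp (- ((lam n)%:C * z)) * (- (lam n)%:C))).
Proof.
have L : is_derive z 1 (fun s : C => - ((lam n)%:C * s) : C) (- (lam n)%:C : C).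
  have := cplx_is_derive_affine 0 (- (lam n)%:C) z.
  rewrite (_ : (fun _ => _) = fun s : C => - ((lam n)%:C * s) : C)//.
  by apply/funext => s; rewrite add0r mulNr.
have E := @cplx_is_derive_comp _ (@cexp R) _ z _ _ (is_derive_cexp _) L.
by have := cplx_is_deriveM (is_derive_cst (a n) z 1) E; rewrite mul0r add0r.
Qed.

Lemma is_derive_gdirichlet_sum n z :
  is_derive z 1 (fun s => series (gdirichlet_term a lam s) n)
    (\sum_(0 <= k < n) (a k * (cexp (- ((lam k)%:C * z)) * (- (lam k)%:C)))).
Proof.
elim: n => [|n IH].
  rewrite big_geq//; have := is_derive_cst (0 : C) (z : C) 1.
  rewrite (_ : cst _ = fun s => series (gdirichlet_term a lam s) 0)//.
  by apply/funext => s; rewrite /series/= big_geq.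
rewrite big_nat_recr//=.
rewrite (_ : (fun _ => _) = fun s => series (gdirichlet_term a lam s) n +
    gdirichlet_term a lam s n).
  by apply: cplx_is_deriveD => //; exact: is_derive_gdirichlet_term.
by apply/funext => s; rewrite /series/= big_nat_recr.
Qed.

Lemma derivable_hpext s : 2^-1 < complex.Re s -> derivable (hpext g) s 1.
Proof.
(* The disc of radius [4 * r] reaches halfway to the line Re = 1/2. *)
move=> s2; pose r := (complex.Re s - 2^-1) / 8.
have r0 : 0 < r by rewrite divr_gt0// subr_gt0.
have r8 : 8 * r = complex.Re s - 2^-1 by rewrite mulrC divfK.
have [b [B [b0 bP _]]] := @dirichlet_strip (complex.Re s - 4 * r)
  (complex.Re s + 4 * r) ltac:(lra) ltac:(lra).
have inS z : cabs (z - s) < 4 * r ->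
    complex.Re s - 4 * r <= complex.Re z <= complex.Re s + 4 * r.
  move=> zs; have := le_lt_trans (ler_Re_cabs _) zs.
  by rewrite raddfB/= ltr_norml; lra.
apply: (@weierstrass (fun n z => series (gdirichlet_term a lam z) n)
  (fun n z => \sum_(0 <= k < n) (a k * (cexp (- ((lam k)%:C * z)) * (- (lam k)%:C))))
  (hpext g) s r b (b 0%N) r0).
- by move=> n z _; exact: is_derive_gdirichlet_sum.
(* The empty partial sum is 0, so [b 0] bounds the sum function itself. *)
- move=> z /inS zs; have := bP 0%N z zs.
  by rewrite /series/= big_geq// sub0r cabsN.
- by move=> n z /inS; exact: bP.
- exact: b0.
Qed.

Lemma dirichlet_bounded (x1 x2 : R) : 2^-1 < x1 -> x1 <= x2 ->
  exists B, forall s, x1 <= complex.Re s <= x2 -> cabs (hpext g s) <= B.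
Proof.
move=> x12 x1x2; have [b [B [_ bP _]]] := dirichlet_strip x12 x1x2.
exists (b 0%N) => s /(bP 0%N).
by rewrite /series/= big_geq// sub0r cabsN.
Qed.

(** A vertical shift multiplies the [n]-th term by a unimodular factor. Beyond [N] both tails are
    below [e / 4] whatever the shift, so only finitely many factors have to be near 1. *)
Lemma dirichlet_shift (x1 x2 e : R) : 2^-1 < x1 -> x1 <= x2 -> 0 < e ->
  exists N, exists2 eta : R, 0 < eta & forall tau : R,
    (forall n, (n < N)%N -> cabs (cexp (- ((lam n)%:C * (0 +i* tau))) - 1) <= eta) ->
    forall s, x1 <= complex.Re s <= x2 ->
      cabs (hpext g (s + (0 +i* tau)) - hpext g s) <= e.
Proof.
move=> x12 x1x2 e0; have [b [B [b0 bP BP]]] := dirichlet_strip x12 x1x2.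
have [N bN] := b0 (e / 4) ltac:(lra).
have B0 : 0 <= B.
  have := BP 0%N (x1%:C); rewrite big_ord0 /= lexx x1x2; exact.
exists N, (e / 4 / (B + 1)); first by rewrite !divr_gt0//; lra.
move=> tau H s sx; set t := 0 +i* tau.
have stx : x1 <= complex.Re (s + t) <= x2 by rewrite raddfD/= addr0.
have t1 := bP N s sx; have t2 := bP N _ stx.
set S1 := series _ _ in t1; set S2 := series _ _ in t2.
have t3 : cabs (S2 - S1) <= e / 4.
  rewrite /S2 /S1 /series/= -sumrB big_mkord.
  rewrite (le_trans (cabs_sum _ _ _))//.
  rewrite (@le_trans _ _ (\sum_(k < N) e / 4 / (B + 1) *
      cabs (gdirichlet_term a lam s k)))//.
    apply: ler_sum => k _.
    rewrite /gdirichlet_term mulrDr opprD cexpD.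
    rewrite (_ : _ - _ = (cexp (- ((lam k)%:C * t)) - 1) *
      (a k * cexp (- ((lam k)%:C * s)))); last by ring.
    by rewrite cabsM ler_wpM2r ?cabs_ge0// H.
  rewrite -mulr_sumr (le_trans (ler_wpM2l _ (BP N s sx)))//.
    by rewrite !divr_ge0 ?addr_ge0// ltW.
  rewrite mulrAC ler_pdivrMr; last by lra.
  by rewrite ler_wpM2l//; lra.
rewrite (_ : _ - _ = (S1 - hpext g s) + (S2 - S1) - (S2 - hpext g (s + t))); last by ring.
rewrite (le_trans (cabsB _ _))// (le_trans (lerD (cabsD _ _) t2))//; lra.
Qed.

End OneSeries.

End DirichletSeries.

(** * The identity theorem and almost periods *)

Section IdentityTheorem.
Variable R : realType.
Local Notation C := (Cplx R).
Implicit Types (F G : C -> C) (z w c s : C).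

(** If [F] were nonzero at [z], then at the point [c] of the vanishing line at the same height it
    would factor as (z-c)^n G with G(c) nonzero, yet [F] vanishes at [c + t] for all small real
    [t]. *)
Lemma zero_line_spread F (d d' : R) : 0 < d -> `|d' - d| < d / 8 ->
  (forall s, 2^-1 < complex.Re s -> derivable F s 1) ->
  (forall x1 x2 : R, 2^-1 < x1 -> x1 <= x2 -> exists B, forall s,
     x1 <= complex.Re s <= x2 -> cabs (F s) <= B) ->
  (exists2 e : R, 0 < e & forall z, `|complex.Re z - 2^-1 - d| < e -> F z = 0) ->
  exists2 e : R, 0 < e & forall z, `|complex.Re z - 2^-1 - d'| < e -> F z = 0.
Proof.
move=> d0 dd' Fd FB [e e0 Fe].
(* This keeps [z] within [d / 8] of the old line, the reach of [isolated_zero] in the disc of radius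
   [d / 2]. *)
exists (d / 8 - `|d' - d|); first by rewrite subr_gt0.
move=> z zd'; apply: contrapT => /eqP Fz.
pose c : C := (2^-1 + d) +i* complex.Im z.
have zc : cabs (z - c) < d / 2 / 4.
  have -> : z - c = (complex.Re z - 2^-1 - d)%:C.
    by rewrite /c {zd' Fz c}; case: z => x y; cplx_ring.
  rewrite cabs_real.
  have := ler_normD (complex.Re z - 2^-1 - d') (d' - d).
  rewrite addrA subrK; lra.
have inS w : cabs (w - c) < d / 2 ->
    2^-1 + d / 2 <= complex.Re w <= 2^-1 + d + d / 2.
  move=> wc; have := le_lt_trans (ler_Re_cabs _) wc.
  by rewrite raddfB/= ltr_norml; lra.
have [B FBc] := FB (2^-1 + d / 2) (2^-1 + d + d / 2) ltac:(lra) ltac:(lra).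
have Fdc w : cabs (w - c) < d / 2 -> derivable F w 1.
  by move=> /inS wc; apply: Fd; lra.
have [n [G [Gd Gc GF]]] := isolated_zero zc Fdc (fun w wc => FBc w (inS w wc)) Fz.
have Gcd := Gd c ltac:(by rewrite subrr cabs0; lra).
have Gc0 : 0 < cabs (G c) by rewrite cabs_gt0.
have /cplx_continuousP/(_ _ Gc0)[r r0 rP] := cplx_derive_continuous (derivableP Gcd).
pose t := Num.min r e / 2.
have t0 : 0 < t by rewrite divr_gt0// lt_min r0.
have tr : t < r.
  by rewrite ltr_pdivrMr// (@le_lt_trans _ _ r)// ?ge_min ?lexx//; lra.
have te : t < e.
  by rewrite ltr_pdivrMr// (@le_lt_trans _ _ e)// ?ge_min ?lexx ?orbT//; lra.
have ct : c + t%:C - c = t%:C by rewrite [c + _]addrC addrK.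
have ctE : complex.Re (c + t%:C) - 2^-1 - d = t by rewrite /=; ring.
have := Fe (c + t%:C); rewrite ctE gtr0_norm// => /(_ te).
rewrite GF ct => /eqP; rewrite mulf_eq0 expf_eq0.
rewrite -cabs_eq0 cabs_real gtr0_norm// (gt_eqF t0) andbF /= => /eqP G0.
have := rP (c + t%:C); rewrite ct cabs_real gtr0_norm// => /(_ tr).
by rewrite G0 sub0r cabsN ltxx.
Qed.

(** Vanishing propagates from one whole vertical line to the next, so a chain of abscissae from the
    middle of the strip to Re s suffices. *)
Lemma nonzero_in_strip F (x1 x2 : R) s : 2^-1 < x1 -> x1 < x2 ->
  (forall s, 2^-1 < complex.Re s -> derivable F s 1) ->
  (forall x1 x2 : R, 2^-1 < x1 -> x1 <= x2 -> exists B, forall s,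
     x1 <= complex.Re s <= x2 -> cabs (F s) <= B) ->
  2^-1 < complex.Re s -> F s != 0 ->
  exists2 s0, x1 < complex.Re s0 < x2 & F s0 != 0.
Proof.
move=> x1h x12 Fd FB sh Fs; apply: contrapT => H.
have F0 z : x1 < complex.Re z < x2 -> F z = 0.
  by move=> zx; apply/eqP; apply: contrapT => /negP Fz; apply: H; exists z.
pose d0 := (x1 + x2) / 2 - 2^-1; pose D := complex.Re s - 2^-1.
have d00 : 0 < d0 by rewrite /d0; lra.
have D0 : 0 < D by rewrite subr_gt0.
pose m := Num.min d0 D.
have m0 : 0 < m by rewrite lt_min d00.
have md : m <= d0 by rewrite ge_min lexx.
have mD : m <= D by rewrite ge_min lexx orbT.
(* Enough equal steps for each to be shorter than [m / 8]. Every intermediate [dk k] is a convex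
   combination of [d0] and [D], hence at least [m]. *)
pose N := (Num.bound (8 * `|D - d0| / m)).+1.
have N0 : 0 < N%:R :> R by rewrite ltr0n.
have Nm : `|D - d0| / N%:R < m / 8.
  have q0 : 0 <= 8 * `|D - d0| / m by rewrite divr_ge0 ?mulr_ge0// ltW.
  have := archi_boundP q0; rewrite ltr_pdivrMr// ltr_pdivrMr// => NP.
  have -> : N%:R = (Num.bound (8 * `|D - d0| / m))%:R + 1 :> R by rewrite natr1.
  move: (Num.bound _)%:R NP m0 => b; clear; lra.
pose dk k := d0 + (D - d0) / N%:R * k%:R.
have dkm k : (k <= N)%N -> m <= dk k.
  move=> kN; have -> : dk k = (1 - k%:R / N%:R) * d0 + k%:R / N%:R * D.
    by rewrite /dk; field; rewrite gt_eqF.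
  have k1 : 0 <= (k%:R / N%:R : R) <= 1.
    by rewrite divr_ge0//= ler_pdivrMr// mul1r ler_nat.
  move/andP: k1 => [k0 k1].
  have : (1 - k%:R / N%:R) * m <= (1 - k%:R / N%:R) * d0.
    by rewrite ler_wpM2l// subr_ge0.
  have : k%:R / N%:R * m <= k%:R / N%:R * D by rewrite ler_wpM2l.
  lra.
have Z k : (k <= N)%N ->
    exists2 e : R, 0 < e & forall z, `|complex.Re z - 2^-1 - dk k| < e -> F z = 0.
  elim: k => [|k IH] kN.
    exists ((x2 - x1) / 2); first by rewrite divr_gt0// subr_gt0.
    move=> z; rewrite /dk mulr0 addr0 /d0 ltr_norml => zx; apply: F0; lra.
  apply: (@zero_line_spread F (dk k)) => //.
  - exact/(lt_le_trans m0)/dkm/ltnW.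
  - have -> : dk k.+1 - dk k = (D - d0) / N%:R.
      rewrite /dk (_ : k.+1%:R = k%:R + 1 :> R); last by rewrite natr1.
      by ring.
    rewrite normrM normfV (ger0_norm (ltW N0)) (lt_le_trans Nm)//.
    rewrite ler_pM2r//.
    exact/dkm/ltnW.
  - exact/IH/ltnW.
have [e e0 /(_ s)] := Z N (leqnn N).
rewrite /dk divfK ?gt_eqF// [d0 + _]addrC subrK /D subrr normr0 => /(_ e0).
exact/eqP.
Qed.

End IdentityTheorem.

(** * Rational bases and almost periods *)

Section Diophantine.
Variable R : realType.
Local Notation C := (Cplx R).

Let rat_multiple (q : rat) (D : int) : (denq q %| D)%Z ->
  exists n : int, n%:~R = ratr q * D%:~R :> R.
Proof.
move=> /dvdzP[m ->]; exists (numq q * m).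
have dq : (denq q)%:~R != 0 :> R by rewrite intr_eq0 denq_neq0.
by rewrite /ratr !rmorphM/= [m%:~R * _]mulrC mulrA divfK.
Qed.

(** Induction on the list: a number in the rational span of the basis only requires dividing the
    basis by a common denominator; any other number is adjoined as a new element. *)
Lemma rational_basis (s : seq R) : exists k (alpha : 'I_k -> R),
  lin_indep_rat alpha /\ forall x, x \in s ->
    exists n : 'I_k -> int, x = \sum_(j < k) (n j)%:~R * alpha j.
Proof.
elim: s => [|x s [k [alpha [ai IH]]]].
  by exists 0%N, (fun=> 0); split=> // q _ [].
have [[q xq]|nq] := pselect (exists q : 'I_k -> rat,
    x = \sum_(j < k) ratr (q j) * alpha j).
  pose D := \prod_(j < k) denq (q j).
  have D0 : D%:~R != 0 :> R.
    by rewrite intr_eq0; apply/prodf_neq0 => j _; exact: denq_neq0.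
  exists k, (fun j => alpha j / D%:~R); split.
    move=> p p0; apply: ai; apply: (mulIf (invr_neq0 D0)).
    by rewrite mul0r mulr_suml -[RHS]p0; apply: eq_bigr => j _; rewrite mulrA.
  move=> y; rewrite inE => /predU1P[->|/IH[n ->]].
    have /choice[n nP] j : exists n : int, n%:~R = ratr (q j) * D%:~R :> R.
      by apply: rat_multiple; rewrite /D (bigD1 j)//= dvdz_mulr.
    exists n; rewrite xq; apply: eq_bigr => j _; rewrite nP.
    by rewrite mulrACA divff// mulr1.
  exists (fun j => n j * D); apply: eq_bigr => j _.
  by rewrite rmorphM/= mulrACA divff// mulr1.
exists k.+1, (fun i => if unlift ord0 i is Some j then alpha j else x); split.
  move=> q; rewrite big_ord_recl unlift_none.
  under eq_bigr do rewrite liftK.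
  have [q0|q0] := eqVneq (q ord0) 0.
    rewrite q0 rmorph0 mul0r add0r => /(ai (fun j => q (lift ord0 j))) H j.
    by case: (unliftP ord0 j) => [i ->|->].
  move=> E; exfalso; apply: nq; exists (fun j => - (q (lift ord0 j) / q ord0)).
  have rq0 : ratr (q ord0) != 0 :> R by rewrite fmorph_eq0.
  apply: (mulfI rq0); move/eqP: E; rewrite addr_eq0 => /eqP ->.
  rewrite mulr_sumr -sumrN; apply: eq_bigr => j _.
  by rewrite rmorphN rmorphM fmorphV /=; field.
move=> y; rewrite inE => /predU1P[->|/IH[n ->]].
  exists (fun i => if i == ord0 then 1 else 0).
  rewrite big_ord_recl eqxx unlift_none mul1r big1 ?addr0// => j _.
  by rewrite mul0r.
exists (fun i => if unlift ord0 i is Some j then n j else 0).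
rewrite big_ord_recl unlift_none mul0r add0r.
by apply: eq_bigr => j _; rewrite liftK.
Qed.

Lemma dist_int_lt (x e : R) : dist_int x < e ->
  exists n : int, `|x - n%:~R| < e.
Proof.
have S0 : [set `|x - n%:~R| | n in [set: int]] !=set0.
  by exists `|x - 0%:~R|, 0.
by move=> /(inf_lt S0)[_ [n _ <-] ne]; exists n.
Qed.

Lemma cexp_2pi_int (n : int) : cexp (0 +i* (pi *+ 2 * n%:~R) : C) = 1.
Proof.
have N m : cexp (0 +i* (pi *+ 2 * m%:R) : C) = 1.
  elim: m => [|m IH]; first by rewrite mulr0 cexp0.
  rewrite -natr1 mulrDr mulr1 (_ : _ +i* _ =
    (0 +i* (pi *+ 2 * m%:R)) + (0 +i* (pi *+ 2)) :> C); last by cplx_ring.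
  by rewrite cexpD IH mul1r cexp_2pi cexp0.
case: n => m; first exact: N.
rewrite NegzE rmorphN /= (_ : _ +i* _ = - (0 +i* (pi *+ 2 * m.+1%:R)) :> C).
  by rewrite cexpN N invr1.
by cplx_ring.
Qed.

Lemma cexp_near1 (eta : R) : 0 < eta -> exists2 d : R, 0 < d &
  forall x : R, `|x| < d -> cabs (cexp (0 +i* x : C) - 1) <= eta.
Proof.
move=> eta0; have /cplx_continuousP/(_ _ eta0)[d d0 dP] :=
  cplx_derive_continuous (is_derive_cexp (0 : C)).
exists d => // x xd; have := dP (0 +i* x); rewrite subr0 cexp0 => H.
apply/ltW/H; rewrite (le_lt_trans (cabs_le_ReIm _))//= normr0 add0r//.
Qed.

(** Dividing the exponents by 2 pi before choosing the basis makes the integer parts of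
    [tau * alpha j] contribute full turns. *)
Lemma almost_period (s : seq R) (eta : R) : 0 < eta ->
  exists k (alpha : 'I_k -> R), lin_indep_rat alpha /\
    exists2 eps : R, 0 < eps & forall tau : R,
      (forall j, dist_int (tau * alpha j) < eps) ->
      forall x, x \in s -> cabs (cexp (- (x%:C * (0 +i* tau)) : C) - 1) <= eta.
Proof.
move=> eta0; have [k [alpha [ai aP]]] := rational_basis [seq x / (pi *+ 2) | x <- s].
exists k, alpha; split=> //.
have [d d0 dP] := cexp_near1 eta0.
have pi2 : 0 < pi *+ 2 :> R by rewrite mulrn_wgt0// pi_gt0.
have {}aP x : x \in s ->
    exists n : 'I_k -> int, x = pi *+ 2 * \sum_(j < k) (n j)%:~R * alpha j.
  move=> xs; have [n nP] := aP (x / (pi *+ 2)) (map_f _ xs).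
  by exists n; rewrite -nP mulrC divfK// gt_eqF.
have one x : x \in s -> exists2 eps : R, 0 < eps & forall tau : R,
    (forall j, dist_int (tau * alpha j) < eps) ->
    cabs (cexp (- (x%:C * (0 +i* tau)) : C) - 1) <= eta.
  move=> /aP[n ->].
  (* The errors of [tau * alpha j] enter with weights [n j]; the added 1 keeps [K] positive when all
     weights vanish. *)
  pose K := \sum_(j < k) `|(n j)%:~R : R| + 1.
  have K0 : 0 < K by rewrite ltr_wpDl// sumr_ge0.
  exists (d / (pi *+ 2 * K)); first by rewrite divr_gt0// mulr_gt0.
  move=> tau H.
  have /choice[m mP] j := dist_int_lt (H j).
  pose delta j := tau * alpha j - (m j)%:~R.
  (* The phase splits into an integer multiple of 2 pi and a small remainder. *)
  have E : - ((pi *+ 2 * \sum_(j < k) (n j)%:~R * alpha j)%:C * (0 +i* tau)) =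
     (0 +i* (pi *+ 2 * (- \sum_(j < k) n j * m j)%:~R)) +
     (0 +i* (- (pi *+ 2 * \sum_(j < k) (n j)%:~R * delta j))) :> C.
    have -> : \sum_(j < k) (n j)%:~R * delta j =
        tau * (\sum_(j < k) (n j)%:~R * alpha j) - (\sum_(j < k) n j * m j)%:~R.
      rewrite rmorph_sum/= mulr_sumr -sumrB; apply: eq_bigr => j _.
      by rewrite /delta rmorphM/=; ring.
    by rewrite rmorphN/=; cplx_ring.
  rewrite E cexpD cexp_2pi_int mul1r; apply: dP; rewrite normrN normrM.
  rewrite (gtr0_norm pi2) mulrC -ltr_pdivlMr// (le_lt_trans (ler_norm_sum _ _ _))//.
  rewrite (@le_lt_trans _ _ (\sum_(j < k) `|(n j)%:~R| * (d / (pi *+ 2 * K))))//.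
    by apply: ler_sum => j _; rewrite normrM ler_wpM2l// ltW// mP.
  rewrite -mulr_suml invfM (mulrA d) mulrA ltr_pdivrMr// [ltLHS]mulrC.
  by rewrite ltr_pM2l ?divr_gt0// /K ltrDl.
elim: s one {aP} => [|x s IH] one; first by exists 1.
have [e1 e10 H1] := one x (mem_head _ _).
have [e2 e20 H2] := IH (fun y ys => one y (@mem_behead _ (x :: s) y ys)).
exists (Num.min e1 e2); first by rewrite lt_min e10.
move=> tau H y; rewrite inE => /predU1P[->|ys].
  by apply: H1 => j; have := H j; rewrite lt_min => /andP[].
by apply: H2 => // j; have := H j; rewrite lt_min => /andP[].
Qed.

End Diophantine.

(** * Polynomials with prescribed jets *)

(** Evaluation of a polynomial with the exponents held fixed, so that coefficients and arguments can
    vary independently. *)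
Definition monsum (K : comNzRingType) (n : nat) (M : Type) (ms : seq M)
    (e : M -> 'I_n -> nat) (a : M -> K) (x : 'I_n -> K) : K :=
  \sum_(m <- ms) a m * \prod_(j < n) x j ^+ e m j.

Section Polynomials.
Variable R : realType.
Local Notation C := (Cplx R).
Implicit Types (p q g : {poly C}) (s z : C).

Lemma poly_injective_nonroot p (u : nat -> C) : p != 0 -> injective u ->
  exists n, ~~ root p (u n).
Proof.
move=> p0 ui; apply: contrapT => H.
have := @max_poly_roots _ p (map u (iota 0 (size p))) p0.
rewrite size_map size_iota ltnn map_inj_uniq// iota_uniq => H2.
suff : false by []. apply: H2 => //.
apply/allP => _ /mapP[k _ ->]; apply/negPn/negP => Hk; apply: H; by exists k.
Qed.

Lemma poly_small_nonroot p (r : R) : p != 0 -> 0 < r ->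
  exists2 t : C, t != 0 /\ cabs t <= r & p.[t] != 0.
Proof.
move=> p0 r0; have ri : 0 <= r^-1 by rewrite invr_ge0 ltW.
pose K := Num.bound r^-1.
pose u k : C := (K + k).+1%:R^-1.
have ui : injective u.
  by move=> i j /invr_inj/eqP; rewrite eqr_nat eqSS eqn_add2l => /eqP.
have [n nP] := poly_injective_nonroot p0 ui.
exists (u n) => //; split; first by rewrite invr_eq0 pnatr_eq0.
rewrite cabsV cabs_nat -[r]invrK lef_pV2 ?posrE ?invr_gt0//.
rewrite (le_trans (ltW (archi_boundP ri)))// ler_nat.
exact: (leq_trans (leq_addr n K)).
Qed.

Lemma poly_bounded p (A : R) : exists2 B : R, 0 <= B &
  forall z, cabs z <= A -> cabs p.[z] <= B.
Proof.
elim/poly_ind: p => [|p c [B B0 IH]].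
  by exists 0 => // z _; rewrite horner0 cabs0.
exists (B * `|A| + cabs c); first by rewrite addr_ge0 ?mulr_ge0 ?cabs_ge0.
move=> z zA; rewrite hornerMXaddC (le_trans (cabsD _ _))// lerD2r cabsM.
by rewrite ler_pM ?cabs_ge0 ?IH// (le_trans zA)// ler_norm.
Qed.

Section Kronecker.
Variables (n : nat) (M : eqType) (ms : seq M) (e : M -> 'I_n -> nat).
Hypotheses (ums : uniq ms)
  (einj : {in ms &, forall m m', e m =1 e m' -> m = m'}).

(** Uniqueness of base [N] digits, the lowest being the residue modulo [N]. *)
Let digits_inj (N : nat) k (u v : 'I_k -> nat) :
  (forall j, u j < N)%N -> (forall j, v j < N)%N ->
  (\sum_(j < k) u j * N ^ j = \sum_(j < k) v j * N ^ j)%N -> u =1 v.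
Proof.
elim: k u v => [|k IH] u v uN vN; first by move=> _ [].
rewrite !big_ord_recl !expn0 !muln1.
have E (w : 'I_k.+1 -> nat) : (\sum_(i < k) w (lift ord0 i) * N ^ lift ord0 i =
    N * \sum_(i < k) w (lift ord0 i) * N ^ i)%N.
  by rewrite big_distrr/=; apply: eq_bigr => i _; rewrite expnS mulnCA.
rewrite !E => H.
have N0 : (0 < N)%N by apply: leq_trans (uN ord0).
have u0 : u ord0 = v ord0.
  have := congr1 (modn^~ N) H.
  by rewrite /= ![(_ + N * _)%N]addnC ![(N * _)%N]mulnC !modnMDl !modn_small.
move: H; rewrite u0 => /addnI/eqP; rewrite eqn_pmul2l// => /eqP H.
have {}IH := IH (fun j => u (lift ord0 j)) (fun j => v (lift ord0 j))
  (fun j => uN _) (fun j => vN _) H.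
by move=> j; case: (unliftP ord0 j) => [k' ->|->].
Qed.

(** Kronecker substitution: with [N] above all exponents, setting the [j]-th variable to
    [t ^+ (N ^ j)] sends distinct monomials to distinct powers of [t]. A nonzero non-root [t] then
    makes every coordinate nonzero. *)
Lemma monsum_nonzero_point (a : M -> C) m0 : m0 \in ms -> a m0 != 0 ->
  exists x : 'I_n -> C, (forall j, x j != 0) /\ monsum ms e a x != 0.
Proof.
move=> m0ms a0.
pose N := (\max_(m <- ms) \max_(j < n) e m j).+1.
have eN m j : m \in ms -> (e m j < N)%N.
  move=> mms; rewrite ltnS (leq_trans (leq_bigmax j))//.
  exact: (@leq_bigmax_seq _ ms xpredT (fun m => \max_(j < n) e m j)).
pose k m := (\sum_(j < n) e m j * N ^ j)%N.
pose p : {poly C} := \sum_(m <- ms) a m *: 'X^(k m).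
have pk : p`_(k m0) = a m0.
  rewrite coef_sum (bigD1_seq m0)//= coefZ coefXn eqxx mulr1 big1_seq ?addr0//.
  move=> m /andP[mm0 mms]; rewrite coefZ coefXn; case: eqP => [E|]; last first.
    by rewrite mulr0.
  case/eqP: mm0; apply: einj => //; apply: (@digits_inj N) => [j|j|].
  - exact: eN.
  - exact: eN.
  - by rewrite -/(k m) -/(k m0).
have p0 : p != 0.
  by apply: contraNneq a0 => p0; rewrite -pk p0 coef0.
have [t [t0 _] pt] := poly_small_nonroot p0 ltr01.
exists (fun j => t ^+ (N ^ j)); split=> [j|]; first by rewrite expf_neq0.
rewrite (_ : monsum _ _ _ _ = p.[t])//.
rewrite horner_sum; apply: eq_bigr => m _; rewrite hornerZ hornerXn.
by congr (_ * _); rewrite /k -prodrXr; apply: eq_bigr => j _;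
  rewrite -exprM mulnC.
Qed.

End Kronecker.

(** The variable [i] is solved for: the others are chosen nonzero so that the coefficient of its
    power [e m0 i] survives, and the resulting nonconstant polynomial has a root. Coordinate [i0]
    keeps its nonzero value. *)
Lemma monsum_zero (n : nat) (M : eqType) (ms : seq M) (e : M -> 'I_n -> nat)
    (a : M -> C) m0 (i i0 : 'I_n) :
  uniq ms -> {in ms &, forall m m', e m =1 e m' -> m = m'} ->
  m0 \in ms -> a m0 != 0 -> (0 < e m0 i)%N -> i0 != i ->
  exists2 x : 'I_n -> C, x i0 != 0 & monsum ms e a x = 0.
Proof.
move=> ums einj m0ms a0 ei i0i.
pose ms' := [seq m <- ms | e m i == e m0 i].
(* Forgetting exponent [i] stays injective on [ms'], where that exponent is constant. *)
pose e' m j := if j == i then 0%N else e m j.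
have e'inj : {in ms' &, forall m m', e' m =1 e' m' -> m = m'}.
  move=> m m'; rewrite !mem_filter => /andP[/eqP mi mms] /andP[/eqP m'i m'ms] E.
  apply: einj => // j; have := E j; rewrite /e'.
  by case: eqVneq => // -> _; rewrite mi m'i.
have [||x [x0 xn]] := @monsum_nonzero_point n M ms' e' (filter_uniq _ ums) e'inj a m0.
- by rewrite mem_filter eqxx.
- by [].
pose Q : {poly C} :=
  \sum_(m <- ms) (a m * \prod_(j < n | j != i) x j ^+ e m j) *: 'X^(e m i).
have Qd : Q`_(e m0 i) = monsum ms' e' a x.
  rewrite coef_sum /monsum big_filter [RHS]big_mkcond/=; apply: eq_bigr => m _.
  rewrite coefZ coefXn eq_sym; case: eqP => _; rewrite ?mulr0// mulr1.
  congr (_ * _); rewrite [RHS](bigD1 i)//= /e' eqxx expr0 mul1r.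
  by apply: eq_bigr => j /negbTE ->.
have Qs : size Q != 1%N.
  apply: contraNneq xn => Q1; rewrite -Qd nth_default// Q1//.
have /closed_rootP[y /rootP Qy] := Qs.
exists (fun j => if j == i then y else x j); first by rewrite (negbTE i0i).
rewrite -Qy horner_sum; apply: eq_bigr => m _; rewrite hornerZ hornerXn -mulrA.
congr (_ * _); rewrite (bigD1 i)//= eqxx mulrC; congr (_ * _).
by apply: eq_bigr => j /negbTE ->.
Qed.

Lemma derivn_XsubC_expM s (n k : nat) p : (k < n)%N ->
  ((('X - s%:P) ^+ n * p)^`(k)).[s] = 0.
Proof.
elim: k n p => [|k IH] [//|n] p kn.
  by rewrite derivn0 exprS hornerM hornerM hornerXsubC subrr !mul0r.
rewrite derivSn derivM deriv_exp derivXsubC mul1r.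
rewrite (_ : _ + _ = ('X - s%:P) ^+ n *
    ((n.+1%:R * p + ('X - s%:P) * p^`()))); first exact: IH.
by rewrite /= exprS -[_ *+ n.+1]mulr_natl; ring.
Qed.

Lemma derivn_XsubC_exp s n : ((('X - s%:P) ^+ n)^`(n)).[s] = n`!%:R.
Proof.
elim: n => [|n IH]; first by rewrite derivn0 expr0 hornerC fact0.
rewrite derivSn deriv_exp derivXsubC mul1r /= derivnMn hornerMn IH.
by rewrite factS natrM mulr_natl.
Qed.

Lemma poly_with_jet s (x : nat -> C) n :
  exists p, forall k, (k < n)%N -> p^`(k).[s] = x k.
Proof.
elim: n => [|n [p IH]]; first by exists 0.
have n0 : n`!%:R != 0 :> C by rewrite pnatr_eq0 -lt0n fact_gt0.
exists (p + ((x n - p^`(n).[s]) / n`!%:R) *: ('X - s%:P) ^+ n) => k.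
rewrite ltnS leq_eqVlt derivnD derivnZ hornerD hornerZ => /predU1P[->|kn].
  by rewrite derivn_XsubC_exp divfK// addrC subrK.
rewrite IH// -[('X - s%:P) ^+ n]mulr1 derivn_XsubC_expM//.
by rewrite mulr0 addr0.
Qed.

(** Hermite interpolation through a Bezout identity: a multiple of ('X - s0)^n congruent to [q]
    modulo ('X - s1)^n. *)
Lemma poly_with_two_jets s0 s1 (y : nat -> C) n : s0 != s1 ->
  exists g, (forall k, (k < n)%N -> g^`(k).[s0] = 0) /\
            (forall k, (k < n)%N -> g^`(k).[s1] = y k).
Proof.
move=> s01; have [q qP] := poly_with_jet s1 y n.
have cop : coprimep (('X - s0%:P) ^+ n) (('X - s1%:P) ^+ n).
  apply/coprimep_expl/coprimep_expr.
  by rewrite coprimep_XsubC root_XsubC eq_sym.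
have /Bezout_eq1_coprimepP[[u v] /= uv] := cop.
exists (('X - s0%:P) ^+ n * (u * q)); split=> k kn.
  exact: derivn_XsubC_expM.
have -> : ('X - s0%:P) ^+ n * (u * q) = q - ('X - s1%:P) ^+ n * (v * q).
  by rewrite -[X in _ = X - _]mul1r -uv; ring.
by rewrite derivnB hornerD hornerN derivn_XsubC_expM// subr0 qP.
Qed.

(* The perturbation p + t g keeps the jet of p at s0; its value at the nearby
   point s1 is a nonzero polynomial in t, so some small t works. *)
Lemma interpolant_exists (n : nat) (M : eqType) (ms : seq M)
    (e : M -> 'I_n.+1 -> nat) (a : M -> C -> C) m0 (i : 'I_n.+1) s0 (rho : R) :
  uniq ms -> {in ms &, forall m m', e m =1 e m' -> m = m'} ->
  m0 \in ms -> (0 < e m0 i)%N -> (0 < i)%N ->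
  {for s0, continuous (a m0)} -> a m0 s0 != 0 -> 0 < rho ->
  exists (r : R) (q : {poly C}) (s1 : C),
    [/\ 0 < r <= rho, forall z, cabs (z - s0) <= 2 * r -> q.[z] != 0,
      monsum ms e (a^~ s0) (fun j => q^`(j).[s0]) = 0, cabs (s1 - s0) < r / 4 &
      monsum ms e (a^~ s1) (fun j => q^`(j).[s1]) != 0].
Proof.
move=> ums einj m0ms ei i0 ac a0 rho0.
have [|x x0 xz] := @monsum_zero _ _ ms e (a^~ s0) m0 i ord0 ums einj m0ms a0 ei.
  by rewrite eq_sym -val_eqE/= -lt0n.
pose xn k := if insub k is Some j then x j else 0.
have xnE (j : 'I_n.+1) : xn j = x j by rewrite /xn valK.
have [p pP] := poly_with_jet s0 xn n.+1.
have ps0 : p.[s0] = x ord0 by have := pP 0%N isT; rewrite (xnE ord0).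
(* Zero-freeness budget: [p] moves by less than [mu / 2] on the disc of radius [2 * r] and the
   perturbation adds at most [mu / 4]. *)
pose mu := cabs (x ord0).
have mu0 : 0 < mu by rewrite cabs_gt0.
have /cplx_continuousP/(_ (mu / 2) ltac:(lra))[d1 d10 d1P] :=
  cplx_derive_continuous (cplx_is_derive_horner p s0).
have aa0 : 0 < cabs (a m0 s0) by rewrite cabs_gt0.
have /cplx_continuousP/(_ _ aa0)[d2 d20 d2P] := ac.
pose r := Num.min rho (d1 / 4).
have r0 : 0 < r by rewrite lt_min rho0 divr_gt0.
have rrho : r <= rho by rewrite ge_min lexx.
have rd1 : r <= d1 / 4 by rewrite ge_min lexx orbT.
(* The first bound puts [s1] within [r / 4] of [s0]; the second keeps the coefficient of [m0]
   nonzero at [s1]. *)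
pose h := Num.min (r / 8) (d2 / 2).
have h0 : 0 < h by rewrite lt_min !divr_gt0.
have hr : h <= r / 8 by rewrite ge_min lexx.
have hd2 : h <= d2 / 2 by rewrite ge_min lexx orbT.
pose s1 := s0 + h%:C.
have s1s0 : s1 - s0 = h%:C by rewrite /s1 addrC addKr.
have cs1 : cabs (s1 - s0) = h by rewrite s1s0 cabs_real gtr0_norm.
have s01 : s0 != s1 by rewrite eq_sym -subr_eq0 -cabs_gt0 cs1.
have a1 : a m0 s1 != 0.
  have : cabs (s1 - s0) < d2 by rewrite cs1; lra.
  by move=> /d2P; apply: contraTneq => ->; rewrite sub0r cabsN ltxx.
have [y [_ yn]] := @monsum_nonzero_point _ _ _ e ums einj (a^~ s1) m0 m0ms a1.
pose yn' k := (if insub k is Some j then y j else 0) - p^`(k).[s1].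
have [g [g0 g1]] := poly_with_two_jets yn' n.+1 s01.
have [B B0 gB] := poly_bounded g (cabs s0 + 2 * r).
(* [T] is nonzero because at [t = 1] the jet at [s1] becomes [y]. *)
pose T : {poly C} := \sum_(m <- ms) a m s1 *:
  \prod_(j < n.+1) ((p^`(j).[s1])%:P + (g^`(j).[s1])%:P * 'X) ^+ e m j.
have TE t : T.[t] = monsum ms e (a^~ s1) (fun j => (p + t *: g)^`(j).[s1]).
  rewrite horner_sum; apply: eq_bigr => m _; rewrite hornerZ horner_prod.
  congr (_ * _); apply: eq_bigr => j _.
  by rewrite horner_exp hornerD hornerMX !hornerC derivnD derivnZ hornerD hornerZ mulrC.
have T1 : T != 0.
  apply: contraNneq yn => T0; have := TE 1; rewrite T0 horner0 => /esym TE1.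
  rewrite -TE1 /monsum; apply/eqP/eq_bigr => m _; congr (_ * _).
  apply: eq_bigr => j _; rewrite scale1r derivnD hornerD g1//.
  by rewrite /yn' valK addrC subrK.
have [t [t0 tr] Tt] := @poly_small_nonroot T (mu / 4 / (B + 1)) T1
  ltac:(by rewrite !divr_gt0//; lra).
exists r, (p + t *: g), s1; split.
- by rewrite r0.
- move=> z zs; have pz := d1P z ltac:(lra).
  rewrite -cabs_gt0 hornerD hornerZ.
  have gz : cabs g.[z] <= B.
    by apply: gB; have := cabsD s0 (z - s0); rewrite [s0 + _]addrC subrK; lra.
  have tg : cabs (t * g.[z]) <= mu / 4.
    rewrite cabsM (le_trans (ler_pM (cabs_ge0 _) (cabs_ge0 _) tr gz))//.
    rewrite mulrAC ler_pdivrMr; last by lra.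
    by rewrite ler_wpM2l//; clear -mu0; lra.
  have := cabs_dist_le (p.[s0]) (p.[s0] - p.[z]).
  rewrite subKr cabs_distC ps0 -/mu.
  have := cabs_dist_le p.[z] (- (t * g.[z])); rewrite opprK cabsN.
  by rewrite ps0 in pz; lra.
- rewrite -[RHS]xz; apply: eq_bigr => m _; congr (_ * _).
  apply: eq_bigr => j _.
  by rewrite derivnD derivnZ hornerD hornerZ g0// mulr0 addr0 pP// xnE.
- by rewrite cs1; lra.
- by rewrite -TE.
Qed.

End Polynomials.

(** * Continuity, squares and unit cells *)

Section MonsumAnalysis.
Variable R : realType.
Local Notation C := (Cplx R).
Variables (n : nat) (M : eqType) (ms : seq M) (e : M -> 'I_n -> nat).

Let env := ((M -> C) * ('I_n -> C))%type.
Let bnd (B : R) (v : env) := (forall m, m \in ms -> cabs (v.1 m) <= B) /\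
  forall j, cabs (v.2 j) <= B.
Let close (eta : R) (v w : env) :=
  (forall m, m \in ms -> cabs (w.1 m - v.1 m) <= eta) /\
  forall j, cabs (w.2 j - v.2 j) <= eta.

(** Boundedness travels with uniform continuity because products need it. Only [v] is bounded by
    [B]; [w] is merely close to it, as shifted data are. *)
Let ucont (B : R) (phi : env -> C) :=
  (exists2 D : R, 0 <= D & forall v, bnd B v -> cabs (phi v) <= D) /\
  forall r : R, 0 < r -> exists2 eta : R, 0 < eta & forall v w, bnd B v ->
    close eta v w -> cabs (phi w - phi v) <= r.

Let closeW (eta eta' : R) v w : eta <= eta' -> close eta v w -> close eta' v w.
Proof.
by move=> ee [h1 h2]; split => [m /h1|j]; [|have := h2 j] => /le_trans; apply.
Qed.

Let ucont_cst B (k : C) : ucont B (fun=> k).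
Proof.
split; first by exists (cabs k) => //; exact: cabs_ge0.
by move=> r r0; exists 1 => // v w _ _; rewrite subrr cabs0 ltW.
Qed.

Let ucontD B phi psi : ucont B phi -> ucont B psi ->
  ucont B (fun v => phi v + psi v).
Proof.
move=> [[D D0 DP] uphi] [[D' D'0 D'P] upsi]; split.
  exists (D + D'); first by rewrite addr_ge0.
  by move=> v vB; rewrite (le_trans (cabsD _ _))// lerD ?DP ?D'P.
move=> r r0; have [a a0 aP] := uphi (r / 2) ltac:(lra).
have [b b0 bP] := upsi (r / 2) ltac:(lra).
exists (Num.min a b); first by rewrite lt_min a0.
move=> v w vB vw; rewrite opprD addrACA (le_trans (cabsD _ _))//.
rewrite [leRHS](splitr r) lerD//; [apply: aP|apply: bP] => //;
  by apply: closeW vw; rewrite ge_min lexx ?orbT.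
Qed.

Let ucontM B phi psi : ucont B phi -> ucont B psi ->
  ucont B (fun v => phi v * psi v).
Proof.
move=> [[D D0 DP] uphi] [[D' D'0 D'P] upsi]; split.
  exists (D * D'); first by rewrite mulr_ge0.
  by move=> v vB; rewrite cabsM ler_pM ?cabs_ge0 ?DP ?D'P.
move=> r r0.
have [a a0 aP] := uphi (r / 2 / (D' + 1)) ltac:(by rewrite !divr_gt0//; lra).
(* The tolerance 1 bounds [psi w] by [D' + 1]. *)
have p0 : 0 < Num.min 1 (r / 2 / (D + 1)) by rewrite lt_min ltr01 !divr_gt0//; lra.
have [b b0 bP] := upsi _ p0.
exists (Num.min a b); first by rewrite lt_min a0.
move=> v w vB vw.
have wa : cabs (phi w - phi v) <= r / 2 / (D' + 1).
  by apply: aP => //; apply: closeW vw; rewrite ge_min lexx.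
have wb : cabs (psi w - psi v) <= Num.min 1 (r / 2 / (D + 1)).
  by apply: bP => //; apply: closeW vw; rewrite ge_min lexx orbT.
move: wb; rewrite le_min => /andP[wb1 wb2].
have pw : cabs (psi w) <= D' + 1.
  have := cabs_dist_le (psi w) (psi v); have := D'P _ vB; lra.
have -> : phi w * psi w - phi v * psi v =
  (phi w - phi v) * psi w + phi v * (psi w - psi v) by ring.
rewrite (le_trans (cabsD _ _))// !cabsM [leRHS](splitr r) lerD//.
  rewrite (le_trans (ler_pM (cabs_ge0 _) (cabs_ge0 _) wa pw))// divfK//.
  by rewrite gt_eqF//; lra.
rewrite (le_trans (ler_pM (cabs_ge0 _) (cabs_ge0 _) (DP _ vB) wb2))//.
rewrite mulrCA mulrC ler_piMl//; first by lra.
rewrite ler_pdivrMr ?mul1r; lra.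
Qed.

Let ucont_coef B m : 0 <= B -> m \in ms -> ucont B (fun v => v.1 m).
Proof.
move=> B0 mms; split; first by exists B => // v [h _]; exact: h.
by move=> r r0; exists r => // v w _ [h _]; exact: h.
Qed.

Let ucont_var B j : 0 <= B -> ucont B (fun v => v.2 j).
Proof.
move=> B0; split; first by exists B => // v [_ h]; exact: h.
by move=> r r0; exists r => // v w _ [_ h]; exact: h.
Qed.

Let ucont_monsum B : 0 <= B -> ucont B (fun v => monsum ms e v.1 v.2).
Proof.
move=> B0.
have ucX phi k : ucont B phi -> ucont B (fun v => phi v ^+ k).
  move=> uphi; elim: k => [|k IH].
    by rewrite (_ : (fun _ => _) = fun=> 1) //; exact: ucont_cst.
  rewrite (_ : (fun _ => _) = fun v => phi v * phi v ^+ k); first exact: ucontM.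
  by apply/funext => v; rewrite exprS.
have ucP m (r : seq 'I_n) : ucont B (fun v => \prod_(j <- r) v.2 j ^+ e m j).
  elim: r => [|j r IH].
    rewrite (_ : (fun _ => _) = fun=> 1); first exact: ucont_cst.
    by apply/funext => v; rewrite big_nil.
  rewrite (_ : (fun _ => _) = fun v : env => v.2 j ^+ e m j *
      \prod_(j <- r) v.2 j ^+ e m j); last by apply/funext => v; rewrite big_cons.
  by apply: ucontM => //; apply: ucX; exact: ucont_var.
have S (r : seq M) : {subset r <= ms} ->
    ucont B (fun v => \sum_(m <- r) v.1 m * \prod_(j < n) v.2 j ^+ e m j).
  elim: r => [|m r IH] rms.
    rewrite (_ : (fun _ => _) = fun=> 0); first exact: ucont_cst.
    by apply/funext => v; rewrite big_nil.
  rewrite (_ : (fun _ => _) = fun v : env =>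
      v.1 m * \prod_(j < n) v.2 j ^+ e m j +
      \sum_(m <- r) v.1 m * \prod_(j < n) v.2 j ^+ e m j); last first.
    by apply/funext => v; rewrite big_cons.
  apply: ucontD; last by apply: IH => x xr; apply: rms; rewrite inE xr orbT.
  apply: ucontM; last exact: ucP.
  by apply: ucont_coef => //; apply: rms; rewrite mem_head.
exact: S.
Qed.

Lemma monsum_bounded (B : R) : 0 <= B -> exists D : R,
  forall (a : M -> C) (x : 'I_n -> C), (forall m, m \in ms -> cabs (a m) <= B) ->
    (forall j, cabs (x j) <= B) -> cabs (monsum ms e a x) <= D.
Proof.
move=> /ucont_monsum[[D _ DP] _]; exists D => a x aB xB.
exact: (DP (a, x)).
Qed.

Lemma monsum_uniformly_continuous (B r : R) : 0 <= B -> 0 < r ->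
  exists2 eta : R, 0 < eta & forall (a a' : M -> C) (x x' : 'I_n -> C),
    (forall m, m \in ms -> cabs (a m) <= B) -> (forall j, cabs (x j) <= B) ->
    (forall m, m \in ms -> cabs (a' m - a m) <= eta) ->
    (forall j, cabs (x' j - x j) <= eta) ->
    cabs (monsum ms e a' x' - monsum ms e a x) <= r.
Proof.
move=> /ucont_monsum[_ H] /H[eta eta0 etaP]; exists eta => // a a' x x' ? ? ? ?.
exact: (etaP (a, x) (a', x')).
Qed.

Lemma derivable_monsum (a : M -> C -> C) (x : 'I_n -> C -> C) (s : C) :
  (forall m, m \in ms -> derivable (a m) s 1) ->
  (forall j, derivable (x j) s 1) ->
  derivable (fun z => monsum ms e (a^~ z) (x^~ z)) s 1.
Proof.
move=> ad xd.
have dM (f g : C -> C) : derivable f s 1 -> derivable g s 1 ->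
    derivable (fun z => f z * g z) s 1.
  by move=> /derivableP fd /derivableP gd; have [] := cplx_is_deriveM fd gd.
have dX (f : C -> C) k : derivable f s 1 -> derivable (fun z => f z ^+ k) s 1.
  move=> fd; elim: k => [|k IH]; first exact: derivable_cst.
  rewrite (_ : (fun _ => _) = fun z => f z * f z ^+ k); first exact: dM.
  by apply/funext => v; rewrite exprS.
have dP m (r : seq 'I_n) : derivable (fun z => \prod_(j <- r) x j z ^+ e m j) s 1.
  elim: r => [|j r IH].
    rewrite (_ : (fun _ => _) = cst 1); first exact: derivable_cst.
    by apply/funext => v; rewrite big_nil.
  rewrite (_ : (fun _ => _) = fun z => x j z ^+ e m j *
      \prod_(j <- r) x j z ^+ e m j); last by apply/funext => v; rewrite big_cons.
  exact: (dM (fun z => x j z ^+ e m j) _ (dX (x j) (e m j) (xd j)) IH).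
suff S (r : seq M) : {subset r <= ms} ->
    derivable (fun z => \sum_(m <- r) a m z * \prod_(j < n) x j z ^+ e m j) s 1.
  exact: S.
elim: r => [|m r IH] rms.
  rewrite (_ : (fun _ => _) = cst 0); first exact: derivable_cst.
  by apply/funext => v; rewrite big_nil.
rewrite (_ : (fun _ => _) = fun z =>
    a m z * \prod_(j < n) x j z ^+ e m j +
    \sum_(m <- r) a m z * \prod_(j < n) x j z ^+ e m j); last first.
  by apply/funext => v; rewrite big_cons.
have d1 : derivable (fun z => a m z * \prod_(j < n) x j z ^+ e m j) s 1.
  exact: (dM (a m) _ (ad m (rms m (mem_head m r))) (dP m (index_enum 'I_n))).
have d2 := IH (fun y yr => rms y (@mem_behead _ (m :: r) y yr)).
by have [] := cplx_is_deriveD (derivableP d1) (derivableP d2).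
Qed.

End MonsumAnalysis.

(** * Closed squares as test sets for universality *)

Section Square.
Variable R : realType.
Local Notation C := (Cplx R).

(** A square is the image of a product of segments and its complement is a union of four
    half-planes, which makes compactness and connectedness elementary. *)
Definition square (c : C) (r : R) : set C :=
  [set z | `|complex.Re (z - c)| <= r /\ `|complex.Im (z - c)| <= r].

Lemma cabs_square (c z : C) r : square c r z -> cabs (z - c) <= 2 * r.
Proof. by move=> [h1 h2]; rewrite (le_trans (cabs_le_ReIm _))//; lra. Qed.

Lemma ball_square (c z : C) r : cabs (z - c) <= r -> square c r z.
Proof.
by move=> zc; split; apply: le_trans zc; [exact: ler_Re_cabs|exact: ler_Im_cabs].
Qed.

Lemma compact_square (c : C) r : compact (square c r).
Proof.
pose f (p : R * R) : C := p.1 +i* p.2.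
pose a := complex.Re c; pose b := complex.Im c.
have -> : square c r =
    f @` (`[a - r, a + r] `*` `[b - r, b + r]).
  apply/seteqP; split=> [[x y] [/= h1 h2]|_ [[x y] [/= h1 h2] <-]].
    exists (x, y) => //; split; rewrite /= in_itv/=.
      by move: h1; rewrite raddfB/= -/a ler_norml; lra.
    by move: h2; rewrite raddfB/= -/b ler_norml; lra.
  move: h1 h2; rewrite !in_itv/= => h1 h2; split.
    by rewrite raddfB/= -/a ler_norml; lra.
  by rewrite raddfB/= -/b ler_norml; lra.
apply: continuous_compact; last by apply: compact_setX; exact: segment_compact.
apply: continuous_subspaceT => -[x y] P /nbhs_cabsP[e e0 eP].
have e20 : 0 < e / 2 by lra.
exists (ball x (e / 2), ball y (e / 2)) => /=.
  by split; apply: nbhsx_ballx.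
move=> [x' y'] [/= xx yy]; apply: eP.
rewrite (le_lt_trans (cabs_le_ReIm _))// !raddfB /=.
move: xx yy; rewrite /ball/= !(distrC _ x') !(distrC _ y'); lra.
Qed.

Lemma connected_convex (A : set C) :
  (forall x y, A x -> A y -> forall t : R, 0 <= t <= 1 -> A (x + t%:C * (y - x))) ->
  connected A.
Proof.
move=> Ac; have [->|/set0P[p Ap]] := eqVneq A set0; first exact: connected0.
pose seg y := (fun t : R => p + t%:C * (y - p)) @` `[0, 1]%classic.
have -> : A = \bigcup_(y in A) seg y.
  apply/seteqP; split=> [y Ay|_ [y Ay [t t01 <-]]].
    exists y => //; exists 1; first by rewrite /= in_itv/= ler01 lexx.
    by rewrite rmorph1 mul1r addrC subrK.
  by apply: Ac => //; move: t01; rewrite /= in_itv.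
apply: bigcup_connected.
  exists p => y _; exists 0; first by rewrite /= in_itv/= ler01 lexx.
  by rewrite rmorph0 mul0r addr0.
move=> y Ay; apply: connected_continuous_connected; first exact: segment_connected.
apply: continuous_subspaceT => t; apply/real_cplx_continuousP => e e0.
have k0 : 0 < cabs (y - p) + 1 by rewrite ltr_wpDl// cabs_ge0.
exists (e / (cabs (y - p) + 1)); first by rewrite divr_gt0.
move=> s; rewrite ltr_pdivlMr// => st.
have -> : p + s%:C * (y - p) - (p + t%:C * (y - p)) = (s - t)%:C * (y - p).
  by rewrite rmorphB; ring.
rewrite cabsM cabs_real (le_lt_trans _ st)// ler_wpM2l// lerDl//.
Qed.

Let affine_part (p : C -> R) (x y : C) (t : R) :
  {morph p : w1 w2 / w1 + w2} -> (forall (k : R) w, p (k%:C * w) = k * p w) ->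
  p (x + t%:C * (y - x)) = (1 - t) * p x + t * p y.
Proof.
move=> pD pZ; have -> : x + t%:C * (y - x) = (1 - t)%:C * x + t%:C * y.
  by rewrite rmorphB rmorph1; ring.
by rewrite pD !pZ.
Qed.

Lemma connected_halfplane (p : C -> R) (k : R) :
  {morph p : w1 w2 / w1 + w2} -> (forall (k : R) w, p (k%:C * w) = k * p w) ->
  connected [set z | k < p z].
Proof.
move=> pD pZ; apply: connected_convex => x y /= kx ky t /andP[t0 t1].
rewrite affine_part//; have [->|tn1] := eqVneq t 1.
  by rewrite subrr mul0r add0r mul1r.
have t1' : t < 1 by rewrite lt_neqAle tn1.
have : (1 - t) * k < (1 - t) * p x by rewrite ltr_pM2l// subr_gt0.
have : t * k <= t * p y by rewrite ler_wpM2l// ltW.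
lra.
Qed.

(** The half-planes are convex, and each one added meets the union of those before it at an explicit
    point. *)
Lemma connected_square_setC (c : C) r : connected (~` square c r).
Proof.
pose a := complex.Re c; pose b := complex.Im c.
pose H1 : set C := [set z | a + r < complex.Re z].
pose H2 : set C := [set z | b + r < complex.Im z].
pose H3 : set C := [set z | r - a < - complex.Re z].
pose H4 : set C := [set z | r - b < - complex.Im z].
have c1 : connected H1.
  apply: connected_halfplane; first by move=> [? ?] [? ?].
  by move=> k [u v] /=; rewrite mul0r subr0.
have c2 : connected H2.
  apply: connected_halfplane; first by move=> [? ?] [? ?].
  by move=> k [u v] /=; rewrite mul0r addr0.
have c3 : connected H3.
  apply: (@connected_halfplane (fun z => - complex.Re z)).
    by move=> [? ?] [? ?] /=; rewrite opprD.
  by move=> k [u v] /=; rewrite mul0r subr0 mulrN.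
have c4 : connected H4.
  apply: (@connected_halfplane (fun z => - complex.Im z)).
    by move=> [? ?] [? ?] /=; rewrite opprD.
  by move=> k [u v] /=; rewrite mul0r addr0 mulrN.
have -> : ~` square c r = ((H1 `|` H2) `|` H3) `|` H4.
  apply/seteqP; split=> [z|z].
    move=> zc; apply: contrapT => H; apply: zc.
    have h1 : complex.Re z <= a + r.
      by rewrite leNgt; apply/negP => h; apply: H; do 3 left.
    have h2 : complex.Im z <= b + r.
      by rewrite leNgt; apply/negP => h; apply: H; do 2 left; right.
    have h3 : - complex.Re z <= r - a.
      by rewrite leNgt; apply/negP => h; apply: H; left; right.
    have h4 : - complex.Im z <= r - b.
      by rewrite leNgt; apply/negP => h; apply: H; right.
    by split; rewrite raddfB/= -/a -/b ler_norml; lra.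
  rewrite /H1 /H2 /H3 /H4 /=; move=> zH [].
  rewrite !raddfB/= -/a -/b !ler_norml => h1 h2.
  by case: zH => [[[|]|]|]; lra.
have k0 : r <= `|r| by exact: ler_norm.
apply: connectedU => //.
  exists ((a + `|r| + 1) +i* (b - `|r| - 1)); split.
    by left; left; rewrite /H1 /=; lra.
  by rewrite /H4 /=; lra.
apply: connectedU => //.
  exists ((a - `|r| - 1) +i* (b + `|r| + 1)); split.
    by right; rewrite /H2 /=; lra.
  by rewrite /H3 /=; lra.
apply: connectedU => //.
exists ((a + `|r| + 1) +i* (b + `|r| + 1)); split; rewrite /H1 /H2 /=; lra.
Qed.

End Square.

(** * From lower density to counting unit cells *)

Section Cells.
Variable R : realType.
Implicit Types (A : set R) (T c : R).

(** Monotonicity of the outer measure applies to sets of shifts whose measurability is not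
    established. *)
Lemma lebesgue_measure_mono (A B : set R) : A `<=` B ->
  (lebesgue_measure A <= lebesgue_measure B)%E.
Proof. exact: (le_outer_measure ((wlength idfun)^*)%mu). Qed.

Lemma lebesgue_measure_seg (a b : R) : a <= b ->
  lebesgue_measure (`[a, b]%classic : set R) = (b - a)%:E.
Proof.
move=> ab; rewrite lebesgue_measure_itv/= lte_fin.
by case: ltgtP ab => // -> _; rewrite subrr.
Qed.

Lemma measure_cells_le (ks : seq nat) (B : set R) : measurable B ->
  (lebesgue_measure (\big[setU/B]_(k <- ks) `[(k%:R : R), (k.+1%:R : R)]%classic)
   <= lebesgue_measure B + (size ks)%:R%:E)%E.
Proof.
move=> mB; suff [] : measurable (\big[setU/B]_(k <- ks)
    `[(k%:R : R), (k.+1%:R : R)]%classic) /\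
  (lebesgue_measure (\big[setU/B]_(k <- ks) `[(k%:R : R), (k.+1%:R : R)]%classic)
   <= lebesgue_measure B + (size ks)%:R%:E)%E by [].
elim: ks => [|k ks [IH1 IH2]]; first by rewrite big_nil adde0.
rewrite big_cons; split; first exact: measurableU.
rewrite (le_trans (measureU2 _ _ _))//= lebesgue_measure_seg ?ler_nat//.
have -> : (size ks).+1%:R = 1 + (size ks)%:R :> R by rewrite nat1r.
have -> : k.+1%:R - k%:R = 1 :> R by rewrite -natrB// subSnn.
by rewrite EFinD addeCA leeD2l.
Qed.

(* The two end strips absorb the translation by the ordinate of s0. *)
Lemma many_cells A c T (k0 : nat) : 0 < c -> 2 * k0%:R + 1 <= T ->
  (c%:E <= nu T A)%E ->
  exists ks : seq nat, [/\ uniq ks, c * T - 2 * k0%:R - 1 <= (size ks)%:R &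
    forall k, k \in ks -> [/\ (k0 <= k)%N, k%:R + 1 <= T - k0%:R &
      exists2 tau, A tau & k%:R <= tau <= k%:R + 1]].
Proof.
move=> c0 kT cA.
have T0 : 0 < T by rewrite (lt_le_trans _ kT)// ltr_wpDl// mulr_ge0.
pose P k := `[< [/\ (k0 <= k)%N, k%:R + 1 <= T - k0%:R &
      exists2 tau, A tau & k%:R <= tau <= k%:R + 1] >].
pose ks := [seq k <- iota 0 (Num.bound T) | P k].
exists ks; split.
- by rewrite filter_uniq// iota_uniq.
- pose B : set R := `[0, k0%:R]%classic `|` `[T - k0%:R - 1, T]%classic.
  have mB : measurable B by exact: measurableU.
  have k00 : 0 <= k0%:R :> R by [].
  have muB : (lebesgue_measure B <= (k0%:R + (k0%:R + 1))%:E)%E.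
    rewrite (le_trans (measureU2 _ _ _))//= !lebesgue_measure_seg//; last by lra.
    by rewrite -EFinD lee_fin; lra.
  (* A shift in [[0, T]] lies in an end strip or in the cell of its integer part; comparing measures
     bounds the number of cells from below. *)
  have sub : `[0%R, T]%classic `&` A `<=`
      \big[setU/B]_(k <- ks) `[(k%:R : R), (k.+1%:R : R)]%classic.
    move=> tau [/=]; rewrite in_itv/= => /andP[tau0 tauT] Atau.
    have mem k : k \in ks -> k%:R <= tau <= k%:R + 1 ->
        (\big[setU/B]_(k <- ks) `[(k%:R : R), (k.+1%:R : R)]%classic) tau.
      elim: (ks) => // k' ks' IH; rewrite inE big_cons => /predU1P[<-|kks] tk.
        by left; rewrite /= in_itv/= -natr1.
      by right; exact: IH.
    have memB : B tau ->
        (\big[setU/B]_(k <- ks) `[(k%:R : R), (k.+1%:R : R)]%classic) tau.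
      by move=> Bt; elim: (ks) => [|k' ks' IH]; rewrite ?big_nil// big_cons; right.
    have [tk|tk] := leP tau k0%:R.
      by apply: memB; left; rewrite /= in_itv/= tau0.
    have [tk'|tk'] := leP (T - k0%:R - 1) tau.
      by apply: memB; right; rewrite /= in_itv/= tk'.
    have /andP[t1 t2] := truncn_itv tau0.
    have t3 : (Num.truncn tau)%:R <= tau <= (Num.truncn tau)%:R + 1.
      by rewrite t1 natr1 ltW.
    apply: (mem (Num.truncn tau)) => //.
    rewrite mem_filter mem_iota /= add0n; apply/andP; split.
      apply/asboolP; split; last by exists tau.
        by rewrite -ltnS -(ltr_nat R) (lt_trans tk).
      by lra.
    rewrite -(ltr_nat R) (le_lt_trans t1)// (lt_le_trans tk')//.
    rewrite (le_trans _ (ltW (archi_boundP (ltW T0))))//.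
    have : 0 <= k0%:R :> R by []. lra.
  have := le_trans (lebesgue_measure_mono sub) (measure_cells_le ks mB).
  have h1 : ((c * T)%:E <= lebesgue_measure (`[0%R, T]%classic `&` A))%E.
    by move: cA; rewrite /nu muleC lee_pdivlMr.
  move=> /(le_trans h1) /le_trans /(_ (leeD2r _ muB)).
  rewrite -EFinD lee_fin; lra.
- by move=> k; rewrite mem_filter => /andP[/asboolP].
Qed.

(** The more numerous parity keeps at least half of the cells and leaves a gap between any two of
    them. *)
Lemma parity_class (ks : seq nat) : uniq ks -> exists ks' : seq nat,
  [/\ uniq ks', {subset ks' <= ks}, (size ks <= 2 * size ks')%N &
    forall k k', k \in ks' -> k' \in ks' -> (k < k')%N -> (k.+2 <= k')%N].
Proof.
move=> uks; pose cl b := [seq k <- ks | odd k == b].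
have P b k k' : k \in cl b -> k' \in cl b -> (k < k')%N -> (k.+2 <= k')%N.
  rewrite !mem_filter => /andP[/eqP kb _] /andP[/eqP k'b _]; rewrite leq_eqVlt.
  by case/orP=> // /eqP E; move: k'b; rewrite -E /= kb; case: (b).
have sz : (size ks = size (cl true) + size (cl false))%N.
  rewrite !size_filter -(count_predC (fun k => odd k == true)); congr (_ + _)%N.
  by apply: eq_count => k /=; case: (odd k).
have [h|h] := leqP (size (cl true)) (size (cl false)).
  exists (cl false); split; [exact: filter_uniq|exact: mem_subseq (filter_subseq _ _)
    |lia|exact: P].
exists (cl true); split; [exact: filter_uniq|exact: mem_subseq (filter_subseq _ _)
  |lia|exact: P].
Qed.

Lemma limf_einf_gt0 (f : R -> \bar R) : (0 < limf_einf f (pinfty_nbhs R))%E ->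
  exists2 c : R, 0 < c & \forall T \near +oo, (c%:E <= f T)%E.
Proof.
rewrite limf_einfE => /ereal_sup_gt[_ [V VF <-] V0].
have [c c0 cV] : exists2 c : R, 0 < c & (c%:E <= ereal_inf (f @` V))%E.
  case: (ereal_inf _) V0 => [r| |//].
    by rewrite lte_fin => r0; exists r.
  by exists 1 => //; rewrite leey.
exists c => //; apply: filterS VF => T VT.
by rewrite (le_trans cV)//; apply: ereal_inf_lbound; exists T.
Qed.

End Cells.

(** * Zeros of differential polynomials *)

Section DifferentialPolynomial.
Variable R : realType.
Local Notation C := (Cplx R).

Definition dirichlet_series_of (g : halfplane R -> C) (a : nat -> C)
    (lam : nat -> R) := forall s : halfplane R,
  cvgn [normed series (gdirichlet_term a lam (val s))] /\
  series (gdirichlet_term a lam (val s)) @ \oo --> g s.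

Lemma diff_polyE (l : nat) (P : mpoly.mpoly l.+1 (hpfun R)) (L : C -> C)
    (s : halfplane R) :
  diff_poly P L s = monsum (mpoly.msupp P)
    (fun (m : mpoly.multinom l.+1) (j : 'I_l.+1) => m j)
    (fun m => hpext (mpoly.mcoeff m P : halfplane R -> C) (val s))
    (fun j => derive1n j L (val s)).
Proof.
rewrite /diff_poly /mpoly.map_mpoly /mpoly.mmap rmorph_sum/=.
apply: eq_bigr => m _; rewrite mpoly.mevalM mpoly.mevalC hpext_val.
congr (_ * _); rewrite /mpoly.mmap1 rmorph_prod/=; apply: eq_bigr => j _.
by rewrite rmorphXn/= mpoly.mevalXU.
Qed.

Lemma dirichlet_family_shift (M : eqType) (ms : seq M)
    (g : M -> halfplane R -> C) (x1 x2 eta : R) :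
  (forall m, m \in ms -> exists a lam, dirichlet_series_of (g m) a lam) ->
  2^-1 < x1 -> x1 <= x2 -> 0 < eta ->
  exists (lams : seq R) (eta' : R), 0 < eta' /\ forall tau : R,
    (forall x, x \in lams -> cabs (cexp (- (x%:C * (0 +i* tau)) : C) - 1) <= eta') ->
    forall m, m \in ms -> forall s, x1 <= complex.Re s <= x2 ->
      cabs (hpext (g m) (s + (0 +i* tau)) - hpext (g m) s) <= eta.
Proof.
move=> gD x1h x12 eta0; elim: ms gD => [|m ms IH] gD.
  by exists [::], 1; split => // tau _ m; rewrite in_nil.
have [lams [e1 [e10 H1]]] := IH (fun y ym => gD y (@mem_behead _ (m :: ms) y ym)).
have [a [lam gm]] := gD m (mem_head _ _).
have [N [e2 e20 H2]] := dirichlet_shift gm x1h x12 eta0.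
exists (map lam (iota 0 N) ++ lams), (Num.min e1 e2).
split; first by rewrite lt_min e10.
move=> tau H y; rewrite inE => /predU1P[->|ys].
  apply: H2 => n nN; have := H (lam n).
  rewrite mem_cat map_f ?mem_iota// => /(_ isT) /le_trans; apply.
  by rewrite ge_min lexx orbT.
apply: H1 => // x xl; have := H x.
rewrite mem_cat xl orbT => /(_ isT) /le_trans; apply.
by rewrite ge_min lexx.
Qed.

Lemma exists_common_bound (M : eqType) (ms : seq M) (Q : M -> R -> Prop) :
  (forall m B B', B <= B' -> Q m B -> Q m B') ->
  (forall m, m \in ms -> exists B, Q m B) ->
  exists2 B : R, 0 <= B & forall m, m \in ms -> Q m B.
Proof.
move=> Qmono; elim: ms => [|m ms IH] H; first by exists 0.
have [B1 B10 H1] := IH (fun y ym => H y (@mem_behead _ (m :: ms) y ym)).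
have [B2 H2] := H m (mem_head _ _).
exists (Num.max B1 B2); first by rewrite le_max B10.
move=> y; rewrite inE => /predU1P[->|ys].
  by apply: Qmono H2; rewrite le_max lexx orbT.
by apply: Qmono (H1 _ ys); rewrite le_max lexx.
Qed.

(** After factoring F = (z-c)^n G, the factor G stays above half of |G(c)| on small circles. *)
Lemma isolated_zero_circle F (c s : C) (rho M : R) : cabs (s - c) < rho / 4 ->
  (forall z, cabs (z - c) < rho -> derivable F z 1) ->
  (forall z, cabs (z - c) < rho -> cabs (F z) <= M) -> F s != 0 ->
  exists r delta : R, [/\ 0 < r, r < rho / 2, 0 < delta &
    forall z, cabs (z - c) = r -> delta <= cabs (F z)].
Proof.
move=> sc Fd FM Fs; have rho0 : 0 < rho by have := cabs_ge0 (s - c); lra.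
have [n [G [Gd Gc GF]]] := isolated_zero sc Fd FM Fs.
have cc : cabs (c - c) < rho by rewrite subrr cabs0.
have Gc0 : 0 < cabs (G c) / 2 by rewrite divr_gt0// cabs_gt0.
have /cplx_continuousP/(_ _ Gc0)[d d0 dP] :=
  cplx_derive_continuous (derivableP (Gd c cc)).
pose r := Num.min (rho / 2) d / 2.
have m0 : 0 < Num.min (rho / 2) d by rewrite lt_min d0 divr_gt0.
have r0 : 0 < r by rewrite divr_gt0.
have m1 : Num.min (rho / 2) d <= rho / 2 by rewrite ge_min lexx.
have m2 : Num.min (rho / 2) d <= d by rewrite ge_min lexx orbT.
have r1 : r < rho / 2 by rewrite /r; lra.
have r2 : r < d by rewrite /r; lra.
exists r, (r ^+ n * (cabs (G c) / 2)); split => //.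
  by rewrite mulr_gt0// exprn_gt0.
move=> z zr; rewrite GF cabsM cabsX zr ler_wpM2l ?exprn_ge0 ?(ltW r0)//.
have := dP z; rewrite zr => /(_ r2); have := cabs_dist_le (G c) (G z).
by rewrite cabs_distC; lra.
Qed.

End DifferentialPolynomial.

Theorem theorem1p1 (R : realType) (L : Cplx R -> Cplx R)
    (L_hol : holomorphic_on (@strip R) L) (L_univ : hybridly_universal L)
    (l : nat) (l_ge1 : (1 <= l)%N) (P : mpoly.mpoly l.+1 (hpfun R))
    (P_coef : P \is a mpoly.mpolyOver l.+1 (@gdirichlet R))
    (P_deg : exists j : 'I_l.+1, (1 <= j)%N /\ (0 < degree_in j P)%N)
    (sigma1 sigma2 : R)
    (sigma1_gt : 2^-1 < sigma1) (sigma12 : sigma1 < sigma2)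
    (sigma2_lt : sigma2 < 1) :
  exists C1 : R, 0 < C1 /\
    \forall T \near +oo,
      more_than (C1 * T) (zeros_in_rect P L sigma1 sigma2 T).
Proof.
have [i [i1 iP]] := P_deg.
pose ms := mpoly.msupp P.
pose e (m : mpoly.multinom l.+1) (j : 'I_l.+1) : nat := m j.
have [m0 m0ms m0i] : exists2 m, m \in ms & (0 < e m i)%N.
  apply: contrapT => H; move: iP; rewrite /degree_in big1_seq// => m /andP[_ mms].
  by apply/eqP; rewrite eqn0Ngt; apply/negP => mi; apply: H; exists m.
have ums : uniq ms by exact: mpoly.msupp_uniq.
have einj : {in ms &, forall m m', e m =1 e m' -> m = m'}.
  by move=> m m' _ _ E; apply/mpoly.mnmP.
pose g m : halfplane R -> Cplx R := mpoly.mcoeff m P.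
pose A m := hpext (g m).
have gD m : m \in ms -> exists a lam, dirichlet_series_of (g m) a lam.
  move=> mms; move: P_coef; rewrite qualifE /= => /allP/(_ _ (map_f _ mms)).
  by move=> /asboolP.
have Ad m s : m \in ms -> 2^-1 < complex.Re s -> derivable (A m) s 1.
  by move=> /gD[a [lam gm]]; exact: derivable_hpext gm s.
have AB m x1 x2 : m \in ms -> 2^-1 < x1 -> x1 <= x2 -> exists B, forall s,
    x1 <= complex.Re s <= x2 -> cabs (A m s) <= B.
  by move=> /gD[a [lam gm]]; exact: dirichlet_bounded gm x1 x2.
(* The coefficient of [m0] is nonzero somewhere in the half-plane; the identity theorem moves such a
   point into the prescribed strip. *)
have [s0 s0R A0] : exists2 s0, sigma1 < complex.Re s0 < sigma2 & A m0 s0 != 0.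
  have : mpoly.mcoeff m0 P != 0 by rewrite -mpoly.mcoeff_msupp.
  move=> g0; have [s gs] : exists s, g m0 s != 0.
    apply: contrapT => H; move/eqP: g0; apply; apply/funext => s.
    by apply/eqP; apply: contrapT => /negP gs; apply: H; exists s.
  apply: (@nonzero_in_strip _ (A m0) sigma1 sigma2 (val s)) => //.
  - by move=> s'; exact: Ad.
  - by move=> x1 x2; exact: AB.
  - exact: (valP s).
  - by rewrite /A hpext_val.
(* The bound 1/4 keeps zeros within a quarter of their cells; the other two keep the disc of radius
   [2 * r] between [sigma1] and [sigma2]. *)
pose rho0 := Num.min 4^-1 (Num.min ((complex.Re s0 - sigma1) / 2)
  ((sigma2 - complex.Re s0) / 2)).
have /andP[s0l s0r] := s0R.
have rho00 : 0 < rho0 by rewrite !lt_min invr_gt0 ltr0n !divr_gt0 ?subr_gt0.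
have s0h : 2^-1 < complex.Re s0 by rewrite (lt_trans sigma1_gt).
have Ac : {for s0, continuous (A m0)}.
  exact: (cplx_derive_continuous (derivableP (Ad m0 s0 m0ms s0h))).
have [r [q [s1 [/andP[r0 rrho] q0 Fs0 s1r Fs1]]]] :=
  interpolant_exists ums einj m0ms m0i i1 Ac A0 rho00.
have r14 : r <= 4^-1 by rewrite (le_trans rrho)// ge_min lexx.
have rl : 2 * r <= complex.Re s0 - sigma1.
  have : r <= (complex.Re s0 - sigma1) / 2.
    by rewrite (le_trans rrho)// /rho0 !ge_min lexx orbT.
  lra.
have rr : 2 * r <= sigma2 - complex.Re s0.
  have : r <= (sigma2 - complex.Re s0) / 2.
    by rewrite (le_trans rrho)// /rho0 !ge_min lexx !orbT.
  lra.
have Re_near z (d : R) : cabs (z - s0) <= d ->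
    complex.Re s0 - d <= complex.Re z <= complex.Re s0 + d.
  move=> zs; have := le_trans (ler_Re_cabs _) zs.
  by rewrite raddfB/= ler_norml; lra.
have [B1 B10 AB1] := @exists_common_bound R _ ms (fun m B => forall s,
    sigma1 <= complex.Re s <= sigma2 -> cabs (A m s) <= B)
  ltac:(by move=> m b b' bb H s /H /le_trans; apply)
  (fun m mms => AB m sigma1 sigma2 mms sigma1_gt (ltW sigma12)).
have [B2 B20 qB2] := @exists_common_bound R _ (index_enum 'I_l.+1)
    (fun j B => forall s, cabs (s - s0) <= r -> cabs (q^`(j).[s]) <= B)
  ltac:(by move=> m b b' bb H s /H /le_trans; apply)
  ltac:(move=> j _; have [B _ BP] := poly_bounded q^`(j) (cabs s0 + r);
    exists B => s ss; apply: BP; have := cabsD s0 (s - s0);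
    rewrite [s0 + _]addrC subrK; clear -ss; lra).
pose B := B1 + B2.
have B0 : 0 <= B by rewrite addr_ge0.
pose F (z : Cplx R) := monsum ms e (A^~ z) (fun j => q^`(j).[z]).
have aB z m : cabs (z - s0) <= r -> m \in ms -> cabs (A m z) <= B.
  move=> /Re_near zr mms; rewrite (le_trans (AB1 _ mms z _)) ?lerDl//.
  by clear -zr rl rr r0; lra.
have qB z (j : 'I_l.+1) : cabs (z - s0) <= r -> cabs (q^`(j).[z]) <= B.
  by move=> zr; rewrite (le_trans (qB2 j _ z zr)) ?lerDr// mem_index_enum.
have [D DP] := monsum_bounded ms e B0.
have Fd (z : Cplx R) : cabs (z - s0) < r -> derivable F z 1.
  move=> /ltW/Re_near zr.
  apply: (@derivable_monsum _ _ _ ms e A (fun j z => q^`(j).[z])) => [m mms|j].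
    by apply: Ad => //; clear -zr rl r0 sigma1_gt; lra.
  by have [] := cplx_is_derive_horner q^`(j) z.
have FM (z : Cplx R) : cabs (z - s0) < r -> cabs (F z) <= D.
  by move=> /ltW zr; apply: DP => [m|j]; [exact: aB|exact: qB].
have [r1 [delta [r10 r1r delta0 Fdelta]]] := isolated_zero_circle s1r Fd FM Fs1.
(* An error of [delta / 4] leaves the shifted function at least [3 * delta / 4] on the circle and at
   most [delta / 4] at the centre, so [delta / 2] separates the two. *)
have [eta eta0 etaP] := @monsum_uniformly_continuous _ _ _ ms e B (delta / 4)
  B0 ltac:(clear -delta0; lra).
have [lams [eta' [eta'0 shiftP]]] := @dirichlet_family_shift R _ ms g
  sigma1 sigma2 eta gD sigma1_gt (ltW sigma12) eta0.
have [k [alpha [alpha_ind [eps1 eps10 eps1P]]]] := almost_period lams eta'0.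
(* At most [l] differentiations, each costing [d], use less than [r / 2] of radius, and [r1 < r / 2]
   remains covered. *)
pose d := r / (2 * l.+1%:R).
have l0 : 0 < l.+1%:R :> R by rewrite ltr0n.
have d0 : 0 < d by rewrite divr_gt0// mulr_gt0.
pose K := \sum_(n < l.+1) (2 / d) ^+ n + 1.
have K0 : 0 < K.
  by rewrite ltr_wpDl// sumr_ge0// => n _; rewrite exprn_ge0// divr_ge0// ltW.
pose eps := Num.min (eta / K) eps1.
have eps0 : 0 < eps by rewrite lt_min divr_gt0.
have univ := L_univ (square s0 r) (horner q) (@compact_square R s0 r).
have sq_strip : square s0 r `<=` @strip R.
  move=> z [h _]; move: h; rewrite raddfB/= ler_norml /strip/= => h.
  by apply/andP; clear -h rl rr r0 sigma1_gt sigma2_lt; lra.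
have qc : {within square s0 r, continuous (horner q)}.
  apply: continuous_subspaceT => z.
  exact: (cplx_derive_continuous (cplx_is_derive_horner q z)).
have qn0 z : square s0 r z -> q.[z] != 0 by move=> /cabs_square /q0.
have qh : holomorphic_on ((square s0 r)^°)%classic (horner q).
  by move=> z _; have [] := cplx_is_derive_horner q z.
have {}univ := univ sq_strip (@connected_square_setC R s0 r) qc qn0 qh k alpha
  (fun=> 0) eps alpha_ind eps0.
have [c c0 cP] := limf_einf_gt0 univ.
set X := hybrid_approx _ _ _ _ _ _ in cP.
have zero tau : X tau -> exists s : halfplane R, [/\ diff_poly P L s = 0,
    sigma1 < complex.Re (val s) < sigma2 &
    `|complex.Im (val s) - complex.Im s0 - tau| <= 4^-1].
  move=> [Xf Xd]; pose t : Cplx R := 0 +i* tau.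
  have Ret z : complex.Re (z + t) = complex.Re z by rewrite raddfD /= addr0.
  have sh : forall m, m \in ms -> forall s, sigma1 <= complex.Re s <= sigma2 ->
      cabs (A m (s + t) - A m s) <= eta.
    apply: shiftP; apply: eps1P => j; have := Xd j.
    by rewrite subr0 lt_min => /andP[].
  have strip_open z : @strip R z -> exists2 d : R, 0 < d &
      forall w, cabs (w - z) < d -> @strip R w.
    move=> /andP[z1 z2].
    exists (Num.min (complex.Re z - 2^-1) (1 - complex.Re z)).
      by rewrite lt_min !subr_gt0 z1.
    move=> w; rewrite lt_min => /andP[w1 w2].
    have := ler_Re_cabs (w - z); rewrite raddfB/= ler_norml => h.
    by apply/andP; clear -h w1 w2; lra.
  have Ld n z : @strip R z -> derivable (derive1n n L) z 1.
    exact: (derivable_derive1n strip_open L_hol).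
  have in_strip z : cabs (z - s0) <= r -> @strip R (z + t).
    move=> /Re_near zr; rewrite /strip/= Ret; apply/andP.
    by clear -zr rl rr r0 sigma1_gt sigma2_lt; lra.
  (* Universality bounds [E 0]; iterated Cauchy estimates then bound the errors of all derivatives
     up to order [l]. *)
  pose E (n : nat) (z : Cplx R) : Cplx R := derive1n n L (z + t) - q^`(n).[z].
  have Ed n (z : Cplx R) : cabs (z - s0) < r -> is_derive z 1 (E n) (E n.+1 z).
    move=> /ltW/in_strip zt; apply: cplx_is_deriveB.
      apply: cplx_is_derive_shift; rewrite derive1nS derive1E.
      exact/derivableP/Ld.
    by rewrite derivnS; exact: cplx_is_derive_horner.
  have E0 (z : Cplx R) : cabs (z - s0) < r -> cabs (E 0%N z) <= eps.
    move=> /ltW/ball_square/Xf; rewrite cplx_normE ltcR => /ltW.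
    by rewrite /E derive1n0 derivn0.
  have Eb (n : 'I_l.+1) (z : Cplx R) : cabs (z - s0) <= r1 -> cabs (E n z) <= eta.
    move=> zr; rewrite (le_trans (iterated_cauchy d0 Ed E0 _))//.
      have nd : n%:R * d <= r / 2.
        have -> : r / 2 = l.+1%:R * d by rewrite /d; field; rewrite gt_eqF.
        by rewrite ler_wpM2r ?(ltW d0)// ler_nat ltnW.
      by rewrite (le_lt_trans zr)//; clear -r1r nd; lra.
    have nK : (2 / d) ^+ n <= K.
      rewrite /K (bigD1 n)//= -addrA lerDl addr_ge0// sumr_ge0// => m _.
      by rewrite exprn_ge0// divr_ge0// ltW.
    rewrite (le_trans (ler_wpM2r (ltW eps0) nK))// mulrC -ler_pdivlMr//.
    by rewrite ge_min lexx.
  pose Ft (z : Cplx R) := monsum ms e (fun m => A m (z + t)) (fun j => derive1n j L (z + t)).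
  have FtF (z : Cplx R) : cabs (z - s0) <= r1 -> cabs (Ft z - F z) <= delta / 4.
    move=> zr1; have zr : cabs (z - s0) <= r by clear -zr1 r1r r0; lra.
    apply: etaP.
    - by move=> m; exact: aB.
    - by move=> j; exact: qB.
    - move=> m mms; apply: sh => //; have := Re_near _ _ zr.
      by clear -rl rr r0; lra.
    - by move=> j; exact: Eb.
  have Ftd (z : Cplx R) : cabs (z - s0) <= r1 -> derivable Ft z 1.
    move=> zr1; have zr : cabs (z - s0) <= r by clear -zr1 r1r r0; lra.
    apply: (@derivable_monsum _ _ _ ms e (fun m z => A m (z + t))
      (fun j z => derive1n j L (z + t))) => [m mms|j].
      have : derivable (A m) (z + t) 1.
        apply: Ad => //; rewrite Ret; have := Re_near _ _ zr.
        by clear -rl r0 sigma1_gt; lra.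
      by move=> /derivableP/cplx_is_derive_shift[].
    have /derivableP/cplx_is_derive_shift[] := Ld j _ (in_strip z zr).
    by [].
  have [z zr1 Fz] : exists2 z, cabs (z - s0) <= r1 & Ft z = 0.
    apply: (@zero_in_disc _ Ft s0 r1 (delta / 2) r10 Ftd) => [z zr|].
      have := FtF z; rewrite zr => /(_ (lexx _)); have := Fdelta z zr.
      have := cabs_dist_le (F z) (Ft z); rewrite cabs_distC.
      by clear -delta0; lra.
    have := FtF s0; rewrite subrr cabs0 => /(_ (ltW r10)).
    by rewrite /F Fs0 subr0; clear -delta0; lra.
  have zr : cabs (z - s0) <= r by clear -zr1 r1r r0; lra.
  have zh : 2^-1 < complex.Re (z + t) by case/andP: (in_strip z zr).
  exists (Sub (z + t) zh); split.
  - by rewrite diff_polyE.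
  - by rewrite /= Ret; have := Re_near _ _ zr; clear -rl rr r0; lra.
  - rewrite (_ : _ - tau = complex.Im (z - s0)); last first.
      by rewrite /= raddfD raddfB /=; ring.
    by rewrite (le_trans (ler_Im_cabs _))// (le_trans zr).
(* Cells at distance [k0] from both ends give zeros whose ordinates, moved by Im s0 and at most 1/4,
   stay between 0 and [T]. *)
pose k0 := Num.bound (`|complex.Im s0| + 1).
have k0P : `|complex.Im s0| + 1 < k0%:R by apply: archi_boundP; rewrite addr_ge0.
(* One half is lost to the parity choice, the other absorbs the constant [2 * k0 + 1] for large
   [T]. *)
exists (c / 4); split; first by rewrite divr_gt0.
near=> T.
have T1 : 2 * k0%:R + 1 <= T by near: T; exact: nbhs_pinfty_ge.
have T2 : (4 * k0%:R + 2) / c < T by near: T; apply: nbhs_pinfty_gt; exact: num_real.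
have T3 : (c%:E <= nu T X)%E by near: T.
have [ks [uks sks ksP]] := many_cells c0 T1 T3.
have [ks' [uks' sub sks' gap]] := parity_class uks.
have /choice[Z ZP] n : exists s : halfplane R, n \in ks ->
    [/\ diff_poly P L s = 0, sigma1 < complex.Re (val s) < sigma2 &
      n%:R - 4^-1 <= complex.Im (val s) - complex.Im s0 <= n%:R + 1 + 4^-1].
  have [nks|] := boolP (n \in ks); last by exists point.
  have [_ _ [tau Xtau ntau]] := ksP n nks.
  have [s [h1 h2 h3]] := zero tau Xtau; exists s => _; split => //.
  by move: h3; rewrite ler_norml; clear -ntau; lra.
exists (map Z ks'); split.
- rewrite map_inj_in_uniq// => n n' nks n'ks Znn'.
  wlog nn' : n n' nks n'ks Znn' / (n <= n')%N.
    by move=> H; case: (leqP n n') => [/H|/ltnW/H H']; [exact|exact/esym/H'].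
  apply/eqP; rewrite eqn_leq nn' leqNgt; apply/negP => {}nn'.
  (* The kept cells start at least 2 apart, and [n + 1 + 1/4 < n + 2 - 1/4], so their zeros
     differ. *)
  have := gap _ _ nks n'ks nn'; rewrite -(ler_nat R).
  have -> : n.+2%:R = n%:R + 2 :> R by rewrite -natrD addn2.
  have [_ _] := ZP n (sub n nks); have [_ _] := ZP n' (sub n' n'ks).
  rewrite Znn'; clear; lra.
- rewrite size_map.
  have s1' : (size ks)%:R <= 2 * (size ks')%:R :> R by rewrite -natrM ler_nat.
  by move: T2; rewrite ltr_pdivrMr// => T2; clear -s1' sks T2; lra.
- move=> s /mapP[n nks ->]; have nks' := sub n nks.
  have [h1 h2 h3] := ZP n nks'; have [n0 nT _] := ksP n nks'.
  split => //.
  have : k0%:R <= n%:R :> R by rewrite ler_nat.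
  have := ler_norm (complex.Im s0); have := ler_norm (- complex.Im s0).
  by rewrite normrN; clear -h3 nT k0P; lra.
Unshelve. all: by end_near. Qed.
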